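(* Let $m=2$, let $u,v$ be the columns of $\mathcal{B}$, so that $I=\langle\partial^{u_+}-\partial^{u_-},\partial^{v_+}-\partial^{v_-}\rangle$, and let $\alpha\in\mathbb{N}^n$ satisfy: $\alpha_i>0\Rightarrow u_i>0$. Then for generic $c\in\mathbb{C}^n$, every holomorphic solution of the left $D_n$-ideal $D_nI+D_n\langle\partial^\alpha\rangle+\langle A\theta-Ac\rangle$ is a Puiseux polynomial.
   Context: $\mathcal{B}\in\mathbb{Z}^{n\times2}$ ($n>2$) of rank 2 with rows summing to zero; $A=(a_{kj})\in\mathbb{Z}^{(n-2)\times n}$ of rank $n-2$, first row all ones, $A\mathcal{B}=0$. For $w\in\mathbb{Z}^n$, $w=w_+-w_-$ with $w_\pm\ge0$ of disjoint supports. $\langle A\theta-Ac\rangle$ is the left ideal generated by $\sum_ja_{kj}x_j\partial_j-(Ac)_k$. A Puiseux polynomial is a finite linear combination of monomials $x^p$, $p\in\mathbb{C}^n$. Generic: outside an exceptional measure-zero set. *)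

(* Defs.v *)
From Stdlib Require Import Reals ClassicalEpsilon.
From Coquelicot Require Import Coquelicot.
From mathcomp Require Import all_boot all_order all_algebra.

Set Implicit Arguments.
Unset Strict Implicit.
Unset Printing Implicit Defensive.

Definition intR (z : int) : R :=
  match z with Posz k => INR k | Negz k => Ropp (INR k.+1) end.
Definition intC (z : int) : C := RtoC (intR z).

Definition intpos (z : int) : nat := match z with Posz k => k | Negz _ => 0%N end.
Definition intneg (z : int) : nat := match z with Posz _ => 0%N | Negz k => k.+1 end.

Definition qrank m k (M : 'M[int]_(m, k)) : nat :=
  \rank (map_mx (fun z : int => (z%:~R : rat)) M).

Definition Csum n (F : 'I_n -> C) : C :=
  foldr (fun j acc => Cplus (F j) acc) (RtoC 0) (enum 'I_n).

Definition cexp (z : C) : C :=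
  (Rmult (exp (Re z)) (cos (Im z)), Rmult (exp (Re z)) (sin (Im z))).

Definition is_cderiv (g : C -> C) (z l : C) : Prop :=
  forall eps : R, Rlt 0 eps -> exists delta : R, Rlt 0 delta /\
    forall h : C, h <> RtoC 0 -> Rlt (Cmod h) delta ->
      Rlt (Cmod (Cminus (Cdiv (Cminus (g (Cplus z h)) (g z)) h) l)) eps.

Definition ccont (g : C -> C) (z : C) : Prop :=
  forall eps : R, Rlt 0 eps -> exists delta : R, Rlt 0 delta /\
    forall w : C, Rlt (Cmod (Cminus w z)) delta -> Rlt (Cmod (Cminus (g w) (g z))) eps.

Definition upd n (x : 'I_n -> C) (j : 'I_n) (t : C) : 'I_n -> C :=
  fun i => if i == j then t else x i.

Definition polydisc n (a : 'I_n -> C) (r : 'I_n -> R) (x : 'I_n -> C) : Prop :=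
  forall j, Rlt (Cmod (Cminus (x j) (a j))) (r j).

(* polydisc contained in the torus (C^* )^n *)
Definition torus_polydisc n (a : 'I_n -> C) (r : 'I_n -> R) : Prop :=
  forall j, Rlt 0 (r j) /\ Rle (r j) (Cmod (a j)).

(* holomorphic on an open set U of C^n (Osgood): continuous and
   holomorphic in each variable separately *)
Definition holomorphic_on n (U : ('I_n -> C) -> Prop) (f : ('I_n -> C) -> C) : Prop :=
  (forall x, U x -> forall eps : R, Rlt 0 eps -> exists delta : R, Rlt 0 delta /\
     forall y, (forall j, Rlt (Cmod (Cminus (y j) (x j))) delta) ->
       Rlt (Cmod (Cminus (f y) (f x))) eps)
  /\ (forall x, U x -> forall j, exists l, is_cderiv (fun t => f (upd x j t)) (x j) l).

(* partial derivative d/dx_j (the value of the complex derivative where it exists) *)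
Definition pderiv n (j : 'I_n) (f : ('I_n -> C) -> C) : ('I_n -> C) -> C :=
  fun x => epsilon (inhabits (RtoC 0)) (fun l => is_cderiv (fun t => f (upd x j t)) (x j) l).

Definition dpow n (beta : 'I_n -> nat) (f : ('I_n -> C) -> C) : ('I_n -> C) -> C :=
  foldr (fun j g => iter (beta j) (pderiv j) g) f (enum 'I_n).

(* f is a holomorphic solution on U of the left ideal
   D I + D <d^alpha> + <A theta - A c>, where I = <d^{u+}-d^{u-}, d^{v+}-d^{v-}>,
   u, v the columns of B: f is annihilated by all the generators. *)
Definition is_solution n (A : 'M[int]_(n - 2, n)) (B : 'M[int]_(n, 2))
    (alpha : 'I_n -> nat) (c : 'I_n -> C)
    (U : ('I_n -> C) -> Prop) (f : ('I_n -> C) -> C) : Prop :=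
  holomorphic_on U f /\
  forall x, U x ->
    (forall col : 'I_2,
       dpow (fun i => intpos (B i col)) f x = dpow (fun i => intneg (B i col)) f x)
    /\ dpow alpha f x = RtoC 0
    /\ (forall k : 'I_(n - 2),
         Cminus (Csum (fun j => Cmult (Cmult (intC (A k j)) (x j)) (pderiv j f x)))
                (Cmult (Csum (fun j => Cmult (intC (A k j)) (c j))) (f x)) = RtoC 0).

(* f is a Puiseux polynomial on the polydisc (a, r): f = sum_p kappa_p x^p with
   finitely many p in C^n, where x_j^{p_j} = exp(p_j log x_j) for a continuous
   branch of log on the j-th coordinate disc. *)
Definition puiseux_on n (a : 'I_n -> C) (r : 'I_n -> R) (f : ('I_n -> C) -> C) : Prop :=
  exists (L : seq (C * ('I_n -> C))) (lg : 'I_n -> C -> C),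
    (forall j z, Rlt (Cmod (Cminus z (a j))) (r j) -> cexp (lg j z) = z /\ ccont (lg j) z)
    /\ forall x, polydisc a r x ->
       f x = foldr (fun kp acc => Cplus (Cmult kp.1
                    (cexp (Csum (fun j => Cmult (kp.2 j) (lg j (x j)))))) acc)
                   (RtoC 0) L.

Definition null_set n (E : ('I_n -> C) -> Prop) : Prop :=
  forall eps : R, Rlt 0 eps ->
    exists (z : nat -> 'I_n -> C) (s : nat -> R),
      (forall k, Rlt 0 (s k)) /\
      (forall x, E x -> exists k, forall j,
          Rlt (Rabs (Re (Cminus (x j) (z k j)))) (s k) /\
          Rlt (Rabs (Im (Cminus (x j) (z k j)))) (s k)) /\
      (forall N, Rlt (sum_f_R0 (fun k => pow (Rmult 2 (s k)) (2 * n)) N) eps).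

(* Main.v *)
(** Write theta_j = x_j d_j. Since x^beta d^beta is the product of the factors theta_j - l (l < beta_j),
    d^alpha f = 0 makes f annihilated by a product of factors theta_i - l with u_i > 0. Moreover
    d^(u-) f = d^(u+) f yields d^(k u-) f = d^(k u+) f for all k, and the latter is 0 for large k because
    k u+ >= alpha; so f is also annihilated by a product of factors theta_j - l with u_j < 0.
    The Euler equations say that sum_j w_j theta_j f = (sum_j w_j c_j) f for every integer vector w with
    w B = 0. Hence two factors of different kinds together determine all theta_k f (or force f = 0, when
    the rows i and j of B are proportional), and for c outside the countably many hyperplanes w.c = m
    no joint eigenvalue lies on three of the lines theta_i = l with distinct i. Peeling off the factors
    one at a time therefore writes f as a finite sum of joint eigenfunctions of the theta_k, and these
    are multiples of monomials x^p.

    Iterating derivatives of f requires that partial derivatives of separately holomorphic continuous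
    functions are again such and commute; this follows from Goursat's theorem through the formula
    2 pi g'(0) = int_0^(2 pi) (g(rho e^(it)) - g(0)) / (rho e^(it)) dt. *)

Require Import Defs.
From Stdlib Require Import Reals.
From Coquelicot Require Import Coquelicot.
From mathcomp Require Import all_boot all_order all_algebra.
From Stdlib Require Import Lra Lia Classical ClassicalEpsilon FunctionalExtensionality PropExtensionality Cantor.
From mathcomp Require Import zify.

Delimit Scope R_scope with Rs.
Local Open Scope R_scope.

(** * Complex differentiability *)

(** The relations w B = 0 confine the joint eigenvalue p of a nonzero joint eigenfunction to the
    plane c + B C^2; with p = c + B z, the condition p_i = l is an affine line in z whose normal is
    the i-th row of B. A line with u_i > 0 and a line with u_j < 0 meet in one point unless the two
    rows are proportional. The danger in peeling is a logarithm. If h is an eigenfunction, (theta_i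
    - l) g = h is solved by a multiple of h as long as p_i <> l, whereas p_i = l with h nonzero
    calls for h log x_i. The eigenfunctions to be inverted already lie on two lines, so such a
    coincidence either puts p on three lines with distinct indices, or repeats an index; two
    different values l for one index exclude each other, so only the first case needs genericity. *)

Definition cdiff (g : C -> C) (z l : C) : Prop :=
  is_derive (K := C_AbsRing) (V := AbsRing_NormedModule C_AbsRing) g z l.

(** The working form has no quotient, so h = 0 is no exception. Defining [cdiff] by [is_derive] over
    C supplies the sum, product and chain rules; [is_cderivP] connects it with the difference
    quotients of the statement. *)
Lemma cdiffP g z l : cdiff g z l <-> forall eps, 0 < eps -> exists d, 0 < d /\
  forall h, Cmod h < d -> Cmod (g (z + h)%C - g z - l * h)%C <= eps * Cmod h.
Proof.
split.
- move=> [_ H] eps He.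
  have [d Hd] := H z (fun P HP => HP) (mkposreal _ He).
  exists d; split; first exact: cond_pos.
  move=> h Hh.
  have E : Cminus (z + h)%C z = h by ring.
  have H1 : Cmod (Cminus (z + h)%C z) < d by rewrite E.
  have := Hd (z + h)%C H1.
  change (Cmod (Cminus (Cminus (g (z + h)%C) (g z)) (Cmult (Cminus (z + h)%C z) l)) <=
    eps * Cmod (Cminus (z + h)%C z) -> Cmod (g (z + h)%C - g z - l * h)%C <= eps * Cmod h).
  by rewrite E (Cmult_comm h l).
- move=> H; split; first exact: is_linear_scal_l.
  move=> x Hx eps.
  have -> : x = z.
    symmetry. apply: (is_filter_lim_locally_unique (K:=C_AbsRing) (V:= AbsRing_NormedModule C_AbsRing)). exact: Hx.
  have [d [Hd0 Hd]] := H eps (cond_pos eps).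
  exists (mkposreal _ Hd0) => y Hy.
  have H1 : Cmod (y - z)%C < d := Hy.
  have := Hd (y - z)%C H1.
  have -> : (z + (y - z) = y)%C by ring.
  change (Cmod (g y - g z - l * (y - z))%C <= eps * Cmod (y - z)%C ->
    Cmod (Cminus (Cminus (g y) (g z)) (Cmult (y - z)%C l)) <= eps * Cmod (y - z)%C).
  by rewrite (Cmult_comm l).
Qed.

Lemma cdiff_ext f g z l : (forall w, f w = g w) -> cdiff f z l -> cdiff g z l.
Proof. move=> E; exact: (@is_derive_ext C_AbsRing (AbsRing_NormedModule C_AbsRing)). Qed.

Lemma cdiff_ext_loc f g z l d : 0 < d -> (forall h, Cmod h < d -> f (z + h)%C = g (z + h)%C) ->
  cdiff f z l -> cdiff g z l.
Proof.
move=> Hd E; apply: is_derive_ext_loc; exists (mkposreal _ Hd) => y Hy.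
have := E (y - z)%C Hy.
by have -> : (z + (y - z) = y)%C by ring.
Qed.

Lemma cdiff_const (k z : C) : cdiff (fun _ => k) z 0%C.
Proof. exact: is_derive_const. Qed.
Lemma cdiff_id z : cdiff (fun w => w) z 1%C.
Proof. exact: is_derive_id. Qed.
Lemma cdiff_plus f g z l m : cdiff f z l -> cdiff g z m -> cdiff (fun w => f w + g w)%C z (l + m)%C.
Proof. exact: is_derive_plus. Qed.
Lemma cdiff_minus f g z l m : cdiff f z l -> cdiff g z m -> cdiff (fun w => f w - g w)%C z (l - m)%C.
Proof. exact: is_derive_minus. Qed.
Lemma cdiff_mult f g z l m : cdiff f z l -> cdiff g z m -> cdiff (fun w => f w * g w)%C z (l * g z + f z * m)%C.
Proof. move=> H1 H2; apply: (is_derive_mult f g z l m H1 H2). exact: Cmult_comm. Qed.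
Lemma cdiff_comp f g z l m : cdiff f (g z) l -> cdiff g z m -> cdiff (fun w => f (g w)) z (m * l)%C.
Proof. exact: is_derive_comp. Qed.
Lemma cdiff_scal (k : C) g z m : cdiff g z m -> cdiff (fun w => k * g w)%C z (k * m)%C.
Proof.
move=> H; have := cdiff_mult _ _ _ _ _ (cdiff_const k z) H.
by have -> : (0 * g z + k * m = k * m)%C by ring.
Qed.

Lemma cdiff_unique f z l m : cdiff f z l -> cdiff f z m -> l = m.
Proof.
move=> H1 H2.
apply: NNPP => N.
have N0 : 0 < Cmod (l - m)%C.
  by apply/Cmod_gt_0 => E; apply: N; have -> : (l = (l - m) + m)%C by [ring|]; rewrite E Cplus_0_l.
move/cdiffP: H1 => /(_ (Cmod (l - m)%C / 3) ltac:(lra)) [d1 [D1 E1]].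
move/cdiffP: H2 => /(_ (Cmod (l - m)%C / 3) ltac:(lra)) [d2 [D2 E2]].
have D : 0 < Rmin d1 d2 / 2 by have := Rmin_glb_lt _ _ _ D1 D2; lra.
have M1 := Rmin_l d1 d2; have M2 := Rmin_r d1 d2.
set h := RtoC (Rmin d1 d2 / 2).
have Hh : Cmod h = Rmin d1 d2 / 2 by rewrite Cmod_R Rabs_pos_eq; lra.
have := E1 h ltac:(lra); have := E2 h ltac:(lra).
have := Cmod_triangle (f (z + h)%C - f z - m * h)%C (- (f (z + h)%C - f z - l * h))%C.
rewrite Cmod_opp.
have -> : (f (z + h) - f z - m * h + - (f (z + h) - f z - l * h) = (l - m) * h)%C by ring.
rewrite Cmod_mult Hh; nra.
Qed.

(** * The complex exponential and its derivative *)

Lemma cexp_add (z w : C) : cexp (z + w)%C = (cexp z * cexp w)%C.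
Proof.
case: z => a b; case: w => c d; rewrite /cexp /Cmult /Cplus /= exp_plus cos_plus sin_plus.
by congr pair; ring.
Qed.

Lemma cexp_0 : cexp 0%C = 1%C.
Proof. by rewrite /cexp /= exp_0 cos_0 sin_0 Rmult_1_l Rmult_0_r. Qed.

Lemma Cmod_cexp z : Cmod (cexp z) = exp (Re z).
Proof.
rewrite /Cmod /cexp /=.
have -> : exp (Re z) * cos (Im z) * (exp (Re z) * cos (Im z) * 1) +
  exp (Re z) * sin (Im z) * (exp (Re z) * sin (Im z) * 1) = Rsqr (exp (Re z)).
  have := sin2_cos2 (Im z); rewrite /Rsqr => E.
  transitivity (exp (Re z) * exp (Re z) * (sin (Im z) * sin (Im z) + cos (Im z) * cos (Im z))); first ring.
  rewrite E; ring.
apply: sqrt_Rsqr; apply: Rlt_le; exact: exp_pos.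
Qed.

Lemma cexp_neq0 z : cexp z <> 0%C.
Proof. apply/Cmod_gt_0; rewrite Cmod_cexp; exact: exp_pos. Qed.

Lemma Cmod_le_Re_Im z : Cmod z <= Rabs (Re z) + Rabs (Im z).
Proof.
have -> : z = (RtoC (Re z) + Ci * RtoC (Im z))%C.
  by case: z => a b; rewrite /Cplus /Cmult /=; congr pair; ring.
apply: Rle_trans (Cmod_triangle _ _) _.
rewrite Cmod_mult Cmod_Ci !Cmod_R /=; apply: Req_le; congr (Rabs _ + _); first ring.
rewrite Rmult_1_l; congr Rabs; ring.
Qed.

Lemma derive_eps (f : R -> R) x l : derivable_pt_lim f x l ->
  forall eps, 0 < eps -> exists d, 0 < d /\ forall h, Rabs h < d ->
    Rabs (f (x + h) - f x - l * h) <= eps * Rabs h.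
Proof.
move=> H eps He; have [d Hd] := H eps He.
exists d; split; first exact: cond_pos.
move=> h Hh; case: (Req_dec h 0) => [->|h0].
  by rewrite Rplus_0_r Rmult_0_r Rminus_0_r Rminus_diag Rabs_R0 Rmult_0_r; lra.
have := Hd h h0 Hh.
have -> : f (x + h) - f x - l * h = ((f (x + h) - f x) / h - l) * h by field.
rewrite Rabs_mult => H1; apply: Rmult_le_compat_r; [exact: Rabs_pos|lra].
Qed.

Lemma cdiff_cexp0 : cdiff cexp 0%C 1%C.
Proof.
apply/cdiffP => eps He.
have [d1 [Hd1 E1]] := derive_eps _ _ _ (derivable_pt_lim_exp 0) (Rmin 1 (eps/6)) ltac:(apply: Rmin_glb_lt; lra).
have [d2 [Hd2 E2]] := derive_eps _ _ _ (derivable_pt_lim_cos 0) (eps/12) ltac:(lra).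
have [d3 [Hd3 E3]] := derive_eps _ _ _ (derivable_pt_lim_sin 0) (Rmin 1 (eps/12)) ltac:(apply: Rmin_glb_lt; lra).
(* Most errors are linear in m = |h| with coefficients eps/6, 3 eps/12 and eps/12. The cross term
   (exp s - 1) sin t is only bounded by 4 m^2, and d <= eps/12 turns this into m eps/3. *)
pose d := Rmin (Rmin 1 (eps/12)) (Rmin d1 (Rmin d2 d3)).
have D0 : 0 < d by do ![apply: Rmin_glb_lt]; lra.
have [D1 [D1' [D2 [D3 D4]]]] : d <= 1 /\ d <= eps/12 /\ d <= d1 /\ d <= d2 /\ d <= d3.
  have := Rmin_l 1 (eps/12); have := Rmin_r 1 (eps/12).
  have := Rmin_l d2 d3; have := Rmin_r d2 d3.
  have := Rmin_l d1 (Rmin d2 d3); have := Rmin_r d1 (Rmin d2 d3).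
  have := Rmin_l (Rmin 1 (eps/12)) (Rmin d1 (Rmin d2 d3)).
  have := Rmin_r (Rmin 1 (eps/12)) (Rmin d1 (Rmin d2 d3)).
  rewrite -/d; lra.
exists d; split=> // -[s t] Hh.
have M := Rmax_Cmod (s, t); rewrite /= in M.
have Hs : Rabs s <= Cmod (s, t) := Rle_trans _ _ _ (Rmax_l _ _) M.
have Ht : Rabs t <= Cmod (s, t) := Rle_trans _ _ _ (Rmax_r _ _) M.
set m := Cmod (s, t) in M Hh Hs Ht *.
have m0 : 0 <= m := Cmod_ge_0 _.
have s0 := Rabs_pos s; have t0 := Rabs_pos t.
have := E1 s ltac:(lra); have := E2 t ltac:(lra); have := E3 t ltac:(lra).
rewrite !Rplus_0_l exp_0 cos_0 sin_0 => F3 F2 F1.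
rewrite Cplus_0_l cexp_0.
apply: Rle_trans (Cmod_le_Re_Im _) _; rewrite /Re /Im /cexp /=.
have -> : exp s * cos t + - (1) + - (1 * s - 0 * t) =
  (exp s - 1 - 1 * s) + exp s * (cos t - 1 - - 0 * t) by ring.
have -> : exp s * sin t + - 0 + - (1 * t + 0 * s) =
  (exp s - 1) * sin t + (sin t - 0 - 1 * t) by ring.
have G1 : Rabs (exp s - 1 - 1 * s) <= eps / 6 * Rabs s.
  by apply: Rle_trans F1 _; apply: Rmult_le_compat_r => //; exact: Rmin_r.
have G1' : Rabs (exp s - 1 - 1 * s) <= 1 * Rabs s.
  by apply: Rle_trans F1 _; apply: Rmult_le_compat_r => //; exact: Rmin_l.
have G3 : Rabs (sin t - 0 - 1 * t) <= eps / 12 * Rabs t.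
  by apply: Rle_trans F3 _; apply: Rmult_le_compat_r => //; exact: Rmin_r.
have G3' : Rabs (sin t - 0 - 1 * t) <= 1 * Rabs t.
  by apply: Rle_trans F3 _; apply: Rmult_le_compat_r => //; exact: Rmin_l.
have K1 : Rabs (exp s - 1) <= 2 * m.
  have -> : exp s - 1 = (exp s - 1 - 1 * s) + s by ring.
  apply: Rle_trans (Rabs_triang _ _) _; lra.
have K2 : Rabs (sin t) <= 2 * m.
  have -> : sin t = (sin t - 0 - 1 * t) + t by ring.
  apply: Rle_trans (Rabs_triang _ _) _; lra.
have K3 : Rabs (exp s) <= 3.
  have -> : exp s = (exp s - 1) + 1 by ring.
  apply: Rle_trans (Rabs_triang _ _) _; rewrite Rabs_R1; lra.
apply: Rle_trans (Rplus_le_compat _ _ _ _ (Rabs_triang _ _) (Rabs_triang _ _)) _.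
rewrite !Rabs_mult.
have := Rabs_pos (exp s); have := Rabs_pos (exp s - 1); have := Rabs_pos (sin t).
have := Rabs_pos (cos t - 1 - - 0 * t).
move=> P1 P2 P3 P4.
have Q1 : Rabs (exp s) * Rabs (cos t - 1 - - 0 * t) <= 3 * (eps/12 * m).
  apply: Rmult_le_compat => //; nra.
have Q2 : Rabs (exp s - 1) * Rabs (sin t) <= (2 * m) * (2 * m) by apply: Rmult_le_compat.
have Q3 : 2 * m * (2 * m) <= eps / 3 * m by nra.
nra.
Qed.

Lemma cdiff_cexp z : cdiff cexp z (cexp z).
Proof.
have H : cdiff (fun w => cexp z * cexp (w - z))%C z (cexp z * ((1 - 0) * 1))%C.
  apply: cdiff_scal; apply: cdiff_comp; last by apply: cdiff_minus (cdiff_id _) (cdiff_const _ _).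
  have -> : (z - z = 0)%C by ring.
  exact: cdiff_cexp0.
have E : (cexp z * ((1 - 0) * 1) = cexp z)%C by ring.
rewrite E in H; apply: cdiff_ext H => w.
by rewrite -cexp_add; congr cexp; ring.
Qed.

Lemma is_cderivP g z l : is_cderiv g z l <-> cdiff g z l.
Proof.
split.
- move=> H; apply/cdiffP => eps He; have [d [Hd0 Hd]] := H eps He.
  exists d; split=> // h Hh.
  case: (Ceq_dec h 0%C) => [->|h0].
    have -> : (g (z + 0) - g z - l * 0 = 0)%C by rewrite Cplus_0_r; ring.
    by rewrite Cmod_0; lra.
  have := Hd h h0 Hh => H1.
  have -> : (g (z + h) - g z - l * h = ((g (z + h) - g z) / h - l) * h)%C by field.
  rewrite Cmod_mult; apply: Rmult_le_compat_r; [exact: Cmod_ge_0|lra].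
- move=> /cdiffP H eps He; have [d [Hd0 Hd]] := H (eps/2) ltac:(lra).
  exists d; split=> // h h0 Hh; have := Hd h Hh.
  have -> : (g (z + h) - g z - l * h = ((g (z + h) - g z) / h - l) * h)%C by field.
  have P : 0 < Cmod h by apply/Cmod_gt_0.
  rewrite Cmod_mult => H1; have := Rmult_le_reg_r _ _ _ P H1; lra.
Qed.

(** * Goursat's theorem *)

Definition cont_real (g : R -> C) (x : R) : Prop :=
  forall eps, 0 < eps -> exists d, 0 < d /\ forall y, Rabs (y - x) < d -> Cmod (g y - g x)%C < eps.

Definition Cint (g : R -> C) (a b : R) : C := RInt (V := C_R_CompleteNormedModule) g a b.

Definition is_Cint (g : R -> C) (a b : R) (l : C) : Prop :=
  is_RInt (V := C_R_CompleteNormedModule) g a b l.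

Lemma cont_real_ex g a b : a <= b -> (forall x, a <= x <= b -> cont_real g x) -> is_Cint g a b (Cint g a b).
Proof.
move=> ab H; apply: RInt_correct; apply: ex_RInt_continuous => x.
rewrite Rmin_left // Rmax_right // => Hx.
move=> P [eps HP]; have [d [D0 Hd]] := H x Hx eps (cond_pos eps).
exists (mkposreal _ D0) => y Hy; apply: HP.
have := Hd y Hy => Hc; have M := Rmax_Cmod (g y - g x)%C.
split.
- exact: Rle_lt_trans (Rle_trans _ _ _ (Rmax_l _ _) M) Hc.
- exact: Rle_lt_trans (Rle_trans _ _ _ (Rmax_r _ _) M) Hc.
Qed.

Lemma Cint_unique g a b l : is_Cint g a b l -> Cint g a b = l.
Proof. exact: is_RInt_unique. Qed.

Lemma is_Cint_minus f g a b l m : is_Cint f a b l -> is_Cint g a b m ->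
  is_Cint (fun x => f x - g x)%C a b (l - m)%C.
Proof. exact: is_RInt_minus. Qed.

Lemma is_Cint_const k a b : is_Cint (fun _ => k) a b (RtoC (b - a) * k)%C.
Proof.
have := is_RInt_const (V := C_R_CompleteNormedModule) a b k.
have -> // : scal (V := C_R_CompleteNormedModule) (b - a) k = (RtoC (b - a) * k)%C.
case: k => u v; rewrite /scal /= /prod_scal /scal /= /mult /= /Cmult /=; congr pair; ring.
Qed.

Lemma is_Cint_Chasles f a b c l m : is_Cint f a b l -> is_Cint f b c m -> is_Cint f a c (l + m)%C.
Proof. exact: is_RInt_Chasles. Qed.

Lemma is_Cint_norm g a b M l : a <= b -> (forall x, a <= x <= b -> Cmod (g x) <= M) ->
  is_Cint g a b l -> Cmod l <= (b - a) * M.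
Proof.
move=> ab HM Hg; rewrite Cmod_norm.
apply: (norm_RInt_le_const (V := C_R_NormedModule) g a b l M ab) => // x Hx.
have := HM x Hx; by rewrite Cmod_norm.
Qed.

Lemma is_Cint_near g a b K M l : a <= b -> is_Cint g a b l ->
  (forall x, a <= x <= b -> Cmod (g x - K)%C <= M) ->
  Cmod (l - RtoC (b - a) * K)%C <= (b - a) * M.
Proof.
move=> ab Hg HM.
exact: is_Cint_norm ab HM (is_Cint_minus _ _ _ _ _ _ Hg (is_Cint_const K a b)).
Qed.

(* Differentiability of a function of [s + i t] at [(s, t)], with the l1 norm of the increment. *)
Definition rdiff (Phi : R -> R -> C) (s t : R) : Prop :=
  exists L : C, forall eps, 0 < eps -> exists d, 0 < d /\ forall s' t',
    Rabs (s' - s) < d -> Rabs (t' - t) < d ->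
    Cmod (Phi s' t' - Phi s t - L * (s' - s, t' - t)%Rs)%C <= eps * (Rabs (s' - s) + Rabs (t' - t)).

Lemma rdiff_cont Phi s t : rdiff Phi s t -> forall eps, 0 < eps -> exists d, 0 < d /\ forall s' t',
    Rabs (s' - s) < d -> Rabs (t' - t) < d -> Cmod (Phi s' t' - Phi s t)%C < eps.
Proof.
move=> [L H] eps He; have [d [D0 Hd]] := H 1 Rlt_0_1.
have L0 := Cmod_ge_0 L.
have K0 : 0 < eps / (4 * (1 + Cmod L)) by apply: Rdiv_lt_0_compat; lra.
exists (Rmin d (eps / (4 * (1 + Cmod L)))); split; first by apply: Rmin_glb_lt.
move=> s' t' Hs Ht.
have Hs1 := Rlt_le_trans _ _ _ Hs (Rmin_l _ _); have Hs2 := Rlt_le_trans _ _ _ Hs (Rmin_r _ _).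
have Ht1 := Rlt_le_trans _ _ _ Ht (Rmin_l _ _); have Ht2 := Rlt_le_trans _ _ _ Ht (Rmin_r _ _).
have := Hd _ _ Hs1 Ht1 => H1.
set u := (s' - s, t' - t)%Rs in H1.
have Hu : Cmod u <= Rabs (s' - s) + Rabs (t' - t) by exact: Cmod_le_Re_Im.
have -> : (Phi s' t' - Phi s t = (Phi s' t' - Phi s t - L * u) + L * u)%C by ring.
apply: Rle_lt_trans (Cmod_triangle _ _) _; rewrite Cmod_mult.
set k := eps / _ in Hs2 Ht2 K0 *.
have Ek : 4 * (1 + Cmod L) * k = eps by rewrite /k; field; lra.
have u0 := Cmod_ge_0 u.
nra.
Qed.

Lemma rdiff_cont_real1 Phi s t : rdiff Phi s t -> cont_real (fun s => Phi s t) s.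
Proof.
move=> H eps He; have [d [D0 Hd]] := rdiff_cont _ _ _ H eps He.
by exists d; split=> // y Hy; apply: Hd => //; rewrite Rminus_diag Rabs_R0.
Qed.

Lemma rdiff_cont_real2 Phi s t : rdiff Phi s t -> cont_real (fun t => Phi s t) t.
Proof.
move=> H eps He; have [d [D0 Hd]] := rdiff_cont _ _ _ H eps He.
by exists d; split=> // y Hy; apply: Hd => //; rewrite Rminus_diag Rabs_R0.
Qed.

(* The integral of [Phi (s + i t)] along the boundary of the rectangle [a, b] x [c, d]; with opposite
   sides paired, only integrals of constants are needed to see that it vanishes on affine functions. *)
Definition boundary_int (Phi : R -> R -> C) (a b c d : R) : C :=
  (Ci * (Cint (Phi b) c d - Cint (Phi a) c d)
   - (Cint (fun s => Phi s d) a b - Cint (fun s => Phi s c) a b))%C.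

Lemma nested_corner (u : nat -> R) h : 0 <= h ->
  (forall n, u n <= u (S n) <= u n + h / 2 ^ (S n)) ->
  exists l, forall n, u n <= l <= u n + h / 2 ^ n.
Proof.
move=> h0 Hu.
have P n : 0 < / 2 ^ n by apply: Rinv_0_lt_compat; apply: pow_lt; lra.
have E n : h / 2 ^ n = h / 2 ^ S n + h / 2 ^ S n by rewrite /=; field; apply: pow_nonzero; lra.
have inc m n : u m <= u (m + n)%coq_nat.
  elim: n => [|n IH]; first by rewrite PeanoNat.Nat.add_0_r; lra.
  rewrite PeanoNat.Nat.add_succ_r; have := Hu (m + n)%coq_nat; lra.
have dec m n : u (m + n)%coq_nat + h / 2 ^ (m + n)%coq_nat <= u m + h / 2 ^ m.
  elim: n => [|n IH]; first by rewrite PeanoNat.Nat.add_0_r; lra.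
  rewrite PeanoNat.Nat.add_succ_r; have := Hu (m + n)%coq_nat; have := E (m + n)%coq_nat; lra.
have bd m n : u m <= u n + h / 2 ^ n.
  have Pm : 0 <= h / 2 ^ m by apply: Rmult_le_pos => //; apply: Rlt_le.
  have Pn : 0 <= h / 2 ^ n by apply: Rmult_le_pos => //; apply: Rlt_le.
  case: (PeanoNat.Nat.le_ge_cases m n) => H.
  - have := inc m (n - m)%coq_nat; rewrite PeanoNat.Nat.add_comm PeanoNat.Nat.sub_add //; lra.
  - have := dec n (m - n)%coq_nat; rewrite PeanoNat.Nat.add_comm PeanoNat.Nat.sub_add //; lra.
have [||l [L1 L2]] := completeness (fun x => exists n, x = u n).
- by exists (u O + h / 2 ^ O) => x [n ->].
- by exists (u O), O.
exists l => n; split; first by apply: L1; exists n.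
by apply: L2 => x [m ->].
Qed.

Lemma bisection (Q : nat -> R -> R -> Prop) s0 t0 h k : 0 <= h -> 0 <= k ->
  Q O s0 t0 ->
  (forall n s t, Q n s t -> exists s' t', Q (S n) s' t' /\
     s <= s' <= s + h / 2 ^ S n /\ t <= t' <= t + k / 2 ^ S n) ->
  exists x y, forall n, exists s t, Q n s t /\ s <= x <= s + h / 2 ^ n /\ t <= y <= t + k / 2 ^ n.
Proof.
move=> h0 k0 Q0 step.
(* The condition is an implication, so that every pair has a successor and a total choice function
   exists. *)
pose good n (p q : R * R) := Q n p.1 p.2 ->
  Q (S n) q.1 q.2 /\ p.1 <= q.1 <= p.1 + h / 2 ^ S n /\ p.2 <= q.2 <= p.2 + k / 2 ^ S n.
have ex n p : exists q, good n p q.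
  case: (classic (Q n p.1 p.2)) => H; last by exists p.
  by have [s' [t' ?]] := step _ _ _ H; exists (s', t').
pose nx n p := proj1_sig (constructive_indefinite_description _ (ex n p)).
have nxP n p : good n p (nx n p) := proj2_sig (constructive_indefinite_description _ (ex n p)).
pose w := fix w n := match n with O => (s0, t0) | S n => nx n (w n) end.
have HQ n : Q n (w n).1 (w n).2 by elim: n => // n IH; have [] := nxP n (w n) IH.
have [n|x Hx] := nested_corner (fun n => (w n).1) h h0.
  by have [_ []] := nxP n (w n) (HQ n).
have [n|y Hy] := nested_corner (fun n => (w n).2) k k0.
  by have [_ []] := nxP n (w n) (HQ n).
by exists x, y => n; exists (w n).1, (w n).2.
Qed.

Section Goursat.
Variables (Phi : R -> R -> C) (a b c d : R).
Hypothesis H : forall s t, a <= s <= b -> c <= t <= d -> rdiff Phi s t.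

Lemma vert_int s c' d' : a <= s <= b -> c <= c' -> c' <= d' -> d' <= d ->
  is_Cint (Phi s) c' d' (Cint (Phi s) c' d').
Proof. by move=> *; apply: cont_real_ex => // t Ht; apply: (rdiff_cont_real2 Phi); apply: H; lra. Qed.

Lemma horiz_int t a' b' : c <= t <= d -> a <= a' -> a' <= b' -> b' <= b ->
  is_Cint (fun s => Phi s t) a' b' (Cint (fun s => Phi s t) a' b').
Proof. by move=> *; apply: cont_real_ex => // s Hs; apply: (rdiff_cont_real1 Phi); apply: H; lra. Qed.

Lemma boundary_int_split_h a' m b' c' d' : a <= a' -> a' <= m -> m <= b' -> b' <= b ->
  c <= c' -> c' <= d' -> d' <= d ->
  boundary_int Phi a' b' c' d' = (boundary_int Phi a' m c' d' + boundary_int Phi m b' c' d')%C.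
Proof.
move=> *; rewrite /boundary_int.
have E t : c <= t <= d -> Cint (fun s => Phi s t) a' b' =
    (Cint (fun s => Phi s t) a' m + Cint (fun s => Phi s t) m b')%C.
  by move=> Ht; apply: Cint_unique; apply: is_Cint_Chasles; apply: horiz_int; lra.
rewrite !E; try lra; ring.
Qed.

Lemma boundary_int_split_v a' b' c' m d' : a <= a' -> a' <= b' -> b' <= b ->
  c <= c' -> c' <= m -> m <= d' -> d' <= d ->
  boundary_int Phi a' b' c' d' = (boundary_int Phi a' b' c' m + boundary_int Phi a' b' m d')%C.
Proof.
move=> *; rewrite /boundary_int.
have E s : a <= s <= b -> Cint (Phi s) c' d' =
    (Cint (Phi s) c' m + Cint (Phi s) m d')%C.
  by move=> Ht; apply: Cint_unique; apply: is_Cint_Chasles; apply: vert_int; lra.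
rewrite !E; try lra; ring.
Qed.

(** The linear part contributes the constant L (b' - a') to the difference of the vertical sides and
    L i (d' - c') to that of the horizontal ones; these two contributions cancel. What remains
    compares two points, each with error e, hence 2 e along each pair of sides. *)
Lemma boundary_int_local a' b' c' d' x y L e : a <= a' -> a' <= b' -> b' <= b ->
  c <= c' -> c' <= d' -> d' <= d -> 
  (forall s t, a' <= s <= b' -> c' <= t <= d' ->
     Cmod (Phi s t - Phi x y - L * (s - x, t - y)%Rs)%C <= e) ->
  Cmod (boundary_int Phi a' b' c' d') <= 2 * e * (b' - a') + 2 * e * (d' - c').
Proof.
move=> h1 h2 h3 h4 h5 h6 He.
have V := is_Cint_minus _ _ _ _ _ _ (vert_int b' c' d' ltac:(lra) h4 h5 h6) (vert_int a' c' d' ltac:(lra) h4 h5 h6).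
have W := is_Cint_minus _ _ _ _ _ _ (horiz_int d' a' b' ltac:(lra) h1 h2 h3) (horiz_int c' a' b' ltac:(lra) h1 h2 h3).
have V1 := is_Cint_near _ _ _ (L * RtoC (b' - a'))%C (2 * e) _ h5 V.
have W1 := is_Cint_near _ _ _ (L * (Ci * RtoC (d' - c')))%C (2 * e) _ h2 W.
rewrite /boundary_int.
set v := (Cint (Phi b') c' d' - Cint (Phi a') c' d')%C in V V1 *.
set w := (Cint (fun s => Phi s d') a' b' - Cint (fun s => Phi s c') a' b')%C in W W1 *.
have -> : (Ci * v - w = Ci * (v - RtoC (d' - c') * (L * RtoC (b' - a')))
   - (w - RtoC (b' - a') * (L * (Ci * RtoC (d' - c')))))%C by ring.
apply: Rle_trans (Cmod_triangle _ _) _; rewrite Cmod_opp Cmod_mult Cmod_Ci Rmult_1_l.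
have two p q : Cmod p <= e -> Cmod q <= e -> Cmod (p - q)%C <= 2 * e.
  by move=> Hp Hq; have := Cmod_triangle p (- q)%C; rewrite Cmod_opp -/(Cminus p q); lra.
rewrite Rplus_comm; apply: Rplus_le_compat; rewrite -/v -/w.
- rewrite (Rmult_comm _ (b' - a')); apply: W1 => s Hs.
  have := two _ _ (He s d' Hs ltac:(lra)) (He s c' Hs ltac:(lra)).
  congr (Cmod _ <= _).
  have -> : ((s - x)%Rs, (d' - y)%Rs) = (((s - x)%Rs, (c' - y)%Rs) + Ci * RtoC (d' - c'))%C.
    by rewrite /Cplus /Cmult /=; congr pair; ring.
  ring.
- rewrite (Rmult_comm _ (d' - c')); apply: V1 => t Ht.
  have := two _ _ (He b' t ltac:(lra) Ht) (He a' t ltac:(lra) Ht).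
  congr (Cmod _ <= _).
  have -> : ((b' - x)%Rs, (t - y)%Rs) = (((a' - x)%Rs, (t - y)%Rs) + RtoC (b' - a'))%C.
    by rewrite /Cplus /=; congr pair; ring.
  ring.
Qed.

Lemma Goursat : a < b -> c < d -> boundary_int Phi a b c d = 0%C.
Proof.
move=> ab cd0; apply: NNPP => N.
have N0 : 0 < Cmod (boundary_int Phi a b c d) by apply/Cmod_gt_0.
set h := b - a; set k := d - c.
have h0 : 0 < h by rewrite /h; lra.
have k0 : 0 < k by rewrite /k; lra.
(* Half of the integral per unit of area, so that the strict inequality in [Q] holds for the initial
   rectangle. *)
set e := Cmod (boundary_int Phi a b c d) / (2 * (h * k)).
have hk0 : 0 < h * k by nra.
have e0 : 0 < e by apply: Rdiv_lt_0_compat; lra.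
pose Q n s t := a <= s /\ s + h / 2 ^ n <= b /\ c <= t /\ t + k / 2 ^ n <= d /\
  e * ((h / 2 ^ n) * (k / 2 ^ n)) < Cmod (boundary_int Phi s (s + h / 2 ^ n) t (t + k / 2 ^ n)).
have P n : 0 < / 2 ^ n by apply: Rinv_0_lt_compat; apply: pow_lt; lra.
have Ph n : 0 < h / 2 ^ n by apply: Rmult_lt_0_compat.
have Pk n : 0 < k / 2 ^ n by apply: Rmult_lt_0_compat.
have Eh n : h / 2 ^ n = h / 2 ^ S n + h / 2 ^ S n by rewrite /=; field; apply: pow_nonzero; lra.
have Ek n : k / 2 ^ n = k / 2 ^ S n + k / 2 ^ S n by rewrite /=; field; apply: pow_nonzero; lra.
have [| | | | x [y Hxy]] := bisection Q a c h k; try lra.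
- rewrite /Q /= !Rdiv_1_r /h /k.
  have -> : a + (b - a) = b by ring.
  have -> : c + (d - c) = d by ring.
  do ![split; first lra].
  rewrite -/h -/k /e.
  have -> : Cmod (boundary_int Phi a b c d) / (2 * (h * k)) * (h * k) = Cmod (boundary_int Phi a b c d) / 2 by field; lra.
  lra.
- move=> n s t; rewrite /Q (Eh n) (Ek n).
  have := Ph (S n); have := Pk (S n).
  set hn := h / 2 ^ S n; set kn := k / 2 ^ S n => kn0 hn0 [q1 [q2 [q3 [q4 q5]]]].
  (* If every quarter had an integral of modulus at most e times its area, so would the whole
     rectangle. *)
  apply: NNPP => NQ.
  have G s' t' : s <= s' <= s + hn -> t <= t' <= t + kn ->
      Cmod (boundary_int Phi s' (s' + hn) t' (t' + kn)) <= e * (hn * kn).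
    move=> Hs Ht; apply: Rnot_lt_le => Hlt; apply: NQ; exists s', t'.
    by do ![split; try lra].
  have G1 := G s t ltac:(lra) ltac:(lra).
  have G2 := G (s + hn) t ltac:(lra) ltac:(lra).
  have G3 := G s (t + kn) ltac:(lra) ltac:(lra).
  have G4 := G (s + hn) (t + kn) ltac:(lra) ltac:(lra).
  move: q5; rewrite -!Rplus_assoc.
  rewrite (boundary_int_split_h s (s + hn)); try lra.
  rewrite (boundary_int_split_v s (s + hn) t (t + kn)); try lra.
  rewrite (boundary_int_split_v (s + hn) (s + hn + hn) t (t + kn)); try lra.
  move=> q5; apply: (Rlt_irrefl (4 * (e * (hn * kn)))).
  have -> : 4 * (e * (hn * kn)) = e * ((hn + hn) * (kn + kn)) by ring.
  apply: Rlt_le_trans q5 _.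
  have -> : e * ((hn + hn) * (kn + kn)) =
    (e * (hn * kn) + e * (hn * kn)) + (e * (hn * kn) + e * (hn * kn)) by ring.
  by do 2![apply: Rle_trans (Cmod_triangle _ _) _; apply: Rplus_le_compat]; try exact: Rle_trans (Cmod_triangle _ _) (Rplus_le_compat _ _ _ _ _ _).
have [s0 [t0 [[q1 [q2 [q3 [q4 _]]]] [q5 q6]]]] := Hxy O.
have /= Ph0 := Ph O; have /= Pk0 := Pk O.
have [|| L HL] := H x y; [lra|lra|].
have C0 : 0 < 4 * (h + k) * (h + k) by nra.
(* With this accuracy [boundary_int_local] bounds the n-th integral by 2 e' (h + k)^2 / 4^n, half of
   the lower bound e h k / 4^n recorded in [Q]. *)
have [dl [D0 Hdl]] := HL (e * (h * k) / (4 * (h + k) * (h + k))) ltac:(apply: Rdiv_lt_0_compat; nra).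
have [n Hn] : exists n, (h + k) / 2 ^ n < dl.
  have [n Hn] := pow_lt_1_zero (/ 2) ltac:(rewrite Rabs_pos_eq; lra) (dl / (h + k)) ltac:(apply: Rdiv_lt_0_compat; lra).
  exists n; have := Hn n (Nat.le_refl n); rewrite Rabs_pos_eq; last by apply: pow_le; lra.
  rewrite -Rinv_pow; last lra.
  move=> H1; apply: (Rmult_lt_reg_r (/ (h + k))); first by apply: Rinv_0_lt_compat; lra.
  have -> : (h + k) / 2 ^ n * / (h + k) = / 2 ^ n by field; split; [apply: pow_nonzero|]; lra.
  exact: H1.
have [s [t [[p1 [p2 [p3 [p4 p5]]]] [p6 p7]]]] := Hxy n.
have Phn := Ph n; have Pkn := Pk n.
have EE : (h + k) / 2 ^ n = h / 2 ^ n + k / 2 ^ n by field; apply: pow_nonzero; lra.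
apply: (Rlt_irrefl (e * (h / 2 ^ n * (k / 2 ^ n)))).
apply: Rlt_le_trans p5 _.
set e' := e * (h * k) / (4 * (h + k) * (h + k)) in Hdl.
have e'0 : 0 < e' by apply: Rdiv_lt_0_compat; nra.
have := boundary_int_local s (s + h / 2 ^ n) t (t + k / 2 ^ n) x y L (e' * (h / 2 ^ n + k / 2 ^ n))
  ltac:(lra) ltac:(lra) ltac:(lra) ltac:(lra) ltac:(lra) ltac:(lra).
move/(_ _)/Rle_trans; apply.
- move=> s' t' Hs' Ht'.
  have A1 : Rabs (s' - x) <= h / 2 ^ n by apply: Rabs_le; lra.
  have A2 : Rabs (t' - y) <= k / 2 ^ n by apply: Rabs_le; lra.
  apply: Rle_trans (Hdl s' t' _ _) _; try lra.
  by apply: Rmult_le_compat_l; lra.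
- have -> : 2 * (e' * (h / 2 ^ n + k / 2 ^ n)) * (s + h / 2 ^ n - s) +
    2 * (e' * (h / 2 ^ n + k / 2 ^ n)) * (t + k / 2 ^ n - t)
    = e * (h / 2 ^ n * (k / 2 ^ n)) / 2.
    rewrite /e'; field; split; [apply: pow_nonzero; lra | lra].
  have : 0 < e * (h / 2 ^ n * (k / 2 ^ n)) by apply: Rmult_lt_0_compat => //; apply: Rmult_lt_0_compat.
  lra.
Qed.
End Goursat.

(** * Circle means *)

Lemma is_Cint_cscal g a b (k l : C) : is_Cint g a b l -> is_Cint (fun x => k * g x)%C a b (k * l)%C.
Proof.
move=> H.
have H1 : is_RInt (fun t => fst (g t)) a b (fst l) by exact: is_RInt_fct_extend_fst.
have H2 : is_RInt (fun t => snd (g t)) a b (snd l) by exact: is_RInt_fct_extend_snd.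
case: k => u v.
apply: (is_RInt_fct_extend_pair (U := R_NormedModule) (V := R_NormedModule)) => /=.
- apply: (is_RInt_minus (V := R_NormedModule)); exact: (is_RInt_scal (V := R_NormedModule)).
- apply: (is_RInt_plus (V := R_NormedModule)); exact: (is_RInt_scal (V := R_NormedModule)).
Qed.

Lemma cdiff_rdiff (G : C -> C) s t L : cdiff G (s, t) L -> rdiff (fun s t => G (s, t)) s t.
Proof.
move=> /cdiffP H; exists L => eps He; have [d [D0 Hd]] := H eps He.
exists (d / 2); split; first lra.
move=> s' t' Hs Ht.
have Hu : Cmod (s' - s, t' - t)%Rs <= Rabs (s' - s) + Rabs (t' - t) by exact: Cmod_le_Re_Im.
have := Hd (s' - s, t' - t)%Rs ltac:(lra).
have -> : ((s, t) + (s' - s, t' - t)%Rs)%C = (s', t') by rewrite /Cplus /=; congr pair; ring.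
move=> H1; apply: Rle_trans H1 _; apply: Rmult_le_compat_l; lra.
Qed.

Lemma cexp_opp z : cexp (- z)%C = (/ cexp z)%C.
Proof.
have H : (cexp (- z) * cexp z = 1)%C by rewrite -cexp_add -cexp_0; congr cexp; ring.
have N := cexp_neq0 z.
have -> : (/ cexp z = (cexp (- z) * cexp z) * / cexp z)%C by rewrite H; ring.
by field.
Qed.

Lemma cdiff_cexp_opp z : cdiff (fun w => cexp (- w)%C) z (- cexp (- z))%C.
Proof.
have H := cdiff_comp cexp (fun w => 0 - w)%C z _ _ (cdiff_cexp _) (cdiff_minus _ _ _ _ _ (cdiff_const 0 z) (cdiff_id z)).
have E : ((0 - 1) * cexp (0 - z) = - cexp (- z))%C.
  have -> : (0 - z = - z)%C by ring.
  ring.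
rewrite E in H; apply: cdiff_ext H => w; congr cexp; ring.
Qed.

(* The function [zeta |-> (g (e^zeta) - g 0) / e^zeta] is [2 i pi]-periodic, so by Goursat's theorem
   its integral over a vertical period segment does not depend on the real part [s] of the segment;
   letting [s] tend to minus infinity identifies it. *)
Lemma circle_mean (g : C -> C) r s l : (forall z, Cmod z < r -> exists l, cdiff g z l) ->
  exp s < r -> cdiff g 0%C l ->
  is_Cint (fun t => (g (cexp (s, t)) - g 0) * cexp (- (s, t)))%C 0 (2 * PI) (RtoC (2 * PI) * l)%C.
Proof.
move=> Hg sr Hl.
pose Phi s t := ((g (cexp (s, t)) - g 0%C) * cexp (- (s, t)))%C.
have pi0 := PI_RGT_0.
have HPhi u t : exp u < r -> rdiff Phi u t.
  move=> ur.
  have [m Hm] := Hg (cexp (u, t)) ltac:(by rewrite Cmod_cexp).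
  have := cdiff_mult _ _ _ _ _ (cdiff_minus _ _ _ _ _ (cdiff_comp _ _ _ _ _ Hm (cdiff_cexp (u, t)))
    (cdiff_const (g 0%C) _)) (cdiff_cexp_opp (u, t)).
  exact: cdiff_rdiff.
have IM u : exp u < r -> is_Cint (Phi u) 0 (2 * PI) (Cint (Phi u) 0 (2 * PI)).
  by move=> ur; apply: cont_real_ex => [|t _]; [lra|]; apply: (rdiff_cont_real2 Phi); apply: HPhi.
have per u : Phi u (2 * PI) = Phi u 0.
  rewrite /Phi !cexp_opp.
  by have -> : cexp (u, 2 * PI) = cexp (u, 0) by rewrite /cexp /= cos_2PI sin_2PI cos_0 sin_0.
have indep u v : u < v -> exp v < r -> Cint (Phi u) 0 (2 * PI) = Cint (Phi v) 0 (2 * PI).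
  move=> uv vr.
  have B : boundary_int Phi u v 0 (2 * PI) = 0%C.
    apply: Goursat; try lra; move=> x t Hx _; apply: HPhi.
    case: (Rle_lt_or_eq_dec x v ltac:(lra)) => [xv|->//].
    by have := exp_increasing _ _ xv; lra.
  move: B; rewrite /boundary_int.
  have -> : (fun x => Phi x (2 * PI)) = (fun x => Phi x 0) by apply: functional_extensionality.
  set p := Cint (Phi v) _ _; set q := Cint (Phi u) _ _; set o := Cint _ _ _ => B.
  (* By periodicity the horizontal sides have the same integral [o], so [B] reads i (p - q) = 0;
     multiplying by i gives p = q. *)
  have -> : q = (p + Ci * (Ci * (p - q) - (o - o)))%C.
    have -> : (p + Ci * (Ci * (p - q) - (o - o)) = p + (Ci * Ci) * (p - q))%C by ring.
    have -> : (Ci * Ci = - (1))%C by rewrite /Ci /Cmult /Copp /=; congr pair; ring.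
    ring.
  by rewrite B; ring.
have lim : forall eps, 0 < eps -> Cmod (Cint (Phi s) 0 (2 * PI) - RtoC (2 * PI) * l)%C <= 2 * PI * eps.
  move=> eps He.
  have [d [D0 Hd]] := (proj1 (cdiffP g 0%C l) Hl) eps He.
  (* Moving the segment to the left shrinks the circle to a radius exp u < d, where the difference
     quotient is within eps of l. *)
  pose u := Rmin (s - 1) (ln d - 1).
  have us : u < s by have := Rmin_l (s - 1) (ln d - 1); rewrite -/u; lra.
  have ud : exp u < d.
    rewrite -(exp_ln d) //; apply: exp_increasing.
    by have := Rmin_r (s - 1) (ln d - 1); rewrite -/u; lra.
  rewrite -(indep u s us sr).
  have ur : exp u < r by have := exp_increasing _ _ us; lra.
  have := is_Cint_near _ _ _ l eps _ _ (IM u ur).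
  rewrite Rminus_0_r; apply; first lra.
  move=> t _.
  have := Hd (cexp (u, t)); rewrite Cmod_cexp /= => /(_ ud).
  rewrite Cplus_0_l.
  have E0 := exp_pos u.
  have -> : (g (cexp (u, t)) - g 0 - l * cexp (u, t) = (Phi u t - l) * cexp (u, t))%C.
    by rewrite /Phi cexp_opp; field; exact: cexp_neq0.
  by rewrite Cmod_mult Cmod_cexp /= => /(Rmult_le_reg_r _ _ _ E0).
have E : Cint (Phi s) 0 (2 * PI) = (RtoC (2 * PI) * l)%C.
  apply: NNPP => N.
  have N0 : 0 < Cmod (Cint (Phi s) 0 (2 * PI) - RtoC (2 * PI) * l)%C.
    apply/Cmod_gt_0 => E; apply: N.
    have -> : Cint (Phi s) 0 (2 * PI) = (Cint (Phi s) 0 (2 * PI) - RtoC (2 * PI) * l + RtoC (2 * PI) * l)%C by ring.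
    by rewrite E Cplus_0_l.
  set c := Cmod _ in N0 lim.
  have := lim (c / (4 * PI)) ltac:(apply: Rdiv_lt_0_compat; lra).
  have -> : 2 * PI * (c / (4 * PI)) = c / 2 by field; lra.
  lra.
by rewrite -E; apply: IM.
Qed.

(** The mean value theorem is real, so the error v is projected on its own direction: psi is the
    real part of conj(v) times the error along the segment from 0 to h, and psi 1 - psi 0 =
    |v|^2. *)
Lemma complex_mvt (g g' : C -> C) l e d h : (forall z, Cmod z < d -> cdiff g z (g' z)) ->
  (forall z, Cmod z < d -> Cmod (g' z - l)%C <= e) -> Cmod h < d ->
  Cmod (g h - g 0%C - l * h)%C <= e * Cmod h.
Proof.
move=> Hg He hd.
set v := (g h - g 0 - l * h)%C.
pose psi s := Re (Cconj v * (g (RtoC s * h) - l * (RtoC s * h)))%C.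
pose dpsi s := Re (Cconj v * ((g' (RtoC s * h) - l) * h))%C.
have small s : 0 <= s <= 1 -> Cmod (RtoC s * h)%C < d.
  move=> Hs; rewrite Cmod_mult Cmod_R Rabs_pos_eq; last lra.
  have := Cmod_ge_0 h; nra.
have D s : 0 <= s <= 1 -> derivable_pt_lim psi s (dpsi s).
  move=> Hs eps Heps.
  have K0 : 0 < 2 * (1 + Cmod v) * (1 + Cmod h) by have := Cmod_ge_0 v; have := Cmod_ge_0 h; nra.
  have [dl [D0 Hd]] := (proj1 (cdiffP _ _ _) (Hg _ (small s Hs))) (eps / (2 * (1 + Cmod v) * (1 + Cmod h)))
    ltac:(apply: Rdiv_lt_0_compat; lra).
  have D1 : 0 < dl / (1 + Cmod h) by apply: Rdiv_lt_0_compat; have := Cmod_ge_0 h; lra.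
  exists (mkposreal _ D1) => k k0 /= Hk.
  have V0 := Cmod_ge_0 v; have H0 := Cmod_ge_0 h.
  have Hkh : Cmod (RtoC k * h)%C < dl.
    rewrite Cmod_mult Cmod_R.
    have E : dl / (1 + Cmod h) * (1 + Cmod h) = dl by field; lra.
    have := Rabs_pos k; nra.
  have := Hd _ Hkh.
  set G := (g _ - g _ - _)%C => HG.
  have -> : (psi (s + k) - psi s) / k - dpsi s = Re (Cconj v * G)%C / k.
    rewrite /psi /dpsi /G.
    have -> : (RtoC s * h + RtoC k * h = RtoC (s + k) * h)%C by rewrite RtoC_plus; ring.
    set p := g _; set q := g _; set m := g' _.
    have -> : (RtoC (s + k) * h = RtoC s * h + RtoC k * h)%C by rewrite RtoC_plus; ring.
    move: (RtoC s * h)%C p q m => w [p1 p2] [q1 q2] [m1 m2].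
    case: (v) (h) (l) w => [v1 v2] [h1 h2] [l1 l2] [w1 w2] /=.
    by field.
  rewrite Rabs_div //.
  have Pk : 0 < Rabs k by apply: Rabs_pos_lt.
  apply: (Rmult_lt_reg_r (Rabs k)) => //.
  have -> : Rabs (Re (Cconj v * G)%C) / Rabs k * Rabs k = Rabs (Re (Cconj v * G)%C) by field; lra.
  apply: Rle_lt_trans (re_le_Cmod _) _.
  rewrite Cmod_mult Cmod_conj.
  move: HG; rewrite Cmod_mult Cmod_R => HG.
  apply: Rle_lt_trans (Rmult_le_compat_l _ _ _ V0 HG) _.
  have -> : Cmod v * (eps / (2 * (1 + Cmod v) * (1 + Cmod h)) * (Rabs k * Cmod h)) =
     (eps * Rabs k / 2) * ((Cmod v / (1 + Cmod v)) * (Cmod h / (1 + Cmod h))) by field; lra.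
  have F x : 0 <= x -> 0 <= x / (1 + x) <= 1.
    move=> x0; split; first by apply: Rmult_le_pos => //; apply: Rlt_le; apply: Rinv_0_lt_compat; lra.
    apply: (Rmult_le_reg_r (1 + x)); first lra.
    have -> : x / (1 + x) * (1 + x) = x by field; lra.
    lra.
  have := F _ V0; have := F _ H0 => F1 F2.
  have E0 : 0 < eps * Rabs k by nra.
  set x := Cmod v / _ in F1 F2 *; set y := Cmod h / _ in F1 F2 *.
  have xy : x * y <= 1 by nra.
  nra.
have [x [Hx Ex]] : exists x, 0 <= x <= 1 /\ psi 1 - psi 0 = dpsi x.
  have [|x [Ex Hx]] := MVT_cor2 psi dpsi 0 1 Rlt_0_1.
    by move=> x Hx; apply: D.
  exists x; split; lra.
have Ev : Re (Cconj v * v)%C = Cmod v ^ 2.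
  have -> : (Cconj v * v = RtoC (Cmod v ^ 2))%C by rewrite Cmod2_conj; ring.
  by [].
have E1 : psi 1 - psi 0 = Cmod v ^ 2.
  have lin (w p q : C) : Re (w * p)%C - Re (w * q)%C = Re (w * (p - q))%C.
    by case: w p q => [w1 w2] [p1 p2] [q1 q2] /=; ring.
  rewrite -Ev /psi lin; congr (Re (_ * _)%C).
  have -> : (1 * h = h)%C by ring.
  have -> : (0 * h = 0)%C by ring.
  rewrite /v; ring.
have := re_le_Cmod (Cconj v * ((g' (RtoC x * h) - l) * h))%C.
rewrite -/(dpsi x) -Ex E1 !Cmod_mult Cmod_conj.
have V0 := Cmod_ge_0 v; have H0 := Cmod_ge_0 h.
rewrite Rabs_pos_eq; last by apply: pow_le.
have := He _ (small x Hx).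
set m := Cmod (_ - l)%C => Hm Hv.
case: (Rle_lt_or_eq_dec _ _ V0) => [vp|<-]; last first.
  apply: Rmult_le_pos => //; have := Cmod_ge_0 (g' (RtoC x * h) - l)%C; rewrite -/m; lra.
apply: (Rmult_le_reg_l (Cmod v)) => //.
have : m * Cmod h <= e * Cmod h by apply: Rmult_le_compat_r.
nra.
Qed.

(** * Holomorphic functions of several variables *)

Section Several.
Variable n : nat.
Notation X := ('I_n -> C).

(** Increments, in contrast to the new values of [upd]: shifts compose additively and commute, and
    every partial derivative becomes a derivative at 0. *)
Definition shift (x : X) (j : 'I_n) (h : C) : X := fun i => if i == j then (x i + h)%C else x i.

Definition near (x y : X) (d : R) : Prop := forall j, Cmod (y j - x j)%C < d.

Lemma near_refl x d : 0 < d -> near x x d.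
Proof. by move=> d0 j; have -> : (x j - x j = 0)%C by [ring|]; rewrite Cmod_0. Qed.

Lemma near_trans x y z d e : near x y d -> near y z e -> near x z (d + e).
Proof.
move=> H1 H2 j; have -> : (z j - x j = (y j - x j) + (z j - y j))%C by ring.
apply: Rle_lt_trans (Cmod_triangle _ _) _; have := H1 j; have := H2 j; lra.
Qed.

Lemma near_le x y d e : d <= e -> near x y d -> near x y e.
Proof. by move=> de H j; have := H j; lra. Qed.

Lemma near_shift x j h d : Cmod h < d -> near x (shift x j h) d.
Proof.
move=> hd i; rewrite /shift; case: eqP => _.
  by have -> : (x i + h - x i = h)%C by ring.
have -> : (x i - x i = 0)%C by ring.
rewrite Cmod_0; have := Cmod_ge_0 h; lra.
Qed.

Lemma near_shift2 x y j h k d e : 0 < e -> near x y d -> Cmod (k - h)%C < e ->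
  near (shift x j h) (shift y j k) (d + e).
Proof.
move=> e0 H hk i; rewrite /shift; have := H i => Hi; case: eqP => _; last lra.
have -> : (y i + k - (x i + h) = (y i - x i) + (k - h))%C by ring.
apply: Rle_lt_trans (Cmod_triangle _ _) _; lra.
Qed.

Lemma shift0 x j : shift x j 0%C = x.
Proof. by apply: functional_extensionality => i; rewrite /shift; case: eqP => // _; rewrite Cplus_0_r. Qed.

Lemma shift_shift x j h k : shift (shift x j h) j k = shift x j (h + k)%C.
Proof. by apply: functional_extensionality => i; rewrite /shift; case: eqP => // _; ring. Qed.

Lemma shiftC x i j h k : shift (shift x i h) j k = shift (shift x j k) i h.
Proof. by apply: functional_extensionality => l; rewrite /shift; do 2![case: eqP => // _]; ring. Qed.

Lemma upd_shift x j t : upd x j t = shift x j (t - x j)%C.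
Proof. by apply: functional_extensionality => i; rewrite /shift /upd; case: eqP => // ->; ring. Qed.

Definition is_pderiv (f : X -> C) (j : 'I_n) (x : X) (l : C) : Prop := cdiff (fun h => f (shift x j h)) 0%C l.

Lemma is_pderiv_at_shift f j x h l : is_pderiv f j (shift x j h) l <-> cdiff (fun w => f (shift x j w)) h l.
Proof.
rewrite /is_pderiv; split=> H.
- have H1 : cdiff (fun w => f (shift (shift x j h) j (w - h)%C)) h ((1 - 0) * l)%C.
    apply: (cdiff_comp (fun w => f (shift (shift x j h) j w))); last by apply: cdiff_minus (cdiff_id _) (cdiff_const _ _).
    by have -> : (h - h = 0)%C by ring.
  have E : ((1 - 0) * l = l)%C by ring.
  rewrite E in H1; apply: cdiff_ext H1 => w; rewrite shift_shift; congr (f (shift _ _ _)); ring.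
- have H1 : cdiff (fun w => f (shift x j (h + w)%C)) 0%C ((0 + 1) * l)%C.
    apply: (cdiff_comp (fun w => f (shift x j w))); last by apply: cdiff_plus (cdiff_const _ _) (cdiff_id _).
    by rewrite Cplus_0_r.
  have E : ((0 + 1) * l = l)%C by ring.
  by rewrite E in H1; apply: cdiff_ext H1 => w; rewrite shift_shift.
Qed.

Lemma is_pderiv_cderiv f j x l : is_pderiv f j x l <-> is_cderiv (fun t => f (upd x j t)) (x j) l.
Proof.
rewrite is_cderivP /is_pderiv; split=> H.
- have H1 : cdiff (fun t => f (shift x j (t - x j)%C)) (x j) ((1 - 0) * l)%C.
    apply: (cdiff_comp (fun h => f (shift x j h))); last by apply: cdiff_minus (cdiff_id _) (cdiff_const _ _).
    by have -> : (x j - x j = 0)%C by ring.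
  have E : ((1 - 0) * l = l)%C by ring.
  by rewrite E in H1; apply: cdiff_ext H1 => w; rewrite upd_shift.
- have H1 : cdiff (fun h => f (upd x j (x j + h)%C)) 0%C ((0 + 1) * l)%C.
    apply: (cdiff_comp (fun t => f (upd x j t))); last by apply: cdiff_plus (cdiff_const _ _) (cdiff_id _).
    by rewrite Cplus_0_r.
  have E : ((0 + 1) * l = l)%C by ring.
  by rewrite E in H1; apply: cdiff_ext H1 => w; rewrite upd_shift; congr (f (shift _ _ _)); ring.
Qed.

Lemma is_pderiv_unique f j x l m : is_pderiv f j x l -> is_pderiv f j x m -> l = m.
Proof. exact: cdiff_unique. Qed.

Lemma pderiv_unique f j x l : is_pderiv f j x l -> pderiv j f x = l.
Proof.
move=> H; have P := epsilon_spec (inhabits (RtoC 0)) (fun l => is_cderiv (fun t => f (upd x j t)) (x j) l).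
by apply: (is_pderiv_unique f j x) => //; apply/is_pderiv_cderiv; apply: P; exists l; apply/is_pderiv_cderiv.
Qed.

Definition cont_at (f : X -> C) (x : X) : Prop := forall eps, 0 < eps -> exists d, 0 < d /\
  forall y, near x y d -> Cmod (f y - f x)%C < eps.

Definition joint_cont (F : X -> R -> C) (x : X) (t : R) : Prop := forall eps, 0 < eps -> exists d, 0 < d /\
  forall y s, near x y d -> Rabs (s - t) < d -> Cmod (F y s - F x t)%C < eps.

Lemma joint_cont_cont_real F x t : joint_cont F x t -> cont_real (F x) t.
Proof.
move=> H eps He; have [d [D0 Hd]] := H eps He.
by exists d; split=> // s Hs; apply: Hd => //; apply: near_refl.
Qed.

Lemma joint_cont_cont_at f x t : cont_at f x -> joint_cont (fun y _ => f y) x t.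
Proof.
move=> H eps He; have [d [D0 Hd]] := H eps He.
by exists d; split=> // y s Hy _; apply: Hd.
Qed.

Lemma cont_real_joint_cont g x t : cont_real g t -> joint_cont (fun _ s => g s) x t.
Proof.
move=> H eps He; have [d [D0 Hd]] := H eps He.
by exists d; split=> // y s _ Hs; apply: Hd.
Qed.

Lemma joint_cont_minus F G x t : joint_cont F x t -> joint_cont G x t -> joint_cont (fun y s => F y s - G y s)%C x t.
Proof.
move=> HF HG eps He.
have [d [D0 Hd]] := HF (eps / 2) ltac:(lra).
have [e [E0 He']] := HG (eps / 2) ltac:(lra).
exists (Rmin d e); split; first exact: Rmin_glb_lt.
move=> y s Hy Hs.
have H1 := Hd y s (near_le _ _ _ _ (Rmin_l _ _) Hy) (Rlt_le_trans _ _ _ Hs (Rmin_l _ _)).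
have H2 := He' y s (near_le _ _ _ _ (Rmin_r _ _) Hy) (Rlt_le_trans _ _ _ Hs (Rmin_r _ _)).
have -> : (F y s - G y s - (F x t - G x t) = (F y s - F x t) + - (G y s - G x t))%C by ring.
by apply: Rle_lt_trans (Cmod_triangle _ _) _; rewrite Cmod_opp; lra.
Qed.

Lemma joint_cont_mult F G x t : joint_cont F x t -> joint_cont G x t -> joint_cont (fun y s => F y s * G y s)%C x t.
Proof.
move=> HF HG eps He.
have F0 := Cmod_ge_0 (F x t); have G0 := Cmod_ge_0 (G x t).
pose k := Rmin 1 (eps / (2 + Cmod (F x t) + Cmod (G x t))).
have k1 : k <= 1 := Rmin_l _ _.
have k2 : k <= eps / (2 + Cmod (F x t) + Cmod (G x t)) := Rmin_r _ _.
have k0 : 0 < k by apply: Rmin_glb_lt; [lra | apply: Rdiv_lt_0_compat; lra].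
have [d [D0 Hd]] := HF k k0.
have [e [E0 He']] := HG k k0.
exists (Rmin d e); split; first exact: Rmin_glb_lt.
move=> y s Hy Hs.
have H1 := Hd y s (near_le _ _ _ _ (Rmin_l _ _) Hy) (Rlt_le_trans _ _ _ Hs (Rmin_l _ _)).
have H2 := He' y s (near_le _ _ _ _ (Rmin_r _ _) Hy) (Rlt_le_trans _ _ _ Hs (Rmin_r _ _)).
have -> : (F y s * G y s - F x t * G x t = (F y s - F x t) * (G y s - G x t) +
   ((F y s - F x t) * G x t + F x t * (G y s - G x t)))%C by ring.
apply: Rle_lt_trans (Cmod_triangle _ _) _.
apply: Rle_lt_trans (Rplus_le_compat_l _ _ _ (Cmod_triangle _ _)) _; rewrite !Cmod_mult.
have P1 := Cmod_ge_0 (F y s - F x t)%C; have P2 := Cmod_ge_0 (G y s - G x t)%C.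
have K3 : k * (2 + Cmod (F x t) + Cmod (G x t)) <= eps.
  have E : eps = eps / (2 + Cmod (F x t) + Cmod (G x t)) * (2 + Cmod (F x t) + Cmod (G x t)) by field; lra.
  rewrite E; apply: Rmult_le_compat_r; lra.
have : Cmod (F y s - F x t)%C * Cmod (G y s - G x t)%C <= k * 1 by apply: Rmult_le_compat; lra.
nra.
Qed.

Lemma joint_cont_shift f x j (w : R -> C) t : cont_at f (shift x j (w t)) -> cont_real w t ->
  joint_cont (fun y s => f (shift y j (w s))) x t.
Proof.
move=> Hf Hw eps He; have [d [D0 Hd]] := Hf eps He.
have [e [E0 He']] := Hw (d / 2) ltac:(lra).
exists (Rmin (d / 2) e); split; first by apply: Rmin_glb_lt; lra.
move=> y s Hy Hs; apply: Hd.
have -> : d = d / 2 + d / 2 by field.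
apply: near_shift2; first lra.
- exact: near_le (Rmin_l _ _) Hy.
- exact: He' (Rlt_le_trans _ _ _ Hs (Rmin_r _ _)).
Qed.

(** Compactness of [a, b]: for each s, d is at most the size [del t] of a neighbourhood containing
    s. Comparing F y s and F x s with F x t costs eps/2 each. *)
Lemma joint_cont_unif F x a b : (forall t, a <= t <= b -> joint_cont F x t) ->
  forall eps, 0 < eps -> exists d, 0 < d /\
    forall y t, near x y d -> a <= t <= b -> Cmod (F y t - F x t)%C <= eps.
Proof.
move=> H eps He.
have ex t : exists d : posreal, a <= t <= b -> forall y s, near x y d -> Rabs (s - t) < d ->
    Cmod (F y s - F x t)%C < eps / 2.
  case: (classic (a <= t <= b)) => Ht; last by exists (mkposreal 1 Rlt_0_1).
  have [d [D0 Hd]] := H t Ht (eps / 2) ltac:(lra).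
  by exists (mkposreal _ D0) => _; exact: Hd.
pose del t := proj1_sig (constructive_indefinite_description _ (ex t)).
have delP t := proj2_sig (constructive_indefinite_description _ (ex t)); rewrite -/(del _) in delP.
have [d Hd] := compactness_value_1d a b del.
exists d; split; first exact: cond_pos.
move=> y s Hy Hs; apply: NNPP => N; apply: (Hd s Hs) => -[t [Ht [Hst dt]]]; apply: N.
have Hst1 : Rabs (s - t) < del t := Hst.
have H1 := delP t Ht y s (near_le _ _ _ _ dt Hy) Hst1.
have H2 := delP t Ht x s (near_refl _ _ (cond_pos _)) Hst1.
have -> : (F y s - F x s = (F y s - F x t) + - (F x s - F x t))%C by ring.
by apply: Rle_trans (Cmod_triangle _ _) _; rewrite Cmod_opp; lra.
Qed.

(** * Integrals depending on a parameter *)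

Section Param.
Variables (F : X -> R -> C) (x : X) (T eta : R).
Hypotheses (T0 : 0 < T) (eta0 : 0 < eta).
Hypothesis HF : forall y t, near x y eta -> 0 <= t <= T -> joint_cont F y t.

Lemma par_int y : near x y eta -> is_Cint (F y) 0 T (Cint (F y) 0 T).
Proof. by move=> Hy; apply: cont_real_ex => [|t Ht]; [lra | apply: joint_cont_cont_real; apply: HF]. Qed.

Lemma par_cont : cont_at (fun y => Cint (F y) 0 T) x.
Proof.
move=> eps He.
have [t Ht|d [D0 Hd]] := joint_cont_unif F x 0 T _ (eps / (2 * T)) ltac:(apply: Rdiv_lt_0_compat; lra).
  by apply: HF => //; apply: near_refl.
exists (Rmin d eta); split; first exact: Rmin_glb_lt.
move=> y Hy.
have I := is_Cint_minus _ _ _ _ _ _ (par_int y (near_le _ _ _ _ (Rmin_r _ _) Hy)) (par_int x (near_refl _ _ eta0)).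
apply: Rle_lt_trans (is_Cint_norm _ 0 T (eps / (2 * T)) _ _ _ I) _; first lra.
- by move=> t Ht; apply: Hd => //; exact: near_le (Rmin_l _ _) Hy.
- have -> : (T - 0) * (eps / (2 * T)) = eps / 2 by field; lra.
  lra.
Qed.

Variables (F' : X -> R -> C) (i : 'I_n).
Hypothesis HF' : forall t, 0 <= t <= T -> joint_cont F' x t.
Hypothesis HD : forall y t, near x y eta -> 0 <= t <= T -> is_pderiv (fun y => F y t) i y (F' y t).

(** [complex_mvt] turns the uniform continuity of F' into a bound (eps / T) |h| on the linearization
    error of F, uniform in t; it can then be integrated over [0, T]. *)
Lemma par_deriv : is_pderiv (fun y => Cint (F y) 0 T) i x (Cint (F' x) 0 T).
Proof.
apply/cdiffP => eps He.
have [d [D0 Hd]] := joint_cont_unif F' x 0 T HF' (eps / T) ltac:(apply: Rdiv_lt_0_compat; lra).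
exists (Rmin d eta); split; first exact: Rmin_glb_lt.
move=> h Hh.
have Hh1 := Rlt_le_trans _ _ _ Hh (Rmin_l _ _); have Hh2 := Rlt_le_trans _ _ _ Hh (Rmin_r _ _).
rewrite Cplus_0_l shift0.
have I' : is_Cint (F' x) 0 T (Cint (F' x) 0 T).
  by apply: cont_real_ex => [|t Ht]; [lra | apply: joint_cont_cont_real; apply: HF'].
have I := is_Cint_minus _ _ _ _ _ _ (is_Cint_minus _ _ _ _ _ _
   (par_int (shift x i h) (near_shift _ _ _ _ Hh2)) (par_int x (near_refl _ _ eta0))) (is_Cint_cscal _ _ _ h _ I').
rewrite (Cmult_comm (Cint _ _ _)).
apply: Rle_trans (is_Cint_norm _ 0 T (eps / T * Cmod h) _ _ _ I) _; first lra; last first.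
  by apply: Req_le; field; lra.
move=> t Ht.
have := complex_mvt (fun h => F (shift x i h) t) (fun h => F' (shift x i h) t) (F' x t) (eps / T) (Rmin d eta) h.
rewrite shift0 (Cmult_comm _ h); apply => //.
- move=> z Hz; apply/(is_pderiv_at_shift (fun y => F y t)); apply: HD => //; apply: near_shift; exact: Rlt_le_trans Hz (Rmin_r _ _).
- move=> z Hz; apply: Hd => //; apply: near_shift; exact: Rlt_le_trans Hz (Rmin_l _ _).
Qed.
End Param.

Variable U : X -> Prop.
Hypothesis openU : forall x, U x -> exists d, 0 < d /\ forall y, near x y d -> U y.

Definition holo (f : X -> C) : Prop :=
  (forall x, U x -> cont_at f x) /\ (forall x, U x -> forall j, exists l, is_pderiv f j x l).

Lemma holo_holomorphic f : holo f <-> holomorphic_on U f.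
Proof.
split=> -[H1 H2]; split=> //.
- by move=> x Ux j; have [l Hl] := H2 x Ux j; exists l; apply/is_pderiv_cderiv.
- by move=> x Ux j; have [l Hl] := H2 x Ux j; exists l; apply/is_pderiv_cderiv.
Qed.

Lemma holo_is_pderiv f j x : holo f -> U x -> is_pderiv f j x (pderiv j f x).
Proof. by move=> [_ H] Ux; have [l Hl] := H x Ux j; rewrite (pderiv_unique _ _ _ _ Hl). Qed.

Definition eq_on (f g : X -> C) : Prop := forall x, U x -> f x = g x.

Lemma is_pderiv_eq_on f g j x l : eq_on f g -> U x -> is_pderiv f j x l -> is_pderiv g j x l.
Proof.
move=> E Ux; have [d [D0 Hd]] := openU x Ux.
apply: cdiff_ext_loc D0 _ => h Hh; rewrite Cplus_0_l; apply: E; apply: Hd; exact: near_shift.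
Qed.

Lemma cont_at_eq_on f g x : eq_on f g -> U x -> cont_at f x -> cont_at g x.
Proof.
move=> E Ux H eps He; have [d [D0 Hd]] := openU x Ux; have [e [E0 Hf]] := H eps He.
exists (Rmin d e); split; first exact: Rmin_glb_lt.
move=> y Hy; rewrite -!E //; first by apply: Hf; exact: near_le (Rmin_r _ _) Hy.
by apply: Hd; exact: near_le (Rmin_l _ _) Hy.
Qed.

Lemma eq_on_sym f g : eq_on f g -> eq_on g f.
Proof. by move=> E x Ux; rewrite E. Qed.

Lemma eq_on_trans f g h : eq_on f g -> eq_on g h -> eq_on f h.
Proof. by move=> E1 E2 x Ux; rewrite E1 ?E2. Qed.

Lemma holo_eq_on f g : eq_on f g -> holo f -> holo g.
Proof.
move=> E [H1 H2]; split=> x Ux; first by apply: (cont_at_eq_on f) => //; apply: H1.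
by move=> j; have [l Hl] := H2 x Ux j; exists l; apply: (is_pderiv_eq_on f).
Qed.

Lemma pderiv_eq_on f g j : eq_on f g -> eq_on (pderiv j f) (pderiv j g).
Proof.
move=> E x Ux; rewrite /pderiv; congr epsilon; apply: functional_extensionality => l.
apply: propositional_extensionality; rewrite -!is_pderiv_cderiv; split.
  exact: is_pderiv_eq_on.
by apply: is_pderiv_eq_on => //; apply: eq_on_sym.
Qed.

(** The increment exp (s + i t) runs over the circle of radius exp s; dividing by it is multiplying
    by the exponential of the opposite. *)
Definition circle_quot (f : X -> C) (j : 'I_n) (s : R) (x : X) (t : R) : C :=
  ((f (shift x j (cexp (s, t))) - f x) * cexp (- (s, t)))%C.

Lemma cont_real_cexp s t : cont_real (fun t => cexp (s, t)) t.
Proof.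
apply: (rdiff_cont_real2 (fun s t => cexp (s, t))); apply: (cdiff_rdiff cexp); exact: cdiff_cexp.
Qed.

Lemma cont_real_cexp_opp s t : cont_real (fun t => cexp (- (s, t))%C) t.
Proof.
apply: (rdiff_cont_real2 (fun s t => cexp (- (s, t))%C)); apply: (cdiff_rdiff (fun z => cexp (- z)%C)); exact: cdiff_cexp_opp.
Qed.

Lemma circle_quot_joint_cont f j s x t : holo f -> U x -> U (shift x j (cexp (s, t))) -> joint_cont (circle_quot f j s) x t.
Proof.
move=> [Hf _] Ux Us; apply: joint_cont_mult; last by apply: cont_real_joint_cont; exact: cont_real_cexp_opp.
apply: joint_cont_minus; last by apply: joint_cont_cont_at; apply: Hf.
apply: (joint_cont_shift f x j (fun t => cexp (s, t))); [exact: Hf | exact: cont_real_cexp].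
Qed.

(* The derivative at [x] is an average of translates of [f], with a radius that can be kept fixed
   while [x] varies: this gives its continuity, its differentiability and the symmetry of second
   derivatives. *)
Lemma mean_pderiv f j s d x : holo f -> (forall y, near x y d -> U y) -> exp s < d ->
  pderiv j f x = (Cint (circle_quot f j s x) 0 (2 * PI) / RtoC (2 * PI))%C.
Proof.
move=> Hf Hd sd; have d0 : 0 < d by have := exp_pos s; lra.
have Ux : U x by apply: Hd; apply: near_refl.
have H := circle_mean (fun h => f (shift x j h)) d s (pderiv j f x) _ sd (holo_is_pderiv f j x Hf Ux).
rewrite /circle_quot; rewrite shift0 in H.
have H1 := Cint_unique _ _ _ _ (H _); rewrite H1; last first.
  move=> z Hz; exists (pderiv j f (shift x j z)); apply/is_pderiv_at_shift; apply: holo_is_pderiv => //; apply: Hd.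
  exact: near_shift.
field; move/RtoC_inj; have := PI_RGT_0; lra.
Qed.

(** Halving a radius of openness gives one d valid at all points y near x, and exp s is half of that
    d: the same circle serves for all these y. *)
Lemma open_radius x : U x -> exists d s, 0 < d /\ exp s < d /\
   forall y, near x y d -> forall z, near y z d -> U z.
Proof.
move=> Ux; have [d [D0 Hd]] := openU x Ux.
exists (d / 2), (ln (d / 4)); split; first lra.
split; first by rewrite exp_ln; lra.
move=> y Hy z Hz; apply: Hd; have -> : d = d / 2 + d / 2 by field.
exact: near_trans Hy Hz.
Qed.

Lemma U_circle x d s y j t : exp s < d -> (forall y, near x y d -> forall z, near y z d -> U z) ->
  near x y d -> U y /\ U (shift y j (cexp (s, t))).
Proof.
move=> sd Hd Hy; split.
  by apply: (Hd y) => //; apply: near_refl; have := exp_pos s; lra.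
by apply: (Hd y) => //; apply: near_shift; rewrite Cmod_cexp.
Qed.

Lemma pderiv_cont f j x : holo f -> U x -> cont_at (pderiv j f) x.
Proof.
move=> Hf Ux; have [d [s [D0 [sd Hd]]]] := open_radius x Ux.
have pi0 := PI_RGT_0.
have H : cont_at (fun y => Cint (circle_quot f j s y) 0 (2 * PI)) x.
  apply: (par_cont _ _ _ d); try lra.
  by move=> y t Hy _; have [U1 U2] := U_circle x d s y j t sd Hd Hy; apply: circle_quot_joint_cont.
move=> eps He; have [e [E0 He']] := H eps He.
exists (Rmin d e); split; first exact: Rmin_glb_lt.
move=> y Hy.
have Hyd := near_le _ _ _ _ (Rmin_l _ _) Hy.
rewrite (mean_pderiv f j s d x) // ?(mean_pderiv f j s d y) //; first last.
- exact: Hd (near_refl _ _ D0).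
- exact: Hd.
have P2 : RtoC (2 * PI) <> 0%C by move/RtoC_inj; lra.
set p := Cint _ _ _; set q := Cint _ _ _.
have -> : (p / RtoC (2 * PI) - q / RtoC (2 * PI) = (p - q) / RtoC (2 * PI))%C by field.
rewrite Cmod_div // Cmod_R Rabs_pos_eq; last lra.
have := He' y (near_le _ _ _ _ (Rmin_r _ _) Hy); rewrite -/p -/q.
have PI1 : 1 < 2 * PI by have := PI2_1; lra.
have := Cmod_ge_0 (p - q)%C => c0 c1.
apply: Rle_lt_trans c1; apply: (Rmult_le_reg_r (2 * PI)); first lra.
have -> : Cmod (p - q)%C / (2 * PI) * (2 * PI) = Cmod (p - q)%C by field; lra.
nra.
Qed.

Lemma is_pderiv_shift f i j x w l : is_pderiv f i (shift x j w) l -> is_pderiv (fun y => f (shift y j w)) i x l.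
Proof. by apply: cdiff_ext => h; rewrite shiftC. Qed.

(** Differentiating the mean formula for d_j f under the integral turns the circle quotient of f
    into that of d_i f. The result is the mean formula for d_j (d_i f), which is where the symmetry
    of second derivatives comes from. *)
Lemma pderiv_pderiv f i j x d s : holo f -> 0 < d -> exp s < d ->
  (forall y, near x y d -> forall z, near y z d -> U z) ->
  is_pderiv (pderiv j f) i x (Cint (circle_quot (pderiv i f) j s x) 0 (2 * PI) / RtoC (2 * PI))%C.
Proof.
move=> Hf D0 sd Hd; have pi0 := PI_RGT_0.
have Ux : U x by apply: (Hd x); apply: near_refl.
have C := pderiv_cont f i.
have H : is_pderiv (fun y => Cint (circle_quot f j s y) 0 (2 * PI)) i x (Cint (circle_quot (pderiv i f) j s x) 0 (2 * PI)).
  apply: (par_deriv _ _ _ d); try lra.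
  - by move=> y t Hy _; have [U1 U2] := U_circle x d s y j t sd Hd Hy; apply: circle_quot_joint_cont.
  - move=> t _; have [U1 U2] := U_circle x d s x j t sd Hd (near_refl _ _ D0).
    apply: joint_cont_mult; last by apply: cont_real_joint_cont; exact: cont_real_cexp_opp.
    apply: joint_cont_minus; last by apply: joint_cont_cont_at; apply: C.
    by apply: (joint_cont_shift (pderiv i f) x j (fun t => cexp (s, t))); [apply: C | exact: cont_real_cexp].
  - move=> y t Hy _; have [U1 U2] := U_circle x d s y j t sd Hd Hy.
    have D1 := is_pderiv_shift _ _ _ _ _ _ (holo_is_pderiv f i _ Hf U2).
    have D2 := holo_is_pderiv f i _ Hf U1.
    have := cdiff_scal (cexp (- (s, t)))%C _ _ _ (cdiff_minus _ _ _ _ _ D1 D2).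
    rewrite Cmult_comm; apply: cdiff_ext => h; exact: Cmult_comm.
have := cdiff_scal (/ RtoC (2 * PI))%C _ _ _ H; rewrite Cmult_comm.
apply: cdiff_ext_loc D0 _ => h Hh; rewrite Cplus_0_l (mean_pderiv f j s d) //; first exact: Cmult_comm.
by apply: Hd; apply: near_shift.
Qed.

Lemma holo_pderiv f j : holo f -> holo (pderiv j f).
Proof.
move=> Hf; split=> x Ux; first exact: pderiv_cont.
move=> i; have [d [s [D0 [sd Hd]]]] := open_radius x Ux.
by eexists; apply: (pderiv_pderiv f i j x d s).
Qed.

Lemma pderivC f i j : holo f -> eq_on (pderiv i (pderiv j f)) (pderiv j (pderiv i f)).
Proof.
move=> Hf x Ux; have [d [s [D0 [sd Hd]]]] := open_radius x Ux.
rewrite (pderiv_unique _ _ _ _ (pderiv_pderiv f i j x d s Hf D0 sd Hd)).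
by rewrite (mean_pderiv (pderiv i f) j s d x) //; [apply: holo_pderiv | apply: Hd; apply: near_refl].
Qed.

End Several.

Arguments shift {n}. Arguments near {n}. Arguments is_pderiv {n}. Arguments cont_at {n}. Arguments holo {n}. Arguments eq_on {n}.
Arguments pderiv_unique {n f j x l}. Arguments holo_is_pderiv {n U} f j x. Arguments holo_eq_on {n U} openU f g.
Arguments pderiv_eq_on {n U} openU {f g} j. Arguments holo_pderiv {n U} openU f j. Arguments pderivC {n U} openU f i j.
Arguments eq_on_trans {n U f} g {h}. Arguments eq_on_sym {n U f g}. Arguments is_pderiv_eq_on {n U} openU f {g j x l}.

(** * Euler operators and sums of joint eigenfunctions *)

Section Operators.
Variable n : nat.
Notation X := ('I_n -> C).
Variable U : X -> Prop.
Hypothesis openU : forall x, U x -> exists d, 0 < d /\ forall y, near x y d -> U y.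
Notation zero := (fun _ : X => RtoC 0).

(** One operation covers sums (k = 1), differences (k = -1) and multiples (f = 0), so linearity is
    proved only once per operator. *)
Definition add_scaled (f : X -> C) (k : C) (g : X -> C) : X -> C := fun x => (f x + k * g x)%C.

Lemma add_scaled_eq_on f f' k g g' : eq_on U f f' -> eq_on U g g' -> eq_on U (add_scaled f k g) (add_scaled f' k g').
Proof. by move=> E1 E2 x Ux; rewrite /add_scaled E1 ?E2. Qed.

Lemma is_pderiv_add_scaled f k g j x l m : is_pderiv f j x l -> is_pderiv g j x m -> is_pderiv (add_scaled f k g) j x (l + k * m)%C.
Proof. by move=> H1 H2; apply: cdiff_plus => //; apply: cdiff_scal. Qed.

Lemma cont_at_joint_cont (f : X -> C) x : joint_cont n (fun y _ => f y) x 0 -> cont_at f x.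
Proof.
move=> H eps He; have [d [D0 Hd]] := H eps He; exists d; split=> // y Hy.
by apply: (Hd y 0 Hy); rewrite Rminus_diag Rabs_R0.
Qed.

Lemma cont_at_mult (f g : X -> C) x : cont_at f x -> cont_at g x -> cont_at (fun y => f y * g y)%C x.
Proof.
move=> H1 H2; apply: cont_at_joint_cont; apply: (joint_cont_mult n (fun y _ => f y) (fun y _ => g y)); exact: joint_cont_cont_at.
Qed.

Lemma cont_at_plus (f g : X -> C) x : cont_at f x -> cont_at g x -> cont_at (fun y => f y + g y)%C x.
Proof.
move=> Hf Hg eps He.
have [d [D0 Hd]] := Hf (eps / 2) ltac:(lra).
have [e [E0 He']] := Hg (eps / 2) ltac:(lra).
exists (Rmin d e); split; first exact: Rmin_glb_lt.
move=> y Hy.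
have H1 := Hd y (near_le _ _ _ _ _ (Rmin_l _ _) Hy).
have H2 := He' y (near_le _ _ _ _ _ (Rmin_r _ _) Hy).
have -> : (f y + g y - (f x + g x) = (f y - f x) + (g y - g x))%C by ring.
by apply: Rle_lt_trans (Cmod_triangle _ _) _; lra.
Qed.

Lemma cont_at_const k (x : X) : cont_at (fun _ => k) x.
Proof.
move=> eps He; exists 1; split; first lra.
by move=> y _; have -> : (k - k = 0)%C by [ring|]; rewrite Cmod_0.
Qed.

Lemma holo_const k : holo U (fun _ => k).
Proof.
split=> x Ux; first exact: cont_at_const.
by move=> j; exists (RtoC 0); apply: cdiff_const.
Qed.

Lemma holo_add_scaled f k g : holo U f -> holo U g -> holo U (add_scaled f k g).
Proof.
move=> Hf Hg; split=> x Ux.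
  apply: cont_at_plus; first by apply: Hf.1.
  by apply: cont_at_mult; [apply: cont_at_const | apply: Hg.1].
by move=> j; eexists; apply: is_pderiv_add_scaled (holo_is_pderiv f j x Hf Ux) (holo_is_pderiv g j x Hg Ux).
Qed.

Lemma is_pderiv_coord i j (x : X) : is_pderiv (fun x : X => x i) j x (if i == j then 1 else 0)%C.
Proof.
rewrite /is_pderiv /shift; case: eqP => _; last exact: cdiff_const.
have H := cdiff_plus _ _ _ _ _ (cdiff_const (x i) 0%C) (cdiff_id 0%C).
by rewrite Cplus_0_l in H.
Qed.

Lemma is_pderiv_mult (f g : X -> C) j x l m : is_pderiv f j x l -> is_pderiv g j x m ->
  is_pderiv (fun x => f x * g x)%C j x (l * g x + f x * m)%C.
Proof. by move=> H1 H2; have := cdiff_mult _ _ _ _ _ H1 H2; rewrite shift0. Qed.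

Lemma holo_mult f g : holo U f -> holo U g -> holo U (fun x => f x * g x)%C.
Proof.
move=> Hf Hg; split=> x Ux; first by apply: cont_at_mult; [apply: Hf.1 | apply: Hg.1].
by move=> j; eexists; apply: is_pderiv_mult (holo_is_pderiv f j x Hf Ux) (holo_is_pderiv g j x Hg Ux).
Qed.

Lemma holo_coord i : holo U (fun x : X => x i).
Proof.
split=> x Ux; last by move=> j; eexists; apply: is_pderiv_coord.
by move=> eps He; exists eps; split=> // y Hy; apply: Hy.
Qed.

Definition theta (i : 'I_n) (f : X -> C) : X -> C := fun x => (x i * pderiv i f x)%C.

Lemma holo_theta i f : holo U f -> holo U (theta i f).
Proof. by move=> Hf; apply: holo_mult; [apply: holo_coord | apply: holo_pderiv]. Qed.

Lemma theta_eq_on i f g : eq_on U f g -> eq_on U (theta i f) (theta i g).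
Proof. by move=> E x Ux; rewrite /theta (pderiv_eq_on openU i E x Ux). Qed.

Lemma theta_add_scaled i f k g : holo U f -> holo U g -> eq_on U (theta i (add_scaled f k g)) (add_scaled (theta i f) k (theta i g)).
Proof.
move=> Hf Hg x Ux; rewrite /theta /add_scaled.
rewrite (pderiv_unique (is_pderiv_add_scaled _ k _ _ _ _ _ (holo_is_pderiv f i x Hf Ux) (holo_is_pderiv g i x Hg Ux))); ring.
Qed.

Lemma theta_const i k : eq_on U (theta i (fun _ => k)) zero.
Proof.
move=> x Ux; rewrite /theta (pderiv_unique (l := 0%C)); first ring.
exact: cdiff_const.
Qed.

Lemma thetaC i j f : holo U f -> eq_on U (theta i (theta j f)) (theta j (theta i f)).
Proof.
move=> Hf; case: (eqVneq i j) => [->//|ij].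
have E a b : a != b -> eq_on U (theta a (theta b f)) (fun x => x a * x b * pderiv a (pderiv b f) x)%C.
  move=> /negbTE ab x Ux; rewrite /theta.
  rewrite (pderiv_unique (is_pderiv_mult _ _ _ _ _ _ (is_pderiv_coord b a x) (holo_is_pderiv (pderiv b f) a x (holo_pderiv openU _ _ Hf) Ux))).
  rewrite eq_sym ab; ring.
move=> x Ux; rewrite !E //; last by rewrite eq_sym.
rewrite (pderivC openU f i j Hf x Ux); ring.
Qed.

(** A pair q = (i, l) encodes the factor theta_i - l. *)
Definition theta_sub (q : 'I_n * nat) (f : X -> C) : X -> C := add_scaled (theta q.1 f) (- RtoC (INR q.2))%C f.

Lemma holo_theta_sub q f : holo U f -> holo U (theta_sub q f).
Proof. by move=> Hf; apply: holo_add_scaled => //; apply: holo_theta. Qed.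

Lemma theta_sub_eq_on q f g : eq_on U f g -> eq_on U (theta_sub q f) (theta_sub q g).
Proof. by move=> E; apply: add_scaled_eq_on => //; apply: theta_eq_on. Qed.

Lemma theta_sub_add_scaled q f k g : holo U f -> holo U g -> eq_on U (theta_sub q (add_scaled f k g)) (add_scaled (theta_sub q f) k (theta_sub q g)).
Proof. by move=> Hf Hg x Ux; rewrite /theta_sub {1}/add_scaled theta_add_scaled // /add_scaled; ring. Qed.

Lemma theta_theta_sub i q f : holo U f -> eq_on U (theta i (theta_sub q f)) (theta_sub q (theta i f)).
Proof.
move=> Hf x Ux; rewrite /theta_sub theta_add_scaled //; last exact: holo_theta.
by rewrite /add_scaled thetaC.
Qed.

Lemma theta_subC q r f : holo U f -> eq_on U (theta_sub q (theta_sub r f)) (theta_sub r (theta_sub q f)).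
Proof.
move=> Hf x Ux; rewrite {1}/theta_sub {1}/add_scaled theta_theta_sub //.
exact: (esym (theta_sub_add_scaled r _ _ _ (holo_theta _ _ Hf) Hf x Ux)).
Qed.

Lemma theta_sub_zero q : eq_on U (theta_sub q zero) zero.
Proof. by move=> x Ux; rewrite /theta_sub /add_scaled theta_const //; ring. Qed.

(** With [foldl] the head acts first: killing f by q :: L is killing [theta_sub q f] by L, the form
    in which a factor is peeled off by induction. *)
Definition theta_prod (L : seq ('I_n * nat)) (f : X -> C) : X -> C := foldl (fun g q => theta_sub q g) f L.

Lemma theta_prod_eq_on L f g : eq_on U f g -> eq_on U (theta_prod L f) (theta_prod L g).
Proof. by elim: L f g => //= q L IH f g E; apply: IH; apply: theta_sub_eq_on. Qed.

Lemma theta_prod_add_scaled L f k g : holo U f -> holo U g -> eq_on U (theta_prod L (add_scaled f k g)) (add_scaled (theta_prod L f) k (theta_prod L g)).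
Proof.
elim: L f g => //= q L IH f g Hf Hg.
apply: eq_on_trans (IH _ _ (holo_theta_sub _ _ Hf) (holo_theta_sub _ _ Hg)).
by apply: theta_prod_eq_on; apply: theta_sub_add_scaled.
Qed.

Lemma theta_prod_theta_sub L q f : holo U f -> eq_on U (theta_prod L (theta_sub q f)) (theta_sub q (theta_prod L f)).
Proof.
elim: L f => //= r L IH f Hf.
apply: (eq_on_trans (theta_prod L (theta_sub q (theta_sub r f)))); first by apply: theta_prod_eq_on; apply: theta_subC.
by apply: IH; apply: holo_theta_sub.
Qed.

Lemma theta_prod_zero L : eq_on U (theta_prod L zero) zero.
Proof.
elim: L => //= q L IH; apply: eq_on_trans IH; apply: theta_prod_eq_on; exact: theta_sub_zero.
Qed.

(** * Homogeneous functions and joint eigenfunctions *)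

Variables (c : X) (Rel : X -> Prop).

Definition homog (f : X -> C) : Prop := holo U f /\ forall w, Rel w ->
  eq_on U (fun x => Csum (fun j => w j * theta j f x)%C) (fun x => Csum (fun j => w j * c j) * f x)%C.

Lemma Csum_ext (F G : 'I_n -> C) : (forall j, F j = G j) -> Csum F = Csum G.
Proof. by move=> E; rewrite /Csum; elim: (enum _) => //= j s ->; rewrite E. Qed.

Lemma Csum_add_scaled (F G : 'I_n -> C) k : Csum (fun j => F j + k * G j)%C = (Csum F + k * Csum G)%C.
Proof. by rewrite /Csum; elim: (enum _) => [|j s /= ->] /=; ring. Qed.

Lemma homog_add_scaled f k g : homog f -> homog g -> homog (add_scaled f k g).
Proof.
move=> [Hf Rf] [Hg Rg]; split; first exact: holo_add_scaled.
move=> w Hw x Ux; have E1 := Rf w Hw x Ux; have E2 := Rg w Hw x Ux; rewrite /= in E1 E2.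
rewrite (Csum_ext _ (fun j => w j * theta j f x + k * (w j * theta j g x))%C).
  by rewrite Csum_add_scaled E1 E2 /add_scaled; ring.
by move=> j; rewrite theta_add_scaled // /add_scaled; ring.
Qed.

Lemma homog_eq_on f g : eq_on U f g -> homog f -> homog g.
Proof.
move=> E [Hf Rf]; split; first exact: holo_eq_on E Hf.
move=> w Hw x Ux; rewrite -E // -Rf //; apply: Csum_ext => j.
by rewrite -(theta_eq_on j _ _ E).
Qed.

Lemma homog_zero : homog zero.
Proof.
split; first exact: holo_const.
move=> w Hw x Ux; rewrite (Csum_ext _ (fun j => 0 + 0 * 0)%C) ?Csum_add_scaled.
  have -> : Csum (fun _ : 'I_n => 0%C) = 0%C by rewrite /Csum; elim: (enum _) => //= j s ->; ring.
  ring.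
by move=> j; rewrite theta_const //; ring.
Qed.

Lemma theta_Csum i (F : 'I_n -> X -> C) (w : 'I_n -> C) : (forall j, holo U (F j)) ->
  eq_on U (theta i (fun x => Csum (fun j => w j * F j x)%C)) (fun x => Csum (fun j => w j * theta i (F j) x)%C).
Proof.
move=> HF; rewrite /Csum.
have : holo U (fun x => foldr (fun j acc => (w j * F j x + acc)%C) 0%C (enum 'I_n)) /\
  eq_on U (theta i (fun x => foldr (fun j acc => (w j * F j x + acc)%C) 0%C (enum 'I_n)))
   (fun x => foldr (fun j acc => (w j * theta i (F j) x + acc)%C) 0%C (enum 'I_n)); last by case.
elim: (enum _) => [|j s [H1 H2]] /=; first by split; [exact: holo_const | exact: theta_const].
have E : eq_on U (fun x => w j * F j x + foldr (fun j acc => (w j * F j x + acc)%C) 0%C s)%C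
   (add_scaled (fun x => foldr (fun j acc => (w j * F j x + acc)%C) 0%C s) (w j) (F j)).
  by move=> x _; rewrite /add_scaled; ring.
split; first by apply: (holo_eq_on openU _ _ (eq_on_sym E)); apply: holo_add_scaled.
apply: eq_on_trans (theta_eq_on i _ _ E) _.
move=> x Ux; rewrite theta_add_scaled // /add_scaled H2 //; ring.
Qed.

Lemma homog_theta i f : homog f -> homog (theta i f).
Proof.
move=> [Hf Rf]; split; first exact: holo_theta.
move=> w Hw x Ux.
rewrite (Csum_ext _ (fun j => w j * theta i (theta j f) x)%C); last by move=> j; rewrite thetaC.
rewrite -(theta_Csum i (fun j => theta j f)) //; last by move=> j; apply: holo_theta.
rewrite (theta_eq_on i _ _ (Rf w Hw) x Ux).
have E : eq_on U (fun x => Csum (fun j => w j * c j) * f x)%C (add_scaled zero (Csum (fun j => w j * c j))%C f).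
  by move=> y _; rewrite /add_scaled; ring.
rewrite (theta_eq_on i _ _ E x Ux) theta_add_scaled //; last exact: holo_const.
by rewrite /add_scaled theta_const //; ring.
Qed.

Lemma homog_theta_sub q f : homog f -> homog (theta_sub q f).
Proof. by move=> Hf; apply: homog_add_scaled => //; apply: homog_theta. Qed.

(** The zero function qualifies for every p; impossible eigenvalues therefore appear below as the
    conclusion that h vanishes on U. *)
Definition eigenfun (p : X) (h : X -> C) : Prop := homog h /\ forall k, eq_on U (theta k h) (fun x => p k * h x)%C.

Lemma eigenfun_eq_on p f g : eq_on U f g -> eigenfun p f -> eigenfun p g.
Proof.
move=> E [H1 H2]; split; first exact: homog_eq_on E H1.
by move=> k x Ux; rewrite -E // -H2 // (theta_eq_on k _ _ E).
Qed.

Lemma eigenfun_scal p k h : eigenfun p h -> eigenfun p (add_scaled zero k h).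
Proof.
move=> [H1 H2]; split; first exact: (homog_add_scaled _ _ _ homog_zero).
move=> i x Ux; rewrite theta_add_scaled //; [|exact: holo_const|exact: H1.1].
by rewrite /add_scaled theta_const // H2 //; ring.
Qed.

Lemma theta_sub_eigenfun p h q : eigenfun p h -> eq_on U (theta_sub q h) (add_scaled zero (p q.1 - RtoC (INR q.2))%C h).
Proof. by move=> [_ H] x Ux; rewrite /theta_sub /add_scaled H //; ring. Qed.

Lemma theta_prod_eigenfun p h L q : eigenfun p h -> q \in L -> p q.1 = RtoC (INR q.2) -> eq_on U (theta_prod L h) zero.
Proof.
elim: L h => //= r L IH h Hh; rewrite in_cons => /orP[/eqP <-|qL] E.
  apply: eq_on_trans (theta_prod_zero L); apply: theta_prod_eq_on; apply: eq_on_trans (theta_sub_eigenfun _ _ q Hh) _.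
  by move=> x Ux; rewrite /add_scaled E; ring.
apply: IH => //; exact: (eigenfun_eq_on _ _ _ (eq_on_sym (theta_sub_eigenfun _ _ r Hh))) (eigenfun_scal _ _ _ Hh).
Qed.

(* [eigensum P f]: on [U], [f] is a finite sum of joint eigenfunctions whose eigenvalues satisfy [P]. *)
Inductive eigensum (P : X -> Prop) : (X -> C) -> Prop :=
| eigensum_nil f : eq_on U f zero -> eigensum P f
| eigensum_cons f g p h : eigensum P g -> eigenfun p h -> P p -> eq_on U f (add_scaled g 1 h) -> eigensum P f.

Lemma eigensum_eq_on P f g : eq_on U f g -> eigensum P f -> eigensum P g.
Proof.
move=> E H; case: H E => [f' E0|f' g' p h D1 D2 D3 E0] E.
  by apply: eigensum_nil; apply: eq_on_trans E0; apply: eq_on_sym.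
by apply: (eigensum_cons _ _ g' p h) => //; apply: eq_on_trans E0; apply: eq_on_sym.
Qed.

Lemma eigensum_imp (P Q : X -> Prop) f : (forall p, P p -> Q p) -> eigensum P f -> eigensum Q f.
Proof.
move=> PQ; elim=> [g|g g' p h _ IH Hh Pp E]; first exact: eigensum_nil.
by apply: (eigensum_cons _ _ g' p h) => //; apply: PQ.
Qed.

Lemma eigensum_eigenfun (P : X -> Prop) p h : eigenfun p h -> P p -> eigensum P h.
Proof.
move=> Hh Pp; apply: (eigensum_cons _ _ zero p h) => //; first exact: eigensum_nil.
by move=> x _; rewrite /add_scaled; ring.
Qed.

Lemma eigensum_add P f g : eigensum P f -> eigensum P g -> eigensum P (add_scaled f 1 g).
Proof.
move=> Df; elim=> [g0 E|g0 g' p h _ IH Hh Pp E].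
  by apply: eigensum_eq_on Df => x Ux; rewrite /add_scaled E //; ring.
apply: (eigensum_cons _ _ (add_scaled f 1 g') p h) => // x Ux; rewrite /add_scaled E // /add_scaled; ring.
Qed.

Lemma eigensum_homog P f : eigensum P f -> homog f.
Proof.
elim=> [g E|g g' p h _ IH Hh Pp E]; first exact: homog_eq_on (eq_on_sym E) homog_zero.
by apply: (homog_eq_on _ _ (eq_on_sym E)); apply: homog_add_scaled => //; case: Hh.
Qed.

Lemma eigensum_theta_sub P f q : (forall p, P p -> p q.1 = RtoC (INR q.2)) -> eigensum P f -> eq_on U (theta_sub q f) zero.
Proof.
move=> HP; elim=> [g E|g g' p h D IH Hh Pp E].
  by apply: eq_on_trans (theta_sub_eq_on q _ _ E) (theta_sub_zero q).
apply: eq_on_trans (theta_sub_eq_on q _ _ E) _.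
apply: eq_on_trans (theta_sub_add_scaled q _ _ _ (eigensum_homog _ _ D).1 Hh.1.1) _.
by move=> x Ux; rewrite /add_scaled IH // (theta_sub_eigenfun _ _ q Hh) // /add_scaled HP //; ring.
Qed.

Lemma eigensum_theta_prod P f L : (forall p, P p -> exists2 q, q \in L & p q.1 = RtoC (INR q.2)) ->
  eigensum P f -> eq_on U (theta_prod L f) zero.
Proof.
move=> HP; elim=> [g E|g g' p h D IH Hh Pp E].
  by apply: eq_on_trans (theta_prod_eq_on L _ _ E) (theta_prod_zero L).
apply: eq_on_trans (theta_prod_eq_on L _ _ E) _.
apply: eq_on_trans (theta_prod_add_scaled L _ _ _ (eigensum_homog _ _ D).1 Hh.1.1) _.
have [q qL Eq] := HP p Pp.
by move=> x Ux; rewrite /add_scaled IH // (theta_prod_eigenfun _ _ L q Hh) //; ring.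
Qed.

(** On an eigenfunction the factor acts as the scalar p_i - l, so it is inverted by division. The
    hypothesis makes the terms where this scalar is 0 vanish. *)
Lemma eigensum_solve P g q : eigensum P g ->
  (forall p h, P p -> eigenfun p h -> p q.1 = RtoC (INR q.2) -> eq_on U h zero) ->
  exists2 r, eigensum P r & eq_on U (theta_sub q r) g.
Proof.
move=> Dg NC; elim: Dg => [f E|f g' p h _ [r Dr Er] Hh Pp E].
  exists zero; first exact: eigensum_nil.
  exact: eq_on_trans (theta_sub_zero q) (eq_on_sym E).
(* If the denominator is 0, the value of k is immaterial, because then h = 0 on U. *)
pose k := (/ (p q.1 - RtoC (INR q.2)))%C.
have Hk := eigenfun_scal _ k _ Hh.
exists (add_scaled r 1 (add_scaled zero k h)).
  by apply: eigensum_add => //; apply: eigensum_eigenfun Hk Pp.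
apply: eq_on_trans (theta_sub_add_scaled q _ _ _ (eigensum_homog _ _ Dr).1 Hk.1.1) _.
apply: eq_on_trans (eq_on_sym E) => x Ux.
rewrite /add_scaled Er // (theta_sub_eigenfun _ _ q Hk) // /add_scaled; congr Cplus.
case: (Ceq_dec (p q.1) (RtoC (INR q.2))) => [e|ne].
  by rewrite (NC p h Pp Hh e x Ux); ring.
rewrite /k; field => e; apply: ne.
by rewrite -(Cplus_0_l (RtoC (INR q.2))) -e; ring.
Qed.

(** Subtracting from f a preimage r of [theta_sub q f] leaves a remainder g that the single factor
    kills. *)
Lemma eigensum_peel P f q : homog f -> eigensum P (theta_sub q f) ->
  (forall p h, P p -> eigenfun p h -> p q.1 = RtoC (INR q.2) -> eq_on U h zero) ->
  exists r g, [/\ eigensum P r, homog g, eq_on U (theta_sub q g) zero & eq_on U f (add_scaled r 1 g)].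
Proof.
move=> Hf D NC; have [r Dr Er] := eigensum_solve _ _ _ D NC.
have Hr := eigensum_homog _ _ Dr.
exists r, (add_scaled f (- (1))%C r); split=> //; first exact: homog_add_scaled.
  apply: eq_on_trans (theta_sub_add_scaled q _ _ _ Hf.1 Hr.1) _ => x Ux; rewrite /add_scaled Er //; ring.
by move=> x Ux; rewrite /add_scaled; ring.
Qed.

(** * Decomposition by two families of factors *)

Variables P1 P2 : 'I_n -> Prop.
Hypothesis P12 : forall i, P1 i -> P2 i -> False.
Hypothesis triple : forall i j k (a b d : nat) p h, i <> j -> i <> k -> j <> k -> eigenfun p h ->
  p i = RtoC (INR a) -> p j = RtoC (INR b) -> p k = RtoC (INR d) -> eq_on U h zero.
Hypothesis pair12 : forall q r f, P1 q.1 -> P2 r.1 -> homog f -> eq_on U (theta_sub q f) zero -> eq_on U (theta_sub r f) zero ->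
  exists p, [/\ eigenfun p f, p q.1 = RtoC (INR q.2) & p r.1 = RtoC (INR r.2)].

(** Induction on L. The eigenvalues of [theta_sub r f] lie on the line q and on a line s of L, so
    [triple] or uniqueness in L allows r to be peeled off. The remainder is killed by both q and r,
    and [pair12] makes it an eigenfunction. *)
Lemma eigensum_single q L f : P1 q.1 -> (forall r, r \in L -> P2 r.1) -> uniq L -> homog f ->
  eq_on U (theta_sub q f) zero -> eq_on U (theta_prod L f) zero ->
  eigensum (fun p => p q.1 = RtoC (INR q.2) /\ exists2 r, r \in L & p r.1 = RtoC (INR r.2)) f.
Proof.
move=> Pq; elim: L f => [|r L IH] f /= PL; first by move=> _ _ _ E; apply: eigensum_nil.
move=> /andP[rL uL] Hf Tf Lf.
have Pr : P2 r.1 by apply: PL; rewrite mem_head.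
have PL' s : s \in L -> P2 s.1 by move=> sL; apply: PL; rewrite in_cons sL orbT.
have D : eigensum (fun p => p q.1 = RtoC (INR q.2) /\ exists2 r, r \in L & p r.1 = RtoC (INR r.2)) (theta_sub r f).
  apply: IH => //; first exact: homog_theta_sub.
  exact: eq_on_trans (theta_subC q r f Hf.1) (eq_on_trans _ (theta_sub_eq_on r _ _ Tf) (theta_sub_zero r)).
have [p h [pq [s sL ps]] Hh pr|r' [g [Dr' Hg Trg Eg]]] := eigensum_peel _ f r Hf D.
  have ne (i j : 'I_n) : P1 i -> P2 j -> i <> j by move=> Pi Pj E; apply: (P12 i) => //; rewrite E.
  (* For equal indices the eigenvalue determines the integer, so s = r, against [uniq]; for
     different ones q, s, r form a triple. *)
  case: (eqVneq s.1 r.1) => [sr|/eqP sr].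
    have E : s = r.
      case: s r sr ps pr sL {rL uL Lf PL Pr D} => [i a] [j b] /= <- -> /RtoC_inj /INR_eq -> //.
    by rewrite -E sL in rL.
  exact: (triple q.1 s.1 r.1 q.2 s.2 r.2 p h (ne _ _ Pq (PL' _ sL)) (ne _ _ Pq Pr) sr Hh pq ps pr).
have Tqg : eq_on U (theta_sub q g) zero.
  have H1 := eq_on_trans _ (eq_on_sym Tf) (theta_sub_eq_on q _ _ Eg).
  have H2 := eq_on_trans _ H1 (theta_sub_add_scaled q _ 1 _ (eigensum_homog _ _ Dr').1 Hg.1).
  move=> x Ux; have := H2 x Ux; rewrite /add_scaled (eigensum_theta_sub _ _ q _ Dr') //; last by move=> p [].
  by move=> ->; ring.
have [p [Ep p1 p2]] := pair12 q r g Pq Pr Hg Tqg Trg.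
apply: eigensum_eq_on (eq_on_sym Eg) _; apply: eigensum_add.
  apply: eigensum_imp Dr' => p' [p'1 [s sL p's]]; split=> //; exists s => //.
  by rewrite in_cons sL orbT.
by apply: eigensum_eigenfun Ep _; split=> //; exists r => //; rewrite mem_head.
Qed.

(** Induction on K, leaving each remainder to [eigensum_single]. The eigenvalues are recorded
    because of both lists: the line of K is used to exclude a collision with q, the line of L to
    show that the product over L kills r' and hence also the remainder g = f - r'. *)
Theorem eigensum_of_theta_prod K L f : (forall q, q \in K -> P1 q.1) -> (forall r, r \in L -> P2 r.1) ->
  uniq K -> uniq L -> homog f -> eq_on U (theta_prod K f) zero -> eq_on U (theta_prod L f) zero ->
  eigensum (fun p => (exists2 q, q \in K & p q.1 = RtoC (INR q.2)) /\
                exists2 r, r \in L & p r.1 = RtoC (INR r.2)) f.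
Proof.
move=> PK PL; elim: K f PK => [|q K IH] f /= PK; first by move=> _ _ _ E _; apply: eigensum_nil.
move=> /andP[qK uK] uL Hf Kf Lf.
have Pq : P1 q.1 by apply: PK; rewrite mem_head.
have PK' s : s \in K -> P1 s.1 by move=> sK; apply: PK; rewrite in_cons sK orbT.
have D : eigensum (fun p => (exists2 q, q \in K & p q.1 = RtoC (INR q.2)) /\
                exists2 r, r \in L & p r.1 = RtoC (INR r.2)) (theta_sub q f).
  apply: IH => //; first exact: homog_theta_sub.
  exact: eq_on_trans (theta_prod_theta_sub L q f Hf.1) (eq_on_trans _ (theta_sub_eq_on q _ _ Lf) (theta_sub_zero q)).
have [p h [[s sK ps] [r rL pr]] Hh pq|r' [g [Dr' Hg Tqg Eg]]] := eigensum_peel _ f q Hf D.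
  have ne (i j : 'I_n) : P1 i -> P2 j -> i <> j by move=> Pi Pj E; apply: (P12 i) => //; rewrite E.
  case: (eqVneq s.1 q.1) => [sq|/eqP sq].
    have E : s = q.
      case: s q sq ps pq sK {qK uK Kf PK Pq D} => [i a] [j b] /= <- -> /RtoC_inj /INR_eq -> //.
    by rewrite -E sK in qK.
  exact: (triple s.1 q.1 r.1 s.2 q.2 r.2 p h sq (ne _ _ (PK' _ sK) (PL _ rL)) (ne _ _ Pq (PL _ rL)) Hh ps pq pr).
have Lg : eq_on U (theta_prod L g) zero.
  have H1 := eq_on_trans _ (eq_on_sym Lf) (theta_prod_eq_on L _ _ Eg).
  have H2 := eq_on_trans _ H1 (theta_prod_add_scaled L _ 1 _ (eigensum_homog _ _ Dr').1 Hg.1).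
  move=> x Ux; have := H2 x Ux; rewrite /add_scaled (eigensum_theta_prod _ _ L _ Dr') //; last by move=> p [_ [r ? ?]]; exists r.
  by move=> ->; ring.
apply: eigensum_eq_on (eq_on_sym Eg) _; apply: eigensum_add.
  apply: eigensum_imp Dr' => p [[s sK ps] Hr]; split=> //; exists s => //.
  by rewrite in_cons sK orbT.
apply: eigensum_imp (eigensum_single q L g Pq PL uL Hg Tqg Lg) => p [pq Hr]; split=> //.
by exists q => //; rewrite mem_head.
Qed.
End Operators.

(** * Branches of the logarithm, iterated derivatives *)

(* Only used on the half-plane [0 < Re z]. *)
Definition plog (z : C) : C := (ln (Re z * Re z + Im z * Im z) / 2, atan (Im z * / Re z)).

Lemma cexp_plog z : 0 < Re z -> cexp (plog z) = z.
Proof.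
case: z => x y; rewrite /plog /cexp /= => x0.
have s0 : 0 < x * x + y * y by nra.
have -> : exp (ln (x * x + y * y) / 2) = sqrt (x * x + y * y).
  rewrite -Rpower_sqrt // /Rpower; congr exp; field.
have E : sqrt (1 + Rsqr (y * / x)) = sqrt (x * x + y * y) / x.
  transitivity (sqrt (x * x + y * y) / sqrt (x * x)); last by rewrite sqrt_square; lra.
  rewrite -sqrt_div_alt; last nra.
  congr sqrt; rewrite /Rsqr; field; lra.
have q0 := sqrt_lt_R0 _ s0.
rewrite cos_atan sin_atan E; congr pair; field; lra.
Qed.

(** The modulus is bounded by the sum of the absolute values of the two components, so each gets
    eps/2. *)
Lemma ccont_of_continuous (f g : C -> R) z :
  continuous (T := prod_UniformSpace R_UniformSpace R_UniformSpace) (U := R_UniformSpace) f z ->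
  continuous (T := prod_UniformSpace R_UniformSpace R_UniformSpace) (U := R_UniformSpace) g z ->
  ccont (fun w => (f w, g w)) z.
Proof.
have H (h : C -> R) : continuous (T := prod_UniformSpace R_UniformSpace R_UniformSpace) (U := R_UniformSpace) h z ->
    forall eps, 0 < eps -> exists d, 0 < d /\ forall w, Cmod (w - z)%C < d -> Rabs (h w - h z) < eps.
  move=> Hh eps He.
  have [d Hd] := Hh (fun y => Rabs (y - h z) < eps) ltac:(by exists (mkposreal _ He) => y).
  exists d; split; first exact: cond_pos.
  move=> w Hw; apply: Hd; have M := Rmax_Cmod (w - z)%C.
  split; [exact: Rle_lt_trans (Rle_trans _ _ _ (Rmax_l _ _) M) Hw | exact: Rle_lt_trans (Rle_trans _ _ _ (Rmax_r _ _) M) Hw].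
move=> Hf Hg eps He.
have [d [D0 Hd]] := H f Hf (eps / 2) ltac:(lra).
have [e [E0 He']] := H g Hg (eps / 2) ltac:(lra).
exists (Rmin d e); split; first exact: Rmin_glb_lt.
move=> w Hw; apply: Rle_lt_trans (Cmod_le_Re_Im _) _ => /=.
have := Hd w (Rlt_le_trans _ _ _ Hw (Rmin_l _ _)); have := He' w (Rlt_le_trans _ _ _ Hw (Rmin_r _ _)).
rewrite /Rminus; lra.
Qed.

Lemma ccont_plog z : 0 < Re z -> ccont plog z.
Proof.
case: z => x y /= x0; apply: ccont_of_continuous.
- apply: (continuous_mult (K := R_AbsRing)); last exact: continuous_const.
  apply: (continuous_comp (V := R_UniformSpace) (W := R_UniformSpace) _ ln) => /=.
    apply: (continuous_plus (K := R_AbsRing) (V := R_NormedModule)); apply: (continuous_mult (K := R_AbsRing));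
      first [exact: (continuous_fst (U := R_UniformSpace) (V := R_UniformSpace) x y) | exact: (continuous_snd (U := R_UniformSpace) (V := R_UniformSpace) x y)].
  apply/continuity_pt_filterlim; apply: derivable_continuous_pt; eexists; apply: derivable_pt_lim_ln; nra.
- apply: (continuous_comp (V := R_UniformSpace) (W := R_UniformSpace) _ atan) => /=.
    apply: (continuous_mult (K := R_AbsRing)); first exact: (continuous_snd (U := R_UniformSpace) (V := R_UniformSpace) x y).
    apply: (continuous_comp (V := R_UniformSpace) (W := R_UniformSpace) _ Rinv) => /=.
      exact: (continuous_fst (U := R_UniformSpace) (V := R_UniformSpace) x y).
    by apply: continuous_Rinv; lra.
  apply/continuity_pt_filterlim; apply: derivable_continuous_pt; exact: derivable_pt_atan.
Qed.

Lemma log_exists (a : C) : a <> 0%C -> exists w, cexp w = a.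
Proof.
move=> Ha; have M0 : 0 < Cmod a by apply/Cmod_gt_0.
have E2 := Cmod2_alt a.
set m := Cmod a in M0 E2.
set t := Re a / m.
have Et : Re a = t * m by rewrite /t; field; lra.
have Es : (Im a / m) ^ 2 = 1 - t ^ 2.
  have -> : Im a / m = Im a * / m by []; rewrite Rpow_mult_distr.
  have -> : Im a ^ 2 = m ^ 2 - Re a ^ 2 by lra.
  rewrite Et; field; lra.
have Ht : -1 <= t <= 1 by have := pow2_ge_0 (Im a / m); nra.
have Hs : sqrt (1 - Rsqr t) = Rabs (Im a / m).
  rewrite -sqrt_Rsqr_abs; congr sqrt; rewrite /Rsqr; lra.
have Hexp : exp (ln m) = m := exp_ln _ M0.
case: (Rle_dec 0 (Im a / m)) => I0.
- exists (ln m, acos t); rewrite /cexp /= Hexp cos_acos // sin_acos // Hs Rabs_pos_eq //.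
  by case: (a) (Et) => p q /= ->; congr pair; [ring | field; lra].
- exists (ln m, - acos t); rewrite /cexp /= Hexp cos_neg sin_neg cos_acos // sin_acos // Hs Rabs_left; last lra.
  by case: (a) (Et) => p q /= ->; congr pair; [ring | field; lra].
Qed.

(** Since r <= |a|, dividing by a maps the disc into |z - 1| < 1, inside the right half-plane where
    [plog] is a branch; adding a logarithm w of a undoes the division. *)
Lemma log_branch (a : C) r : 0 < r -> r <= Cmod a -> exists lg : C -> C,
  forall z, Cmod (z - a)%C < r -> cexp (lg z) = z /\ ccont lg z.
Proof.
move=> r0 ra.
have Ha : a <> 0%C by apply/Cmod_gt_0; lra.
have [w Hw] := log_exists a Ha.
exists (fun z : C => (w + plog (z / a))%C) => z Hz.
have Re0 : 0 < Re (z / a)%C.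
  have H : Cmod (z / a - 1)%C < 1.
    have -> : (z / a - 1 = (z - a) / a)%C by field.
    rewrite Cmod_div //; apply: (Rmult_lt_reg_r (Cmod a)); first lra.
    have -> : Cmod (z - a)%C / Cmod a * Cmod a = Cmod (z - a)%C by field; lra.
    lra.
  have := re_le_Cmod (z / a - 1)%C.
  have -> : Re (z / a - 1)%C = Re (z / a)%C - 1 by case: (z / a)%C => p q /=; ring.
  move=> H1; have := Rabs_def2 _ _ (Rle_lt_trans _ _ _ H1 H); lra.
split; first by rewrite cexp_add Hw cexp_plog //; field.
move=> eps He; have [d [D0 Hd]] := ccont_plog _ Re0 eps He.
exists (d * Cmod a); split; first by apply: Rmult_lt_0_compat; lra.
move=> y Hy.
have -> : (w + plog (y / a) - (w + plog (z / a)) = plog (y / a) - plog (z / a))%C by ring.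
apply: Hd.
have -> : (y / a - z / a = (y - z) / a)%C by field.
rewrite Cmod_div //; apply: (Rmult_lt_reg_r (Cmod a)); first lra.
have -> // : Cmod (y - z)%C / Cmod a * Cmod a = Cmod (y - z)%C by field; lra.
Qed.

(** Any continuous branch has derivative 1/z: with k the increment of the branch, the expansion of
    the exponential reads h = z k + o(k). The bound e <= m/2 yields |k| m <= 2 |h|, and e <= eps m^2
    / 2 then gives the claimed error. *)
Lemma cdiff_log (lg : C -> C) (z : C) r : z <> 0%C -> 0 < r -> ccont lg z ->
  (forall h, Cmod h < r -> cexp (lg (z + h)%C) = (z + h)%C) -> cdiff lg z (/ z)%C.
Proof.
move=> z0 r0 Hc He; apply/cdiffP => eps Heps.
have M0 : 0 < Cmod z by apply/Cmod_gt_0.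
set m := Cmod z in M0.
pose e := Rmin (m / 2) (eps * m * m / 2).
have e0 : 0 < e by apply: Rmin_glb_lt; [lra|]; have H1 := Rmult_lt_0_compat _ _ Heps M0; have := Rmult_lt_0_compat _ _ H1 M0; lra.
have e1 : e <= m / 2 := Rmin_l _ _.
have e2 : e <= eps * m * m / 2 := Rmin_r _ _.
have Ez : cexp (lg z) = z by have := He 0%C; rewrite Cplus_0_r Cmod_0; apply.
have [d [D0 Hd]] := (proj1 (cdiffP _ _ _) (cdiff_cexp (lg z))) e e0.
have [d' [D0' Hd']] := Hc d D0.
exists (Rmin r d'); split; first exact: Rmin_glb_lt.
move=> h Hh.
have Hh1 := Rlt_le_trans _ _ _ Hh (Rmin_l _ _); have Hh2 := Rlt_le_trans _ _ _ Hh (Rmin_r _ _).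
set k := (lg (z + h) - lg z)%C.
have Hk : Cmod k < d by apply: Hd'; have -> : (z + h - z = h)%C by ring.
have := Hd k Hk.
have -> : (lg z + k = lg (z + h))%C by rewrite /k; ring.
rewrite He // Ez.
have -> : (z + h - z - z * k = - (z * (k - / z * h)))%C by field.
rewrite Cmod_opp Cmod_mult -/m => H1.
have k0 := Cmod_ge_0 k; have h0 := Cmod_ge_0 h.
have Hkh : Cmod k * m <= 2 * Cmod h.
  have : Cmod k * m <= m * Cmod (k - / z * h)%C + Cmod h.
    have -> : Cmod k * m = Cmod (z * (k - / z * h) + h)%C.
      have -> : (z * (k - / z * h) + h = k * z)%C by field.
      by rewrite Cmod_mult.
    by apply: Rle_trans (Cmod_triangle _ _) _; rewrite Cmod_mult -/m; lra.
  nra.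
apply: (Rmult_le_reg_l m) => //.
apply: Rle_trans H1 _.
apply: Rle_trans (Rmult_le_compat_r _ _ _ k0 e2) _.
nra.
Qed.

(** * Words in the partial derivatives and the identity for x^beta d^beta *)

Section Words.
Variable n : nat.
Notation X := ('I_n -> C).
Variable U : X -> Prop.
Hypothesis openU : forall x, U x -> exists d, 0 < d /\ forall y, near x y d -> U y.
Notation zero := (fun _ : X => RtoC 0).

(** Words in place of exponents: commuting derivatives becomes permuting letters, and [count_perm]
    checks this by counting them. *)
Definition dword (w : seq 'I_n) (f : X -> C) : X -> C := foldr (fun j g => pderiv j g) f w.

Lemma dword_cat v w f : dword (v ++ w) f = dword v (dword w f).
Proof. exact: foldr_cat. Qed.

Lemma holo_dword w f : holo U f -> holo U (dword w f).
Proof. by move=> Hf; elim: w => //= j w IH; apply: holo_pderiv. Qed.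

Lemma dword_eq_on w f g : eq_on U f g -> eq_on U (dword w f) (dword w g).
Proof. by move=> E; elim: w => //= j w IH; apply: pderiv_eq_on. Qed.

Lemma dword_zero w : eq_on U (dword w zero) zero.
Proof.
elim: w => //= j w IH; apply: (eq_on_trans _ (pderiv_eq_on openU j IH)) => x Ux.
by apply: pderiv_unique; exact: cdiff_const.
Qed.

Lemma dword_move v j w f : holo U f -> eq_on U (dword (v ++ j :: w) f) (dword (j :: v ++ w) f).
Proof.
move=> Hf; elim: v => //= i v IH; apply: (eq_on_trans _ (pderiv_eq_on openU i IH)) => /=.
exact: pderivC (holo_dword _ _ Hf).
Qed.

Lemma dword_perm v w f : holo U f -> perm_eq v w -> eq_on U (dword v f) (dword w f).
Proof.
move=> Hf; elim: v w => [|j v IH] w; first by rewrite perm_sym => /perm_nilP ->.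
move=> H; have jw : j \in w by rewrite -(perm_mem H) mem_head.
case/splitPr: jw H => w1 w2 H.
apply: (eq_on_trans (dword (j :: w1 ++ w2) f)); last by apply: eq_on_sym; apply: dword_move.
apply: (pderiv_eq_on openU); apply: IH.
by rewrite -(perm_cons j); apply: perm_trans H _; rewrite perm_sym -cat1s perm_catCA.
Qed.

Definition word_of (beta : 'I_n -> nat) : seq 'I_n := flatten [seq nseq (beta j) j | j <- enum 'I_n].

Lemma dpowE beta f : dpow beta f = dword (word_of beta) f.
Proof.
rewrite /dpow /word_of; elim: (enum _) => //= j s ->; rewrite dword_cat.
by elim: (beta j) => //= k ->.
Qed.

Lemma count_word_of beta i : count_mem i (word_of beta) = beta i.
Proof.
rewrite /word_of.
have H s : uniq s -> count_mem i (flatten [seq nseq (beta j) j | j <- s]) = if i \in s then beta i else 0%N.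
  elim: s => //= j s IH /andP[js us]; rewrite count_cat count_nseq IH // in_cons.
  case: eqVneq => [->|ij] /=; first by rewrite /= eqxx mul1n (negbTE js) addn0.
  by rewrite eq_sym (negbTE ij) mul0n add0n.
by rewrite H ?enum_uniq // mem_enum.
Qed.

Definition word_pow (k : nat) (w : seq 'I_n) : seq 'I_n := flatten (nseq k w).

Lemma count_word_pow i k w : count_mem i (word_pow k w) = (k * count_mem i w)%N.
Proof. by rewrite /word_pow; elim: k => //= k IH; rewrite count_cat IH mulSn. Qed.

Lemma count_perm (v w : seq 'I_n) : (forall i, count_mem i v = count_mem i w) -> perm_eq v w.
Proof. by move=> H; apply/allP => i _ /=; apply/eqP. Qed.

(** The hypothesis concerns f alone, so each new copy of v has to be moved next to f by commutation
    before it is replaced by w. *)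
Lemma dword_iter f v w : holo U f -> eq_on U (dword v f) (dword w f) -> forall k, eq_on U (dword (word_pow k v) f) (dword (word_pow k w) f).
Proof.
move=> Hf E; elim=> [|k IH] //.
have -> : word_pow k.+1 v = v ++ word_pow k v by [].
rewrite dword_cat; apply: (eq_on_trans _ (dword_eq_on v _ _ IH)); rewrite -dword_cat.
apply: (eq_on_trans (dword (word_pow k w ++ v) f)); first by apply: dword_perm => //; rewrite perm_catC.
rewrite dword_cat; apply: (eq_on_trans _ (dword_eq_on _ _ _ E)); rewrite -dword_cat.
by apply: dword_perm => //; rewrite perm_catC.
Qed.

Lemma dpow_nilpotent f alpha bp bm : holo U f -> eq_on U (dpow bp f) (dpow bm f) ->
  eq_on U (dpow alpha f) zero -> (forall i, (0 < alpha i)%N -> (0 < bp i)%N) ->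
  exists k, eq_on U (dpow (fun i => (k * bm i)%N) f) zero.
Proof.
(* The sum dominates each alpha_i, and bp_i >= 1 wherever alpha_i > 0; so k bp >= alpha. *)
move=> Hf E Ea Hab; exists (\sum_i alpha i)%N.
set k := (\sum_i alpha i)%N.
have le i : (alpha i <= k * bp i)%N.
  case: (posnP (alpha i)) => [->//|ai].
  have H1 : (alpha i <= k)%N by rewrite /k (bigD1 i) //= leq_addr.
  by apply: leq_trans H1 _; rewrite leq_pmulr // Hab.
rewrite dpowE !dpowE in E Ea *.
apply: (eq_on_trans (dword (word_pow k (word_of bm)) f)).
  by apply: dword_perm => //; apply: count_perm => i; rewrite count_word_pow !count_word_of.
apply: (eq_on_trans (dword (word_pow k (word_of bp)) f)).
  by apply: eq_on_sym; apply: dword_iter.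
apply: (eq_on_trans (dword (word_of (fun i => (k * bp i - alpha i)%N) ++ word_of alpha) f)).
  by apply: dword_perm => //; apply: count_perm => i; rewrite count_cat count_word_pow !count_word_of subnK.
rewrite dword_cat; apply: (eq_on_trans _ (dword_eq_on _ _ _ Ea)); exact: dword_zero.
Qed.

Fixpoint coord_pow (j : 'I_n) (k : nat) (x : X) : C := if k is S k then (x j * coord_pow j k x)%C else 1%C.

Lemma holo_coord_pow j k : holo U (coord_pow j k).
Proof. elim: k => [|k IH]; [exact: holo_const | exact: holo_mult (holo_coord _ _ j) IH]. Qed.

(** Multiplying the derivative by x_j avoids the exponent k - 1 and is the form in which theta_j
    meets it. *)
Lemma is_pderiv_coord_pow j k x : exists2 l, is_pderiv (coord_pow j k) j x l & (x j * l = RtoC (INR k) * coord_pow j k x)%C.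
Proof.
elim: k => [|k [l Hl El]]; first by exists 0%C; [exact: cdiff_const | rewrite /= ; ring].
exists (1 * coord_pow j k x + x j * l)%C.
  by have := is_pderiv_mult _ _ _ _ _ _ _ (is_pderiv_coord _ j j x) Hl; rewrite eqxx.
rewrite S_INR RtoC_plus Cmult_plus_distr_l; rewrite El /=; ring.
Qed.

Fixpoint monomial (beta : 'I_n -> nat) (s : seq 'I_n) (x : X) : C :=
  if s is j :: s then (monomial beta s x * coord_pow j (beta j) x)%C else 1%C.

Lemma holo_monomial beta s : holo U (monomial beta s).
Proof. elim: s => [|j s IH]; [exact: holo_const | exact: holo_mult IH (holo_coord_pow _ _)]. Qed.

Lemma coord_pow_shift i j k x h : i != j -> coord_pow i k (shift x j h) = coord_pow i k x.
Proof. by move=> /negbTE ij; elim: k => //= k ->; rewrite /shift ij. Qed.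

Lemma is_pderiv_monomial beta s j x : j \notin s -> is_pderiv (monomial beta s) j x 0%C.
Proof.
move=> js; apply: (cdiff_ext (fun _ => monomial beta s x)); last exact: cdiff_const.
move=> h; elim: s js => //= i s IH; rewrite in_cons negb_or => /andP[ji js].
by rewrite -IH // coord_pow_shift // eq_sym.
Qed.

Notation theta_sub := (theta_sub n).
Notation theta_prod := (theta_prod n).

(** M does not depend on x_j, and theta_j (x_j^k H) = k x_j^k H + x_j^(k+1) d_j H; the factor
    theta_j - k removes the first term and raises the power by one. *)
Lemma theta_prod_power M j k G : holo U M -> (forall x, U x -> is_pderiv M j x 0%C) -> holo U G ->
  eq_on U (theta_prod [seq (j, l) | l <- iota 0 k] (fun x => M x * G x)%C)
    (fun x => M x * coord_pow j k x * dword (nseq k j) G x)%C.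
Proof.
move=> HM DM HG; elim: k => [|k IH].
  by move=> x Ux /=; ring.
rewrite -addn1 iotaD map_cat /theta_prod foldl_cat /= -/(theta_prod _ _) add0n addn1.
apply: (eq_on_trans _ (theta_sub_eq_on _ _ openU (j, k) _ _ IH)) => x Ux.
set H := dword (nseq k j) G.
have HH : holo U H by apply: holo_dword.
rewrite /theta_sub /add_scaled /theta /=.
have [l Hl El] := is_pderiv_coord_pow j k x.
rewrite (pderiv_unique (is_pderiv_mult _ _ _ _ _ _ _ (is_pderiv_mult _ _ _ _ _ _ _ (DM x Ux) Hl) (holo_is_pderiv H j x HH Ux))).
rewrite -/H.
have -> : (x j * ((0 * coord_pow j k x + M x * l) * H x + M x * coord_pow j k x * pderiv j H x) =
  M x * (x j * l) * H x + M x * (x j * coord_pow j k x) * pderiv j H x)%C by ring.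
rewrite El; ring.
Qed.

(* The factors of [x^beta d^beta = prod_j prod_(l < beta j) (theta_j - l)]. *)
Definition factors (beta : 'I_n -> nat) (s : seq 'I_n) : seq ('I_n * nat) :=
  foldr (fun j acc => acc ++ [seq (j, l) | l <- iota 0 (beta j)]) [::] s.

Lemma mem_factors beta s q : q \in factors beta s -> (q.1 \in s) && (q.2 < beta q.1)%N.
Proof.
elim: s => //= j s IH; rewrite mem_cat => /orP[/IH/andP[qs ->]|].
  by rewrite in_cons qs orbT.
by case/mapP => l; rewrite mem_iota add0n => /andP[_ lb] -> /=; rewrite mem_head.
Qed.

Lemma uniq_factors beta s : uniq s -> uniq (factors beta s).
Proof.
elim: s => //= j s IH /andP[js us]; rewrite cat_uniq IH //=.
rewrite map_inj_uniq ?iota_uniq ?andbT; last by move=> a b [].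
apply/hasPn => q /mapP[l _ ->]; apply/negP => /mem_factors /= /andP[jin _].
by rewrite jin in js.
Qed.

Lemma theta_prod_factors beta f : holo U f ->
  eq_on U (theta_prod (factors beta (enum 'I_n)) f) (fun x => monomial beta (enum 'I_n) x * dpow beta f x)%C.
Proof.
move=> Hf; rewrite /dpow.
have H s : uniq s -> holo U (foldr (fun j g => iter (beta j) (pderiv j) g) f s) /\
  eq_on U (theta_prod (factors beta s) f)
  (fun x => monomial beta s x * foldr (fun j g => iter (beta j) (pderiv j) g) f s x)%C;
  last by case: (H _ (enum_uniq 'I_n)).
elim: s => [|j s IH] /=; first by split=> // x Ux; ring.
move=> /andP[js us]; have [HG E] := IH us.
have Eword k g : iter k (pderiv j) g = dword (nseq k j) g by elim: k => //= k ->.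
split; first by rewrite Eword; apply: holo_dword.
rewrite /theta_prod foldl_cat -/(theta_prod _ _) -/(theta_prod _ _).
apply: (eq_on_trans _ (theta_prod_eq_on _ _ openU _ _ _ E)).
apply: (eq_on_trans _ (theta_prod_power _ j (beta j) _ (holo_monomial beta s) _ HG)).
  by move=> x Ux; apply: is_pderiv_monomial.
by move=> x Ux; rewrite Eword.
Qed.

Lemma theta_prod_factors_zero beta f : holo U f -> eq_on U (dpow beta f) zero ->
  eq_on U (theta_prod (factors beta (enum 'I_n)) f) zero.
Proof. move=> Hf E x Ux; rewrite theta_prod_factors // E //; ring. Qed.
End Words.

(** * Joint eigenfunctions are monomials *)

Section Polydisc.
Variable n : nat.
Notation X := ('I_n -> C).
Variables (a : X) (r : 'I_n -> R).
Notation U := (polydisc a r).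

Lemma finite_min (e : 'I_n -> R) : (forall j, 0 < e j) -> exists d, 0 < d /\ forall j, d <= e j.
Proof.
move=> He.
have [d [D0 Hd]] : exists d, 0 < d /\ forall j, j \in enum 'I_n -> d <= e j.
  elim: (enum _) => [|j s [d [D0 Hd]]]; first by exists 1; split=> //; lra.
  exists (Rmin d (e j)); split; first exact: Rmin_glb_lt.
  move=> i; rewrite in_cons => /orP[/eqP ->|/Hd H]; first exact: Rmin_r.
  exact: Rle_trans (Rmin_l _ _) H.
by exists d; split=> // j; apply: Hd; rewrite mem_enum.
Qed.

Lemma polydisc_open x : U x -> exists d, 0 < d /\ forall y, near x y d -> U y.
Proof.
move=> Ux; have [j|d [D0 Hd]] := finite_min (fun j => r j - Cmod (x j - a j)%C).
  by have := Ux j; lra.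
exists d; split=> // y Hy j.
have -> : (y j - a j = (y j - x j) + (x j - a j))%C by ring.
by apply: Rle_lt_trans (Cmod_triangle _ _) _; have := Hy j; have := Hd j; lra.
Qed.

Hypothesis torus : torus_polydisc a r.
Variable lg : 'I_n -> C -> C.
Hypothesis lgP : forall j z, Cmod (z - a j)%C < r j -> cexp (lg j z) = z /\ ccont (lg j) z.

(** Along the k-th coordinate disc, h times exp (- p_k log x_k) has derivative 0, so [complex_mvt]
    with bound 0 makes it constant. *)
Lemma eig_axis h (p : X) k x w : holo U h -> eq_on U (theta n k h) (fun x => p k * h x)%C ->
  U x -> x k = a k -> Cmod w < r k ->
  h (shift x k w) = (h x * cexp (p k * (lg k (a k + w)%C - lg k (a k))))%C.
Proof.
move=> Hh Eh Ux xk wr.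
have [r0 ra] := torus k.
have Us v : Cmod v < r k -> U (shift x k v).
  move=> Hv j; rewrite /shift; case: eqP => [->|_]; last exact: Ux.
  by rewrite xk; have -> : (a k + v - a k = v)%C by ring.
pose g v := (h (shift x k v) * cexp (- (p k * lg k (a k + v))))%C.
have D v : Cmod v < r k -> cdiff g v 0%C.
  move=> Hv; set z := (a k + v)%C.
  have z0 : z <> 0%C.
    move=> E; have : Cmod (a k) <= Cmod v.
      have -> : (a k = z + - v)%C by rewrite /z; ring.
      by rewrite E Cplus_0_l Cmod_opp; lra.
    lra.
  have H1 : cdiff (fun v => h (shift x k v)) v (pderiv k h (shift x k v)).
    by apply/is_pderiv_at_shift; apply: holo_is_pderiv Hh (Us v Hv).
  have H2 : cdiff (fun v => lg k (a k + v)%C) v ((0 + 1) * / z)%C.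
    apply: (cdiff_comp (lg k)); last by apply: cdiff_plus (cdiff_const _ _) (cdiff_id _).
    apply: (cdiff_log _ _ (r k - Cmod v)) => //; first lra.
      by apply: (lgP k _ _).2; rewrite /z; have -> : (a k + v - a k = v)%C by ring.
    move=> u Hu; apply: (lgP k _ _).1; have -> : (z + u - a k = v + u)%C by rewrite /z; ring.
    by apply: Rle_lt_trans (Cmod_triangle _ _) _; lra.
  have H3 := cdiff_mult _ _ _ _ _ H1 (cdiff_comp _ _ _ _ _ (cdiff_cexp_opp _) (cdiff_scal (p k) _ _ _ H2)).
  have E := Eh _ (Us v Hv).
  have Ez : shift x k v k = z by rewrite /shift eqxx xk.
  rewrite /theta Ez in E.
  have Ed : pderiv k h (shift x k v) = (p k * h (shift x k v) / z)%C by rewrite -E; field.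
  rewrite Ed -/z in H3.
  have E0 : (p k * h (shift x k v) / z * cexp (- (p k * lg k z)) +
    h (shift x k v) * (p k * ((0 + 1) * / z) * - cexp (- (p k * lg k z))) = 0)%C by field.
  by rewrite E0 in H3.
have := complex_mvt g (fun _ => 0%C) 0%C 0 (r k) w D.
have -> : (0 - 0 = 0)%C by ring.
rewrite Cmod_0 => /(_ (fun _ _ => Rle_refl _) wr).
rewrite Rmult_0_l => H.
have E : (g w - g 0%C = 0)%C.
  apply: Cmod_eq_0; apply: Rle_antisym; last exact: Cmod_ge_0.
  by move: H; have -> : (g w - g 0 - 0 * w = g w - g 0)%C by ring.
have Eg : g w = g 0%C by transitivity (g w - g 0 + g 0)%C; [ring | rewrite E Cplus_0_l].
rewrite /g shift0 Cplus_0_r in Eg.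
have -> : (p k * (lg k (a k + w) - lg k (a k)) = p k * lg k (a k + w) + - (p k * lg k (a k)))%C by ring.
rewrite cexp_add.
have -> : (h x * (cexp (p k * lg k (a k + w)) * cexp (- (p k * lg k (a k)))) =
  (h x * cexp (- (p k * lg k (a k)))) * cexp (p k * lg k (a k + w)))%C by ring.
rewrite -Eg cexp_opp; field; exact: cexp_neq0.
Qed.

Lemma eig_monomial h p : holo U h -> (forall k, eq_on U (theta n k h) (fun x => p k * h x)%C) ->
  exists kappa, forall x, U x -> h x = (kappa * cexp (Csum (fun j => p j * lg j (x j))))%C.
Proof.
move=> Hh Eh; exists (h a * cexp (- (1) * Csum (fun j => p j * lg j (a j))))%C => x Ux.
(* The path from the centre a to x changes one coordinate at a time, so every step starts at the
   centre of its disc, as [eig_axis] requires. *)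
pose y (s : seq 'I_n) : X := fun j => if j \in s then x j else a j.
have H s : uniq s -> h (y s) = (h a *
   cexp (foldr (fun j acc => (p j * lg j (x j) + - (1) * (p j * lg j (a j))) + acc) 0 s))%C.
  elim: s => [_|k s IH /= /andP[ks us]] /=; first by rewrite cexp_0 Cmult_1_r.
  have Uy : U (y s).
    move=> j; rewrite /y; case: (j \in s) => //.
    have -> : (a j - a j = 0)%C by ring.
    by rewrite Cmod_0; case: (torus j).
  have -> : y (k :: s) = shift (y s) k (x k - a k)%C.
    apply: functional_extensionality => j; rewrite /y /shift in_cons.
    by case: eqP => [->|_] //=; rewrite (negbTE ks); ring.
  rewrite (eig_axis h p) //; last by rewrite /y (negbTE ks).
  rewrite IH // cexp_add.
  have -> : (a k + (x k - a k) = x k)%C by ring.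
  have -> : (p k * (lg k (x k) - lg k (a k)) = p k * lg k (x k) + - (1) * (p k * lg k (a k)))%C by ring.
  ring.
have -> : h x = h (y (enum 'I_n)).
  by congr h; apply: functional_extensionality => j; rewrite /y mem_enum.
rewrite H ?enum_uniq // -Cmult_assoc -cexp_add; congr (_ * cexp _)%C.
rewrite -/(Csum (fun j => p j * lg j (x j) + - (1) * (p j * lg j (a j)))%C).
rewrite (Csum_add_scaled n (fun j => p j * lg j (x j))%C (fun j => p j * lg j (a j))%C); ring.
Qed.

Lemma eigensum_puiseux c Rel P f : eigensum n U c Rel P f -> exists L : seq (C * X),
  forall x, U x -> f x = foldr (fun kp acc => Cplus (Cmult kp.1
     (cexp (Csum (fun j => Cmult (kp.2 j) (lg j (x j)))))) acc) (RtoC 0) L.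
Proof.
elim=> [g E|g g' p h _ [L HL] [[Hh _] Eh] _ E]; first by exists [::].
have [kappa Hk] := eig_monomial h p Hh Eh.
exists ((kappa, p) :: L) => x Ux /=; rewrite E // /add_scaled HL // Hk //; ring.
Qed.
End Polydisc.

Lemma eigensum_puiseux_on n (a : 'I_n -> C) r c Rel P f : torus_polydisc a r ->
  eigensum n (polydisc a r) c Rel P f -> puiseux_on a r f.
Proof.
move=> Ht D.
have ex j : exists lg : C -> C, forall z, Cmod (z - a j)%C < r j -> cexp (lg z) = z /\ ccont lg z.
  by case: (Ht j) => r0 ra; apply: log_branch.
pose lg j := proj1_sig (constructive_indefinite_description _ (ex j)).
have lgP j := proj2_sig (constructive_indefinite_description _ (ex j)); rewrite -/(lg _) in lgP.
have [L HL] := eigensum_puiseux n a r Ht lg lgP c Rel P f D.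
by exists L, lg.
Qed.

(** * Resonant parameters form a null set *)

Definition list_sum {T : Type} (F : T -> R) (s : seq T) : R := foldr (fun x acc => F x + acc) 0 s.

Lemma list_sum_cat T (F : T -> R) s t : list_sum F (s ++ t) = list_sum F s + list_sum F t.
Proof. by elim: s => [|x s IH] /=; rewrite ?IH; ring. Qed.

Lemma list_sum_ge0 T (F : T -> R) s : (forall x, 0 <= F x) -> 0 <= list_sum F s.
Proof. by move=> HF; elim: s => [|x s IH] /=; [lra | have := HF x; lra]. Qed.

Lemma list_sum_le T (F G : T -> R) s : (forall x, F x <= G x) -> list_sum F s <= list_sum G s.
Proof. by move=> H; elim: s => [|x s IH] /=; [lra | have := H x; lra]. Qed.

Lemma list_sum_add T (F G : T -> R) s : list_sum (fun x => F x + G x) s = list_sum F s + list_sum G s.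
Proof. by elim: s => [|x s IH] /=; rewrite ?IH; ring. Qed.

Lemma list_sum_scal T (F : T -> R) k s : list_sum (fun x => k * F x) s = k * list_sum F s.
Proof. by elim: s => [|x s IH] /=; rewrite ?IH; ring. Qed.

Lemma list_sum_map T S (F : T -> R) (h : S -> T) s : list_sum F (map h s) = list_sum (fun x => F (h x)) s.
Proof. by elim: s => //= x s ->. Qed.

Lemma list_sum_const T v (s : seq T) : list_sum (fun _ => v) s = INR (size s) * v.
Proof. by elim: s => [|x s IH]; [rewrite /=; ring | rewrite [size _]/= S_INR /= IH; ring]. Qed.

Lemma list_sum_abs T (F : T -> R) s : Rabs (list_sum F s) <= list_sum (fun x => Rabs (F x)) s.
Proof.
elim: s => [|x s IH] /=; first by rewrite Rabs_R0; lra.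
apply: Rle_trans (Rabs_triang _ _) _; lra.
Qed.

Lemma list_sum_rem (T : eqType) (F : T -> R) x s : x \in s -> list_sum F s = F x + list_sum F (rem x s).
Proof.
elim: s => //= y s IH; rewrite in_cons eq_sym; case: eqP => [->//|_ /= xs].
by rewrite IH //=; ring.
Qed.

Lemma list_sum_subset (T : eqType) (F : T -> R) s t : (forall x, 0 <= F x) -> uniq s -> {subset s <= t} ->
  list_sum F s <= list_sum F t.
Proof.
move=> HF; elim: s t => [|x s IH] t /=; first by move=> _ _; apply: list_sum_ge0.
move=> /andP[xs us] sub; rewrite (list_sum_rem _ F x t); last by apply: sub; rewrite mem_head.
apply: Rplus_le_compat_l; apply: IH => // y ys.
have yt : y \in t by apply: sub; rewrite in_cons ys orbT.
have yx : y != x by apply: contraNneq xs => <-.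
have := perm_mem (perm_to_rem (sub x (mem_head _ _))) y.
by rewrite yt in_cons (negbTE yx) /= => <-.
Qed.

Lemma sum_f_R0_list_sum (F : nat -> R) N : sum_f_R0 F N = list_sum F (iota 0 N.+1).
Proof.
elim: N => [|N IH]; first by rewrite /=; ring.
by rewrite tech5 IH -(addn1 N.+1) iotaD list_sum_cat add0n /=; ring.
Qed.

Lemma list_sum_half eps K : 0 < eps -> list_sum (fun k => eps / 2 ^ (k + 2)%coq_nat) (iota 0 K) <= eps / 2.
Proof.
move=> He.
have -> : list_sum (fun k => eps / 2 ^ (k + 2)%coq_nat) (iota 0 K) = eps / 2 - eps / 2 ^ (K + 1)%coq_nat.
  elim: K => [|K IH]; first by rewrite /=; field.
  rewrite -[in iota _ _](addn1 K) iotaD list_sum_cat IH add0n /=.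
  have P : 2 ^ K <> 0 by apply: pow_nonzero; lra.
  rewrite !pow_add /=; field => //.
have := pow_lt 2 (K + 1)%coq_nat ltac:(lra) => P.
have : 0 < eps / 2 ^ (K + 1)%coq_nat by apply: Rdiv_lt_0_compat.
lra.
Qed.

Lemma list_sum_nth T (x0 : T) (F : T -> R) L K : (forall x, 0 <= F x) ->
  list_sum (fun l => if (l < size L)%N then F (nth x0 L l) else 0) (iota 0 K) <= list_sum F L.
Proof.
move=> HF; elim: L K => [|x L IH] K /=.
  by rewrite list_sum_const; lra.
case: K => [|K]; first by have := list_sum_ge0 _ F L HF; have := HF x; rewrite /=; lra.
rewrite [iota _ _]/= -[1%N]addn0 iotaDl /= list_sum_map.
by apply: Rplus_le_compat_l; exact: (IH K).
Qed.

Section Null.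
Variable n : nat.
Hypothesis n0 : (0 < n)%N.
Notation X := ('I_n -> C).

Definition in_cube (z : X) (s : R) (x : X) : Prop := forall j,
  Rabs (Re (Cminus (x j) (z j))) < s /\ Rabs (Im (Cminus (x j) (z j))) < s.

Definition vol (s : R) : R := (2 * s) ^ (2 * n)%N.

(** Finite covers suffice for bounded pieces of hyperplanes; [null_union] merges countably many of
    them into the one sequence of cubes that [null_set] asks for. The universally quantified default
    d has no effect, as i is in range. *)
Definition small_cover (S : X -> Prop) : Prop := forall eps, 0 < eps -> exists L : seq (X * posreal),
  (forall x, S x -> exists i, (i < size L)%N /\ forall d, in_cube (nth d L i).1 (nth d L i).2 x) /\
  list_sum (fun e => vol (pos e.2)) L < eps.

Lemma vol_ge0 s : 0 <= s -> 0 <= vol s.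
Proof. by move=> s0; apply: pow_le; lra. Qed.

Lemma vol_small eps : 0 < eps -> exists s, 0 < s /\ vol s <= eps.
Proof.
move=> He; pose u := Rmin 1 eps.
have u0 : 0 < u by apply: Rmin_glb_lt; lra.
have u1 : u <= 1 := Rmin_l _ _.
exists (u / 2); split; first lra.
rewrite /vol; have -> : 2 * (u / 2) = u by field.
case: n n0 => // m _; rewrite mulnS /=.
apply: Rle_trans (Rmin_r 1 eps); rewrite -/u.
have P : 0 <= u ^ (2 * m)%N <= 1.
  split; first by apply: pow_le; lra.
  by rewrite -(pow1 (2 * m)%N); apply: pow_incr; lra.
set q := u ^ _ in P *.
have Q : 0 <= u * q <= 1 by nra.
by rewrite -[X in _ <= X](Rmult_1_r u); apply: Rmult_le_compat_l; lra.
Qed.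

(** Cantor's pairing lists the cubes (k, i) of all covers. Where the k-th cover has no i-th cube, a
    filler of radius t m takes the place, since all radii must be positive. Covers and fillers each
    cost at most eps/4. *)
Lemma null_union (S : nat -> X -> Prop) : (forall k, small_cover (S k)) ->
  null_set (fun x => exists k, S k x).
Proof.
move=> HS eps He.
have ek k : 0 < (eps / 2) / 2 ^ (k + 2)%coq_nat.
  by apply: Rdiv_lt_0_compat; [lra | apply: pow_lt; lra].
pose Lx k := constructive_indefinite_description _ (HS k _ (ek k)).
pose L k := proj1_sig (Lx k).
have LP k : (forall x, S k x -> exists i, (i < size (L k))%N /\
    forall d, in_cube (nth d (L k) i).1 (nth d (L k) i).2 x) /\
    list_sum (fun e => vol (pos e.2)) (L k) < (eps / 2) / 2 ^ (k + 2)%coq_nat := proj2_sig (Lx k).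
pose tx k := constructive_indefinite_description _ (vol_small _ (ek k)).
pose t k := proj1_sig (tx k).
have tP k : 0 < t k /\ vol (t k) <= (eps / 2) / 2 ^ (k + 2)%coq_nat := proj2_sig (tx k).
pose dflt : X * posreal := ((fun _ => RtoC 0), mkposreal 1 Rlt_0_1).
pose el m := nth dflt (L (of_nat m).1) (of_nat m).2.
pose isin m := ((of_nat m).2 < size (L (of_nat m).1))%N.
exists (fun m => (el m).1), (fun m => if isin m then pos (el m).2 else t m); split; last split.
- by move=> m; case: (isin m); [exact: cond_pos | case: (tP m)].
- move=> x [k Sx]; have [i [iL Hi]] := (LP k).1 x Sx.
  exists (to_nat (k, i)) => j.
  rewrite /el /isin cancel_of_to /= iL; exact: Hi.
- move=> N; rewrite sum_f_R0_list_sum.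
  pose b (p : nat * nat) := if (p.2 < size (L p.1))%N then vol (pos (nth dflt (L p.1) p.2).2) else 0.
  have b0 p : 0 <= b p.
    rewrite /b; case: ifP => _; last lra.
    by apply: vol_ge0; apply: Rlt_le; apply: cond_pos.
  apply: (Rle_lt_trans _ (list_sum (fun m => b (of_nat m) + (eps / 2) / 2 ^ (m + 2)%coq_nat) (iota 0 N.+1))).
    apply: list_sum_le => m.
    change (vol (if isin m then pos (el m).2 else t m) <= b (of_nat m) + (eps / 2) / 2 ^ (m + 2)%coq_nat).
    have := b0 (of_nat m); have := ek m; have := tP m.
    by rewrite /b -/(isin m) -/(el m); case: (isin m) => /=; lra.
  rewrite list_sum_add.
  have H1 := list_sum_half (eps / 2) N.+1 ltac:(lra).
  pose s := [seq of_nat m | m <- iota 0 N.+1].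
  (* Finitely many pairs fit into a square, over which the volumes can be summed cover by cover. *)
  have [K HK] : exists K, forall p, p \in s -> (p.1 < K)%N && (p.2 < K)%N.
    elim: (s) => [|p s' [K HK]]; first by exists O.
    exists (maxn K (maxn p.1.+1 p.2.+1)) => q; rewrite in_cons => /orP[/eqP ->|/HK/andP[h1 h2]].
      by rewrite !leq_max !leqnn !orbT.
    by rewrite !leq_max h1 h2.
  have us : uniq s.
    rewrite map_inj_uniq ?iota_uniq // => p q E.
    by rewrite -(cancel_to_of p) -(cancel_to_of q) E.
  have H2 : list_sum b s <= eps / 2 / 2.
    pose tt := flatten [seq [seq (k, l) | l <- iota 0 K] | k <- iota 0 K].
    apply: Rle_trans (list_sum_subset _ b s tt b0 us _) _.
      move=> [p q] /HK /= /andP[pK qK]; apply/flattenP; exists [seq (p, l) | l <- iota 0 K].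
        by apply/mapP; exists p => //; rewrite mem_iota.
      by apply/mapP; exists q => //; rewrite mem_iota.
    apply: Rle_trans (list_sum_half (eps / 2) K ltac:(lra)).
    rewrite /tt {HK}; move: {2 3}(iota 0 K) => ks; elim: ks => [|k ks IH] /=; first lra.
    rewrite list_sum_cat; apply: Rplus_le_compat; last exact: IH.
    rewrite list_sum_map; apply: Rlt_le; apply: Rle_lt_trans (LP k).2.
    rewrite /b /=; apply: (list_sum_nth _ dflt (fun e => vol (pos e.2))) => e; apply: vol_ge0; apply: Rlt_le; apply: cond_pos.
  have -> : list_sum (fun m => b (of_nat m)) (iota 0 N.+1) = list_sum b s by rewrite /s list_sum_map.
  lra.
Qed.

Lemma grid_cell u N : (0 < N)%N -> 0 <= u <= INR N -> exists i : 'I_N, INR i <= u <= INR i + 1.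
Proof.
elim: N => // N IH _ Hu.
case: (Rle_dec u (INR N)) => uN; last first.
  by exists ord_max; rewrite S_INR in Hu; rewrite /=; lra.
case: N IH Hu uN => [|N] IH Hu uN.
  by exists ord0; rewrite /= in uN Hu *; lra.
have [i Hi] := IH isT (conj Hu.1 uN).
by exists (widen_ord (leqnSn _) i).
Qed.

Lemma list_sum_pull (T : eqType) (F : T -> R) x s : uniq s -> x \in s ->
  list_sum F s = F x + list_sum (fun y => if y == x then 0 else F y) s.
Proof.
elim: s => //= y s IH /andP[ys us]; rewrite in_cons; case: eqVneq => [E _|xy /= xs].
  rewrite Rplus_0_l -E; congr Rplus; rewrite -E in ys.
  by elim: s ys {IH us} => //= z s IH; rewrite in_cons negb_or => /andP[xz xs]; rewrite (eq_sym z) (negbTE xz) IH.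
by rewrite IH //; ring.
Qed.

(* Cutting the remaining [2n - 1] real coordinates into [N] pieces each gives [N ^ (2n - 1)] cubes of
   side [O(1/N)], of total volume [O(1/N)]. *)
Lemma hyperplane_cover (w : 'I_n -> R) k0 K : 1 <= Rabs (w k0) -> 0 < K ->
  small_cover (fun x => (forall j, Rabs (Re (x j)) <= K /\ Rabs (Im (x j)) <= K) /\
     list_sum (fun j => w j * Im (x j)) (enum 'I_n) = 0).
Proof.
move=> wk K0 eps He.
pose I := ('I_n * bool)%type.
(* The coordinate solved for inherits an error of at most the sum of the |w_j| times the grid error;
   the added 1 makes the same bound valid for the grid coordinates themselves. *)
pose Wt := 1 + list_sum (fun j => Rabs (w j)) (enum 'I_n).
have W1 : 1 <= Wt by rewrite /Wt; have := list_sum_ge0 _ (fun j => Rabs (w j)) (enum 'I_n) (fun j => Rabs_pos _); lra.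
pose V := (4 * Wt * K) ^ (2 * n)%N.
have V0 : 0 < V by apply: pow_lt; nra.
have [N [N0 HN]] : exists N, (0 < N)%N /\ V < eps * INR N.
  have [N [H1 H2]] := archimed_cor1 (eps / V) ltac:(apply: Rdiv_lt_0_compat; lra).
  exists N; split; first exact/ltP.
  have NR : 0 < INR N by apply: lt_0_INR.
  apply: (Rmult_lt_reg_r (/ INR N * / V)).
    by apply: Rmult_lt_0_compat; apply: Rinv_0_lt_compat.
  have -> : V * (/ INR N * / V) = / INR N by field; lra.
  by have -> : eps * INR N * (/ INR N * / V) = eps / V by field; lra.
have NR : 0 < INR N by apply: lt_0_INR; apply/ltP.
(* Real coordinates are pairs (j, false) for real and (j, true) for imaginary parts; T omits the
   imaginary part at k0, which the equation determines. [coord] lists the midpoints of N equal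
   pieces of [-K, K]. *)
pose T := {x : I | x != (k0, true)}.
pose coord (i : 'I_N) := - K + (2 * INR i + 1) * (K / INR N).
pose G (phi : {ffun T -> 'I_N}) (x : I) := if insub x is Some t then coord (phi t) else 0.
pose ctr phi : X := fun j => (G phi (j, false),
  if j == k0 then - list_sum (fun j => w j * G phi (j, true)) (enum 'I_n) / w k0 else G phi (j, true)).
(* The factor 2 makes the inequalities strict. The N^(2n-1) cubes then have volume V / N^(2n) each,
   V / N in total. *)
have s0 : 0 < 2 * Wt * K / INR N by apply: Rdiv_lt_0_compat; nra.
exists [seq (ctr phi, mkposreal _ s0) | phi <- enum {ffun T -> 'I_N}]; split; last first.
  rewrite list_sum_map /= list_sum_const -cardE card_ffun /= card_ord.
  have -> : #|{: T}| = (2 * n).-1.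
    by rewrite card_sig (eq_card (B := predC1 (k0, true))) // cardC1 card_prod card_bool card_ord mulnC.
  rewrite /vol.
  have -> : 2 * (2 * Wt * K / INR N) = 4 * Wt * K * / INR N by field; lra.
  rewrite Rpow_mult_distr -/V.
  have -> : INR (N ^ (2 * n).-1) = INR N ^ (2 * n).-1.
    by elim: (2 * n).-1%N => [|m IH] //; rewrite expnS mult_INR IH.
  have -> : (/ INR N) ^ (2 * n)%N = / INR N * (/ INR N) ^ (2 * n).-1.
    by rewrite -{1}(prednK (n := (2 * n)%N)) // muln_gt0.
  rewrite -Rinv_pow; last lra.
  have P : INR N ^ (2 * n).-1 <> 0 by apply: pow_nonzero; lra.
  apply: (Rmult_lt_reg_r (INR N)) => //.
  have -> // : INR N ^ (2 * n).-1 * (V * (/ INR N * / INR N ^ (2 * n).-1)) * INR N = V by field; split=> //; lra.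
move=> x [Hx Sx].
pose v (y : I) := if y.2 then Im (x y.1) else Re (x y.1).
have Hv y : Rabs (v y) <= K by case: y => j [] /=; rewrite /v /=; case: (Hx j).
have ex y : exists i : 'I_N, Rabs (v y - coord i) <= K / INR N.
  have [||i Hi] := grid_cell ((v y + K) * INR N / (2 * K)) N => //.
    have := Hv y => /Rabs_le_between H.
    have iK : 0 < / (2 * K) by apply: Rinv_0_lt_compat; lra.
    split; first by apply: Rmult_le_pos; [apply: Rmult_le_pos; lra | lra].
    have -> : INR N = (2 * K) * INR N / (2 * K) by field; lra.
    apply: Rmult_le_compat_r; first lra.
    have -> : (2 * K * INR N / (2 * K)) = INR N by field; lra.
    by apply: Rmult_le_compat_r; lra.
  exists i.
  have KN : 0 < K / INR N by apply: Rdiv_lt_0_compat.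
  have -> : v y - coord i = ((v y + K) * INR N / (2 * K) - INR i - / 2) * (2 * (K / INR N)).
    by rewrite /coord; field; lra.
  rewrite Rabs_mult (Rabs_pos_eq (2 * _)); last lra.
  have : Rabs ((v y + K) * INR N / (2 * K) - INR i - / 2) <= / 2 by apply: Rabs_le; lra.
  nra.
pose ch y := proj1_sig (constructive_indefinite_description _ (ex y)).
have chP y : Rabs (v y - coord (ch y)) <= K / INR N :=
  proj2_sig (constructive_indefinite_description _ (ex y)).
pose phi : {ffun T -> 'I_N} := [ffun t => ch (val t)].
have HG y : y != (k0, true) -> Rabs (v y - G phi y) <= K / INR N.
  by move=> yk; rewrite /G insubT /phi ffunE SubK; apply: chP.
have G0 : G phi (k0, true) = 0 by rewrite /G insubF // eqxx.
have KN : 0 < K / INR N by apply: Rdiv_lt_0_compat.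
have lt_s u : u <= Wt * (K / INR N) -> u < 2 * Wt * K / INR N.
  have -> : 2 * Wt * K / INR N = 2 * (Wt * (K / INR N)) by field; lra.
  have : 0 < Wt * (K / INR N) by nra.
  lra.
have le1 u : u <= K / INR N -> u <= Wt * (K / INR N) by nra.
exists (index phi (enum {ffun T -> 'I_N})); split.
  by rewrite size_map index_mem mem_enum.
move=> d; rewrite (nth_map phi) ?index_mem ?mem_enum // nth_index ?mem_enum //=.
move=> j; split.
  apply: lt_s; apply: le1; have := HG (j, false) ltac:(by rewrite xpair_eqE andbF); rewrite /v /=.
  by congr (Rabs _ <= _); case: (x j) => p q /=; ring.
rewrite /ctr /=; case: eqVneq => [->|jk]; last first.
  apply: lt_s; apply: le1; have := HG (j, true); rewrite xpair_eqE (negbTE jk) => /(_ isT); rewrite /v /=.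
  by congr (Rabs _ <= _); case: (x j) => p q /=; ring.
have wk0 : w k0 <> 0 by move=> E; rewrite E Rabs_R0 in wk; lra.
apply: lt_s.
rewrite (list_sum_pull _ _ k0 _ (enum_uniq _)) ?mem_enum // in Sx.
(* D is the total grid error in the equation. The value 0 of [G] at (k0, true) keeps the term k0 out
   of it, and |w k0| >= 1 lets D / w k0 be bounded by |D|. *)
set D := list_sum (fun j => w j * ((if j == k0 then 0 else Im (x j)) - G phi (j, true))) (enum 'I_n).
have ED : D = - w k0 * Im (x k0) - list_sum (fun j => w j * G phi (j, true)) (enum 'I_n).
  have -> : - w k0 * Im (x k0) = list_sum (T := 'I_n) (fun y : 'I_n => if y == k0 then 0 else w y * Im (x y)) (enum 'I_n).
    apply: (Rplus_eq_reg_l (w k0 * Im (x k0))); transitivity 0; [ring | exact: esym Sx].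
  rewrite /D; elim: (enum 'I_n) => [|i s IH] /=; first ring.
  rewrite IH; case: (i == k0); ring.
have -> : (x k0).2 + - (- list_sum (fun j => w j * G phi (j, true)) (enum 'I_n) / w k0) = - D / w k0.
  by rewrite ED /Im; field.
have HD : Rabs D <= list_sum (fun j => Rabs (w j)) (enum 'I_n) * (K / INR N).
  apply: Rle_trans (list_sum_abs _ _ _) _; rewrite Rmult_comm -list_sum_scal; apply: list_sum_le => i.
  rewrite Rabs_mult Rmult_comm; apply: Rmult_le_compat_r; first exact: Rabs_pos.
  case: eqVneq => [->|ik]; first by rewrite G0 Rminus_0_r Rabs_R0; lra.
  by apply: (HG (i, true)); rewrite xpair_eqE (negbTE ik).
rewrite Rabs_div // Rabs_Ropp.
apply: (Rmult_le_reg_r (Rabs (w k0))); first lra.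
have -> : Rabs D / Rabs (w k0) * Rabs (w k0) = Rabs D by field; lra.
apply: Rle_trans HD _.
have : list_sum (fun j => Rabs (w j)) (enum 'I_n) * (K / INR N) <= Wt * (K / INR N).
  by apply: Rmult_le_compat_r; [lra | rewrite /Wt; lra].
have : 0 < Wt * (K / INR N) by nra.
nra.
Qed.

Lemma intR_ge1 z : z <> 0%R -> 1 <= Rabs (intR z).
Proof.
have P m : 0 <= INR m by exact: pos_INR.
case: z => [[|m]|m] //; rewrite /intR S_INR => _; have := P m => Pm.
- by rewrite Rabs_pos_eq; lra.
- by rewrite Rabs_Ropp Rabs_pos_eq; lra.
Qed.

Lemma Im_Csum (w : 'I_n -> int) (x : X) :
  Im (Csum (fun j => intC (w j) * x j)%C) = list_sum (fun j => intR (w j) * Im (x j)) (enum 'I_n).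
Proof.
have E z (u v : C) : Im (intC z * u + v)%C = intR z * Im u + Im v.
  by case: u v => [p q] [p' q'] /=; ring.
rewrite /Csum; elim: (enum _) => [//|j s IH].
by rewrite [foldr _ _ _]/= E IH.
Qed.

(** Taking all nonzero integer vectors w makes the exceptional set independent of B, and it is still
    covered by countably many hyperplanes. *)
Definition resonant (c : X) : Prop := exists w : 'I_n -> int, (exists j, w j <> 0%R) /\
  exists m : int, Csum (fun j => intC (w j) * c j)%C = intC m.

(* [m] being real, the imaginary part of the relation is a real linear equation. *)
Lemma null_resonant : null_set resonant.
Proof.
(* The natural number q codes a vector w, as a finite function so that it can be pickled, and a
   bound K that makes the piece bounded; invalid codes give the empty set. *)
pose S q (x : X) := if (unpickle q : option ({ffun 'I_n -> int} * nat)) is Some (w, K) then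
  (exists j, w j <> 0%R) /\ (forall j, Rabs (Re (x j)) <= INR K + 1 /\ Rabs (Im (x j)) <= INR K + 1) /\
    list_sum (fun j => intR (w j) * Im (x j)) (enum 'I_n) = 0 else False.
have H : null_set (fun x => exists q, S q x).
  apply: null_union => q; rewrite /S.
  have empty : small_cover (fun _ => False).
    by move=> eps He; exists [::]; split=> //=.
  case: (unpickle q) => [[w K]|//].
  case: (classic (exists j, w j <> 0%R)) => [[k Hk]|N]; last first.
    by move=> eps He; have [L [_ HL]] := empty eps He; exists L; split=> // x [].
  have P := pos_INR K.
  move=> eps He; have [L [H1 H2]] := hyperplane_cover (fun j => intR (w j)) k (INR K + 1) (intR_ge1 _ Hk) ltac:(lra) eps He.
  by exists L; split=> // x [_ Sx]; apply: H1.
move=> eps He; have [z [s [h1 [h2 h3]]]] := H eps He.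
exists z, s; split=> //; split=> // x [w [[j wj] [m Em]]]; apply: h2.
have [K HK] : exists K, forall j, Rabs (Re (x j)) <= INR K + 1 /\ Rabs (Im (x j)) <= INR K + 1.
  have [K HK] : exists K, forall j, j \in enum 'I_n -> Cmod (x j) <= INR K.
    elim: (enum _) => [|i s' [K HK]]; first by exists O.
    have [K' HK'] := INR_archimed 1 (Cmod (x i)) Rlt_0_1.
    exists (K + K')%coq_nat => l; rewrite in_cons plus_INR.
    have := pos_INR K; have := pos_INR K' => q1 q2.
    by case/orP => [/eqP ->|/HK]; lra.
  exists K => i; have := HK i; rewrite mem_enum => /(_ isT) Hi.
  have M := Rmax_Cmod (x i).
  split; [have := Rmax_l (Rabs (x i).1) (Rabs (x i).2) | have := Rmax_r (Rabs (x i).1) (Rabs (x i).2)];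
    rewrite /Re /Im; lra.
exists (pickle ([ffun j => w j] : {ffun 'I_n -> int}, K)); rewrite /S pickleK.
split; first by exists j; rewrite ffunE.
split=> //.
have <- : Im (Csum (fun j => intC (w j) * x j)%C) = 0 by rewrite Em.
rewrite Im_Csum; elim: (enum _) => //= i t ->; by rewrite ffunE.
Qed.
End Null.

(** * Integer relations *)

Section IntC.
Import GRing.Theory.

Lemma intR_sub m k : intR (m%:Z - k%:Z)%R = INR m - INR k.
Proof.
have H p q : (q <= p)%N -> intR (p%:Z - q%:Z)%R = INR p - INR q.
  by move=> qp; rewrite subzn //= minus_INR //; apply/leP.
case: (leqP k m) => [/H //|/ltnW/H E].
have neg z : intR (- z)%R = - intR z.
  by case: z => [[|z]|z]; rewrite /= ?Ropp_0 ?Ropp_involutive.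
rewrite -[(m%:Z - k%:Z)%R]opprK opprB neg E; ring.
Qed.

(** Differences of naturals reduce the additivity and multiplicativity of [intR], which is defined
    by cases, to those of [INR]. *)
Lemma int_sub (z : int) : exists m k, z = (m%:Z - k%:Z)%R.
Proof.
case: z => m; first by exists m, O; rewrite subr0.
by exists O, m.+1; rewrite sub0r.
Qed.

Lemma intR_add x y : intR (x + y)%R = intR x + intR y.
Proof.
have [m [k ->]] := int_sub x; have [m' [k' ->]] := int_sub y.
have -> : (m%:Z - k%:Z + (m'%:Z - k'%:Z))%R = ((m + m')%N%:Z - (k + k')%N%:Z)%R.
  by rewrite !PoszD opprD addrACA.
rewrite !intR_sub -!plusE !plus_INR; ring.
Qed.

Lemma intR_mul x y : intR (x * y)%R = intR x * intR y.
Proof.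
have [m [k ->]] := int_sub x; have [m' [k' ->]] := int_sub y.
have -> : ((m%:Z - k%:Z) * (m'%:Z - k'%:Z))%R =
    ((m * m' + k * k')%N%:Z - (m * k' + k * m')%N%:Z)%R.
  lia.
rewrite !intR_sub -!plusE -!multE !plus_INR !mult_INR; ring.
Qed.

Lemma intC_add x y : intC (x + y)%R = (intC x + intC y)%C.
Proof. by rewrite /intC intR_add RtoC_plus. Qed.

Lemma intC_mul x y : intC (x * y)%R = (intC x * intC y)%C.
Proof. by rewrite /intC intR_mul RtoC_mult. Qed.

Lemma intC_opp x : intC (- x)%R = (- intC x)%C.
Proof.
have H : (intC (- x)%R + intC x = 0)%C by rewrite -intC_add addNr.
by rewrite -(Cplus_0_l (- intC x)%C) -H; ring.
Qed.

Lemma intC_nat m : intC m%:Z = RtoC (INR m). Proof. by []. Qed.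

Lemma intC_neq0 x : x <> 0%R -> intC x <> 0%C.
Proof. by move=> /intR_ge1 H /RtoC_inj E; rewrite E Rabs_R0 in H; lra. Qed.

Lemma intC_sum n (F : 'I_n -> int) : intC (\sum_i F i)%R = Csum (fun i => intC (F i)).
Proof.
rewrite -big_enum /Csum; elim: (enum _) => [|i s IH]; first by rewrite big_nil.
by rewrite big_cons intC_add IH.
Qed.

Lemma Csum_zero n : Csum (fun _ : 'I_n => 0%C) = 0%C.
Proof. by rewrite /Csum; elim: (enum _) => //= j s ->; ring. Qed.

Lemma Csum_scal n k (F : 'I_n -> C) : Csum (fun j => k * F j)%C = (k * Csum F)%C.
Proof.
have := Csum_add_scaled n (fun _ => 0%C) F k; rewrite Csum_zero Cplus_0_l => <-.
by apply: Csum_ext => j; ring.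
Qed.

Lemma Csum_plus n (F G : 'I_n -> C) : Csum (fun j => F j + G j)%C = (Csum F + Csum G)%C.
Proof.
have := Csum_add_scaled n F G 1; rewrite Cmult_1_l => <-; apply: Csum_ext => j; ring.
Qed.

Lemma Csum_exchange m n (F : 'I_m -> 'I_n -> C) :
  Csum (fun i => Csum (fun j => F i j)) = Csum (fun j => Csum (fun i => F i j)).
Proof.
rewrite {1}/Csum; have -> : (fun j => Csum (fun i => F i j)) =
  (fun j => foldr (fun i acc => F i j + acc)%C 0%C (enum 'I_m)) by [].
elim: (enum 'I_m) => [|i s IH] /=; first by rewrite Csum_zero.
by rewrite IH Csum_plus.
Qed.

Lemma Csum_delta n (i : 'I_n) (x : int) (F : 'I_n -> C) :
  Csum (fun l => intC (x * (l == i)%:Z)%R * F l)%C = (intC x * F i)%C.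
Proof.
rewrite /Csum.
have H s : uniq s -> foldr (fun l acc => intC (x * (l == i)%:Z)%R * F l + acc)%C 0%C s =
    if i \in s then (intC x * F i)%C else 0%C.
  elim: s => //= j s IH /andP[js us]; rewrite IH // in_cons.
  case: (eqVneq j i) js => [->|ji] js; rewrite ?eqxx ?mulr1 ?mulr0 ?(negbTE js) /=; first ring.
  have -> : intC 0 = 0%C by [].
  by rewrite Cmult_0_l Cplus_0_l.
by rewrite H ?enum_uniq // mem_enum.
Qed.
End IntC.

Section Lattice.
Import GRing.Theory.
Local Open Scope ring_scope.

Lemma clear_denominators k (D : 'I_k -> rat) : exists N : int, exists y : 'I_k -> int,
  N != 0 /\ forall i, N%:~R * D i = (y i)%:~R.
Proof.
exists (\prod_i denq (D i)), (fun i => numq (D i) * \prod_(j | j != i) denq (D j)); split.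
  by rewrite prodf_seq_neq0; apply/allP => i _; rewrite denq_neq0.
move=> i; rewrite (bigD1 i) //= !rmorphM /= -{2}(divq_num_den (D i)).
by rewrite mulrAC [(denq _)%:~R * _]mulrC divfK // intr_eq0 denq_neq0.
Qed.

(** Over the rationals the row space of A lies in the left kernel of B, and both have dimension n -
    2, so they coincide; N clears the denominators. *)
Lemma relation_row_span n (A : 'M[int]_(n - 2, n)) (B : 'M[int]_(n, 2)) (w : 'I_n -> int) :
  qrank B = 2%N -> qrank A = (n - 2)%N -> A *m B = 0 ->
  (forall col, \sum_l w l * B l col = 0) ->
  exists N : int, exists y : 'I_(n - 2) -> int, N != 0 /\
    forall j, N * w j = \sum_k y k * A k j.
Proof.
move=> rB rA AB wB.
pose q (z : int) : rat := z%:~R.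
pose Aq := map_mx q A; pose Bq := map_mx q B.
pose wq : 'rV[rat]_n := \row_j q (w j).
have AB0 : Aq *m Bq = 0.
  by rewrite -(map_mxM (intr : {rmorphism int -> rat})) AB (map_mx0 (intr : {rmorphism int -> rat})).
have wB0 : wq *m Bq = 0.
  apply/rowP => col; rewrite !mxE.
  under eq_bigr => l _ do rewrite !mxE -rmorphM.
  by rewrite -rmorph_sum wB.
have sAK : (Aq <= kermx Bq)%MS by apply/sub_kermxP.
have swK : (wq <= kermx Bq)%MS by apply/sub_kermxP.
have eqr : \rank Aq = \rank (kermx Bq) by rewrite mxrank_ker -[\rank Aq]/(qrank A) -[\rank Bq]/(qrank B) rA rB.
have sKA : (kermx Bq <= Aq)%MS by rewrite -(geq_leqif (mxrank_leqif_sup sAK)) eqr.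
have /submxP[D ED] := submx_trans swK sKA.
have [N [y [N0 Ny]]] := clear_denominators _ (fun k => D 0 k).
exists N, y; split=> // j; apply: (intr_inj (R := rat)).
have := congr1 (fun M : 'rV_n => M 0 j) ED; rewrite !mxE => Ej.
rewrite rmorphM /= -/(q (w j)) Ej mulr_sumr rmorph_sum; apply: eq_bigr => k _.
by rewrite mulrA Ny mxE rmorphM.
Qed.

Lemma ord2_ind (P : 'I_2 -> Prop) : P 0 -> P 1 -> forall col, P col.
Proof.
move=> P0 P1; case=> [[|[|//]] Hm]; first by have -> : Ordinal Hm = 0 by apply: val_inj.
by have -> : Ordinal Hm = 1 by apply: val_inj.
Qed.

(** Three vectors in a plane are dependent, with the 2 x 2 minors as coefficients. *)
Lemma three_relation n (B : 'M[int]_(n, 2)) (i j k : 'I_n) : exists x y z : int,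
  [\/ x <> 0, y <> 0 | z <> 0] /\
  forall col, x * B i col + y * B j col + z * B k col = 0.
Proof.
pose d l m := B l 0 * B m 1 - B l 1 * B m 0.
have cyc col : d j k * B i col + d k i * B j col + d i j * B k col = 0.
  by move: col; apply: ord2_ind; rewrite /d; lia.
case: (eqVneq (d j k) 0) => [e1|/eqP n1]; last by exists (d j k), (d k i), (d i j); split=> //; constructor 1.
case: (eqVneq (d k i) 0) => [e2|/eqP n2]; last by exists (d j k), (d k i), (d i j); split=> //; constructor 2.
case: (eqVneq (d i j) 0) => [e3|/eqP n3]; last by exists (d j k), (d k i), (d i j); split=> //; constructor 3.
(* All minors vanish. If row i is nonzero, a relation between the parallel rows i and j is read off
   a nonzero entry of row i; otherwise row i alone is a relation. *)
case: (eqVneq (B i 0) 0) => [b1|/eqP n1]; last first.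
  exists (B j 0), (- B i 0), 0; split; first by constructor 2; move/eqP; rewrite oppr_eq0 => /eqP.
  by apply: ord2_ind; move: e3; rewrite /d; lia.
case: (eqVneq (B i 1) 0) => [b2|/eqP n2]; last first.
  exists (B j 1), (- B i 1), 0; split; first by constructor 2; move/eqP; rewrite oppr_eq0 => /eqP.
  by apply: ord2_ind; move: e3; rewrite /d; lia.
exists 1, 0, 0; split; first by constructor 1.
by apply: ord2_ind; rewrite ?b1 ?b2; lia.
Qed.
End Lattice.

(** * Solutions of the Horn system *)

Section Horn.
Variables (n : nat) (B : 'M[int]_(n, 2)) (c : 'I_n -> C).
Notation X := ('I_n -> C).
Variable U : X -> Prop.
Hypothesis openU : forall x, U x -> exists d, 0 < d /\ forall y, near x y d -> U y.
Hypothesis generic : ~ resonant n c.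
Notation zero := (fun _ : X => RtoC 0).

(** Indexing the Euler relations by the integer left kernel of B, in place of the rows of A, gives
    direct access to relations among two or three rows of B. *)
Definition Brel (w : X) : Prop := exists v : 'I_n -> int,
  (forall col, (\sum_l v l * B l col)%R = 0%R) /\ w = (fun j => intC (v j)).

Notation homog := (homog n U c Brel).
Notation eigenfun := (eigenfun n U c Brel).

(** The combination x e_i + y e_j + z e_k, written additively because the indices may coincide, as
    they do in [crossing]. *)
Definition comb3 (i j k : 'I_n) (x y z : int) (l : 'I_n) : int :=
  (x * (l == i)%:Z + y * (l == j)%:Z + z * (l == k)%:Z)%R.

Lemma Csum_comb3 i j k x y z (F : X) :
  Csum (fun l => intC (comb3 i j k x y z l) * F l)%C = (intC x * F i + intC y * F j + intC z * F k)%C.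
Proof.
rewrite -!Csum_delta -!Csum_plus; apply: Csum_ext => l.
by rewrite /comb3 !intC_add; ring.
Qed.

Lemma comb3_relation i j k x y z :
  (forall col, (x * B i col + y * B j col + z * B k col)%R = 0%R) ->
  forall col, (\sum_l comb3 i j k x y z l * B l col)%R = 0%R.
Proof.
move=> H col; transitivity (x * B i col + y * B j col + z * B k col)%R; last exact: H.
have E t u : (\sum_l (t * (l == u)%:Z) * B l col)%R = (t * B u col)%R.
  rewrite (bigD1 u) //= eqxx GRing.mulr1 big1 ?GRing.addr0 // => l /negbTE ->.
  by rewrite GRing.mulr0 GRing.mul0r.
by rewrite -!E -!big_split /=; apply: eq_bigr => l _; rewrite /comb3 !GRing.mulrDl.
Qed.

Lemma homog_comb3 f i j k x y z : (forall col, (x * B i col + y * B j col + z * B k col)%R = 0%R) ->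
  homog f -> forall p, U p ->
  (intC x * theta n i f p + intC y * theta n j f p + intC z * theta n k f p =
   (intC x * c i + intC y * c j + intC z * c k) * f p)%C.
Proof.
move=> H [_ Hf] p Up.
have R : Brel (fun l => intC (comb3 i j k x y z l)).
  by exists (comb3 i j k x y z); split=> //; apply: comb3_relation.
by have := Hf _ R p Up; rewrite /= !Csum_comb3.
Qed.

Lemma comb3_nonresonant i j k x y z m : (exists l, comb3 i j k x y z l <> 0%R) ->
  (intC x * c i + intC y * c j + intC z * c k)%C <> intC m.
Proof.
move=> Hl E; apply: generic; exists (comb3 i j k x y z); split=> //.
by exists m; rewrite Csum_comb3.
Qed.

(** This is where genericity acts: the same combination of the theta_l multiplies f by w.c and by
    the integer m, which differ. *)
Lemma comb3_annihilates f i j k x y z m : (forall col, (x * B i col + y * B j col + z * B k col)%R = 0%R) ->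
  (exists l, comb3 i j k x y z l <> 0%R) -> homog f ->
  eq_on U (fun p => intC x * theta n i f p + intC y * theta n j f p + intC z * theta n k f p)%C
    (fun p => intC m * f p)%C -> eq_on U f zero.
Proof.
move=> H Hl Hf Em p Up.
have := homog_comb3 f i j k x y z H Hf p Up; rewrite (Em p Up).
have N := comb3_nonresonant i j k x y z m Hl.
set u := (intC x * c i + _ + _)%C in N * => E.
case: (Ceq_dec (f p) 0%C) => // f0; case: N.
have -> : u = (u * f p / f p)%C by field.
by rewrite -E; field.
Qed.

Lemma triple_collision (i j k : 'I_n) (l1 l2 l3 : nat) p h : i <> j -> i <> k -> j <> k -> eigenfun p h ->
  p i = RtoC (INR l1) -> p j = RtoC (INR l2) -> p k = RtoC (INR l3) -> eq_on U h zero.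
Proof.
move=> /eqP ij /eqP ik /eqP jk [Hh Eh] pi pj pk.
have [x [y [z [nz H]]]] := three_relation n B i j k.
apply: (comb3_annihilates h i j k x y z (x * l1%:Z + y * l2%:Z + z * l3%:Z)%R H) => //.
  case: nz => nz; [exists i | exists j | exists k]; rewrite /comb3 eqxx.
  - by rewrite (negbTE ij) (negbTE ik); lia.
  - by rewrite eq_sym (negbTE ij) (negbTE jk); lia.
  - by rewrite eq_sym (negbTE ik) eq_sym (negbTE jk); lia.
move=> q Uq; rewrite !Eh // pi pj pk !intC_add !intC_mul !intC_nat; ring.
Qed.

Lemma theta_sub_zeroE q f p : eq_on U (theta_sub n q f) zero -> U p -> theta n q.1 f p = (RtoC (INR q.2) * f p)%C.
Proof.
move=> H Up; have := H p Up; rewrite /theta_sub /add_scaled => E.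
by rewrite -(Cplus_0_r (RtoC (INR q.2) * f p)%C) -E; ring.
Qed.

Lemma eigenfun_zero p f : eq_on U f zero -> eigenfun p f.
Proof.
move=> E; apply: (eigenfun_eq_on _ _ openU _ _ _ _ _ (eq_on_sym E)); split; first exact: homog_zero.
by move=> k x Ux; rewrite (theta_const n U) //; ring.
Qed.

Lemma crossing (q r : 'I_n * nat) f : (0 < B q.1 0)%R -> (B r.1 0 < 0)%R -> homog f ->
  eq_on U (theta_sub n q f) zero -> eq_on U (theta_sub n r f) zero ->
  exists p, [/\ eigenfun p f, p q.1 = RtoC (INR q.2) & p r.1 = RtoC (INR r.2)].
Proof.
case: q r => [i l] [j m] /= Bi Bj Hf Tq Tr.
have ij : i != j by apply: contraTneq Bi => ->; lia.
have Ei p : U p -> theta n i f p = (RtoC (INR l) * f p)%C := fun Up => theta_sub_zeroE (i, l) f p Tq Up.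
have Ej p : U p -> theta n j f p = (RtoC (INR m) * f p)%C := fun Up => theta_sub_zeroE (j, m) f p Tr Up.
pose D : int := (B i 0 * B j 1 - B i 1 * B j 0)%R.
case: (eqVneq D 0%R) => [D0|/eqP D0].
  (* Proportional rows: the relation between rows i and j forces f = 0, so any p with the two
     prescribed values will do. *)
  exists (fun k => if k == i then RtoC (INR l) else RtoC (INR m)).
  rewrite eqxx eq_sym (negbTE ij); split=> //; apply: eigenfun_zero.
  apply: (comb3_annihilates f i j i (B j 0%R) (- B i 0)%R 0%R (B j 0 * l%:Z - B i 0 * m%:Z)%R) => //.
  - by apply: ord2_ind; move: D0; rewrite /D; lia.
  - by exists j; rewrite /comb3 eqxx eq_sym (negbTE ij); lia.
  move=> p Up; rewrite Ei // Ej // intC_add !intC_opp !intC_mul !intC_nat.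
  have -> : INR 0 = 0 by [].
  ring.
have D0' := intC_neq0 _ D0.
(* Cramer's rule: x_k B_i + y_k B_j + D B_k = 0, so the corresponding Euler relation can be solved
   for theta_k f. *)
pose x k := (B j 0 * B k 1 - B j 1 * B k 0)%R.
pose y k := (B k 0 * B i 1 - B k 1 * B i 0)%R.
exists (fun k => ((intC (x k) * (c i - RtoC (INR l)) + intC (y k) * (c j - RtoC (INR m)) + intC D * c k) / intC D)%C).
split.
- split=> // k p Up.
  have H := homog_comb3 f i j k (x k) (y k) D _ Hf p Up.
  rewrite Ei // Ej // in H.
  have {H} H : (intC D * theta n k f p = (intC (x k) * (c i - RtoC (INR l)) + intC (y k) * (c j - RtoC (INR m)) + intC D * c k) * f p)%C.
    apply: (@Logic.eq_trans _ _ ((intC (x k) * (RtoC (INR l) * f p) + intC (y k) * (RtoC (INR m) * f p) + intC D * theta n k f p)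
      - (intC (x k) * (RtoC (INR l) * f p) + intC (y k) * (RtoC (INR m) * f p)))%C); first ring.
    by rewrite H; [ring | apply: ord2_ind; rewrite /x /y /D; lia].
  have -> : theta n k f p = (intC D * theta n k f p / intC D)%C by field.
  by rewrite H; field.
- have -> : x i = (- D)%R by rewrite /x /D; lia.
  have -> : y i = 0%R by rewrite /y; lia.
  rewrite intC_opp; have -> : intC 0%R = 0%C by [].
  by field.
- have -> : x j = 0%R by rewrite /x; lia.
  have -> : y j = (- D)%R by rewrite /y /D; lia.
  rewrite intC_opp; have -> : intC 0%R = 0%C by [].
  by field.
Qed.

(** Linear algebra at each point x: the vector with entries theta_j f - c_j f is orthogonal to the
    rows of A, hence to N w and to w. *)
Lemma homog_of_euler (A : 'M[int]_(n - 2, n)) f : qrank B = 2%N -> qrank A = (n - 2)%N ->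
  (A *m B)%R = 0%R -> holo U f ->
  (forall x, U x -> forall k : 'I_(n - 2),
         Cminus (Csum (fun j => Cmult (Cmult (intC (A k j)) (x j)) (pderiv j f x)))
                (Cmult (Csum (fun j => Cmult (intC (A k j)) (c j))) (f x)) = RtoC 0) -> homog f.
Proof.
move=> rB rA AB Hf HA; split=> // _ [w [wB ->]] x Ux.
have [N [y [/eqP N0 Ny]]] := relation_row_span n A B w rB rA AB wB.
pose v j := (theta n j f x - f x * c j)%C.
have Ev (g : 'I_n -> int) : Csum (fun j => intC (g j) * v j)%C =
    (Csum (fun j => intC (g j) * theta n j f x) - Csum (fun j => intC (g j) * c j) * f x)%C.
  have -> : (Csum (fun j => intC (g j) * theta n j f x) - Csum (fun j => intC (g j) * c j) * f x =
     Csum (fun j => intC (g j) * theta n j f x) + (- f x) * Csum (fun j => intC (g j) * c j))%C by ring.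
  by rewrite -Csum_add_scaled; apply: Csum_ext => j; rewrite /v; ring.
have HAv k : Csum (fun j => intC (A k j) * v j)%C = 0%C.
  rewrite Ev -(HA x Ux k); congr (_ - _)%C; apply: Csum_ext => j; rewrite /theta; ring.
have H : (intC N * Csum (fun j => intC (w j) * v j) = 0)%C.
  rewrite -Csum_scal.
  transitivity (Csum (fun j => Csum (fun k => intC (y k) * (intC (A k j) * v j)))%C).
    apply: Csum_ext => j; rewrite Cmult_assoc -intC_mul Ny intC_sum Cmult_comm -Csum_scal.
    by apply: Csum_ext => k; rewrite intC_mul; ring.
  rewrite Csum_exchange (Csum_ext _ _ (fun _ => 0%C)) ?Csum_zero // => k.
  by rewrite Csum_scal HAv; ring.
have N1 := intC_neq0 _ N0.
have E : Csum (fun j => intC (w j) * v j)%C = 0%C.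
  have -> : Csum (fun j => intC (w j) * v j)%C = (intC N * Csum (fun j => intC (w j) * v j) / intC N)%C by field.
  by rewrite H; field.
rewrite Ev in E.
by rewrite -(Cplus_0_r (Csum (fun j => intC (w j) * c j) * f x)%C) -E; ring.
Qed.
End Horn.

Close Scope R_scope.

Theorem theorem8p6 (n : nat) (hn : (2 < n)%N)
  (B : 'M[int]_(n, 2)) (A : 'M[int]_(n - 2, n))
  (hBrank : qrank B = 2%N)
  (hBsum : (\sum_(i < n) row i B)%R = 0%R)
  (hArank : qrank A = (n - 2)%N)
  (hA1 : forall (k : 'I_(n - 2)) (j : 'I_n), val k = 0%N -> A k j = 1%R)
  (hAB : (A *m B)%R = 0%R)
  (alpha : 'I_n -> nat)
  (halpha : forall i : 'I_n, (0 < alpha i)%N -> (0 < B i 0)%R) :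
  exists E : ('I_n -> C) -> Prop, null_set E /\
    forall c : 'I_n -> C, ~ E c ->
      forall (a : 'I_n -> C) (r : 'I_n -> R), torus_polydisc a r ->
        forall f : ('I_n -> C) -> C,
          is_solution A B alpha c (polydisc a r) f -> puiseux_on a r f.
Proof.
exists (resonant n); split; first by apply: null_resonant; lia.
move=> c generic a r Ht f [holf sol].
have oU := polydisc_open n a r.
have Hf : holo (polydisc a r) f by apply/holo_holomorphic.
have homog_f : homog n (polydisc a r) c (Brel n B) f.
  by apply: (homog_of_euler n B c _ A) => // x Ux k; case: (sol x Ux) => _ [_ ->].
have fa : eq_on (polydisc a r) (dpow alpha f) (fun _ => RtoC 0) by move=> x /sol [_ []].
have [|i ai|k fk] := dpow_nilpotent n (polydisc a r) oU f alpha
    (fun i => intpos (B i 0%R)) (fun i => intneg (B i 0%R)) Hf _ fa.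
- by move=> x /sol [-> _].
- by have := halpha i ai; case: (B i 0%R).
(* [beta] is k u-, so its factors have indices with u_i < 0, while those of [alpha] have u_i > 0:
   these are the two families to be peeled off. *)
set beta := (fun i => (k * intneg (B i 0%R))%N) in fk.
apply: (eigensum_puiseux_on n a r c (Brel n B) _ f Ht).
apply: (eigensum_of_theta_prod n (polydisc a r) oU c (Brel n B) (fun i => (0 < B i 0)%R) (fun i => (B i 0 < 0)%R)
  _ _ _ (factors n alpha (enum 'I_n)) (factors n beta (enum 'I_n))) => //.
- by move=> i; lia.
- by move=> i j m l1 l2 l3 p h; apply: triple_collision.
- by move=> q s g; apply: crossing.
- by move=> q /mem_factors /andP[_ H]; apply: halpha; exact: leq_ltn_trans (leq0n _) H.
- by move=> q /mem_factors /andP[_]; rewrite /beta; case: (B q.1 0%R) => //= m; rewrite muln0.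
- by apply: uniq_factors; apply: enum_uniq.
- by apply: uniq_factors; apply: enum_uniq.
- exact: theta_prod_factors_zero.
- exact: theta_prod_factors_zero.
Qed.
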